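(* Let $\alpha>0$ and let $X(t)$, $t\in\mathbb{R}$, be a stochastically continuous stationary max-stable process with Fréchet marginals $\Phi_\alpha(x)=e^{-x^{-\alpha}}$, $x>0$, with locally bounded sample paths and spectral process $Z$. Then the generalised Pickands constant $\mathcal{H}$ of $X$ satisfies $\mathcal{H}>0$ if and only if $$\mathbb{P}\{\mathcal{S}(Z)<\infty\}>0,\qquad \mathcal{S}(Z)=\int_{\mathbb{R}}Z^\alpha(t)\,\lambda(dt).$$
   Context: $\lambda$ is Lebesgue measure on $\mathbb{R}$. A process is max-stable if its finite-dimensional distributions are max-stable multivariate distributions. A non-negative process $Z(t)$, $t\in\mathbb{R}$, is a spectral process of $X$ if, in the sense of equality of finite-dimensional distributions, $$X(t)=\max_{i\ge1}P_iZ^{(i)}(t),\quad t\in\mathbb{R}\quad\text{(de Haan representation)},$$ where $\sum_i\varepsilon_{P_i}$ is a Poisson point process on $[0,\infty)$ with intensity $\alpha x^{-\alpha-1}dx$, independent of the $Z^{(i)}$, which are independent copies of $Z$. The marginal assumption on $X$ means $\mathbb{E}\{Z^\alpha(t)\}=1$ for all $t$. Standing assumptions: $X$ and $Z$ are jointly measurable, separable and have locally bounded sample paths. The generalised Pickands constant is $\mathcal{H}=\lim_{T\to\infty}\frac1T\mathbb{E}\{\sup_{t\in[0,T]}Z^\alpha(t)\}$; the limit exists, is finite, and depends only on $X$ and not on the choice of $Z$.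
   Formalization: The theorem additionally assumes that almost surely the path of the spectral process Z is not identically zero; without this the claim fails, e.g. for Z(t)=V with V equal to 2^{1/α} or 0 with probability 1/2 each. *)

(* Defs.v *)
From mathcomp Require Import all_boot all_order all_algebra.
From mathcomp Require Import all_classical all_reals all_analysis.
From mathcomp Require Import measurable_realfun.
Import Order.TTheory GRing.Theory Num.Theory.
Import numFieldNormedType.Exports.

Set Implicit Arguments.
Unset Strict Implicit.
Unset Printing Implicit Defensive.

Local Open Scope classical_set_scope.
Local Open Scope ring_scope.

(* A real-valued process indexed by the real line is a
   curried map R -> W -> R, time first, on a probability space (W, P). *)

Definition jointly_measurable (R : realType) (d : measure_display)
    (W : measurableType d) (Y : R -> W -> R) : Prop :=
  measurable_fun setT (fun p : measurableTypeR R * W => Y p.1 p.2).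

(* Separability in the sense of Doob, relative to the closed sets. *)
Definition separable_process (R : realType) (d : measure_display)
    (W : measurableType d) (P : probability W R) (Y : R -> W -> R) : Prop :=
  exists D : set R,
    [/\ countable D, dense D &
      {ae P, forall w, forall I F : set R, open I -> closed F ->
        (forall s, (I `&` D) s -> F (Y s w)) -> forall t, I t -> F (Y t w)}].

Definition locally_bounded_paths (R : realType) (d : measure_display)
    (W : measurableType d) (P : probability W R) (Y : R -> W -> R) : Prop :=
  {ae P, forall w, forall a b : R,
    exists M : R, forall t, a <= t <= b -> `|Y t w| <= M}.

Definition regular_process (R : realType) (d : measure_display)
    (W : measurableType d) (P : probability W R) (Y : R -> W -> R) : Prop :=
  [/\ jointly_measurable Y, separable_process P Y & locally_bounded_paths P Y].

Definition same_fdd (R : realType) (dT : measure_display)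
    (T : measurableType dT)
    (d1 d2 : measure_display) (W1 : measurableType d1) (W2 : measurableType d2)
    (P1 : probability W1 R) (P2 : probability W2 R)
    (Y1 : R -> W1 -> T) (Y2 : R -> W2 -> T) : Prop :=
  forall (n : nat) (t : 'I_n -> R) (A : set (n.-tuple T)), measurable A ->
    P1 [set w | A [tuple Y1 (t i) w | i < n]] =
    P2 [set w | A [tuple Y2 (t i) w | i < n]].

Definition stationary (R : realType) (d : measure_display)
    (W : measurableType d) (P : probability W R) (Y : R -> W -> R) : Prop :=
  forall h : R, same_fdd P P Y (fun t => Y (t + h)).

Definition stochastically_continuous (R : realType) (d : measure_display)
    (W : measurableType d) (P : probability W R) (Y : R -> W -> R) : Prop :=
  forall t e : R, 0 < e ->
    P [set w | e <= `|Y s w - Y t w|] @[s --> t] --> 0%E.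

Definition joint_cdf (R : realType) (d : measure_display)
    (W : measurableType d) (P : probability W R) (Y : R -> W -> R)
    (n : nat) (t x : 'I_n -> R) : \bar R :=
  P [set w | forall i, Y (t i) w <= x i].

(* A distribution function G on R^n is max-stable if for every k >= 1 there
   are norming vectors a > 0 and b with G(a x + b)^k = G(x) for all x. *)
Definition max_stable (R : realType) (d : measure_display)
    (W : measurableType d) (P : probability W R) (Y : R -> W -> R) : Prop :=
  forall (n : nat) (t : 'I_n -> R) (k : nat), (0 < k)%N ->
    exists a b : 'I_n -> R, (forall i, 0 < a i) /\
      forall x : 'I_n -> R,
        (joint_cdf P Y t (fun i => a i * x i + b i)%R ^+ k)%E =
        joint_cdf P Y t x.

Definition frechet_marginals (R : realType) (d : measure_display)
    (W : measurableType d) (P : probability W R) (alpha : R)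
    (Y : R -> W -> R) : Prop :=
  forall t x : R, 0 < x ->
    P [set w | Y t w <= x] = (expR (- (x `^ (- alpha))))%:E.

Definition sigma_of (d : measure_display) (W : measurableType d)
    (dT : measure_display) (T : measurableType dT) (I : Type)
    (Y : I -> W -> T) : set (set W) :=
  <<s \bigcup_i preimage_set_system setT (Y i) measurable >>.

Definition mutually_independent (R : realType) (d : measure_display)
    (W : measurableType d) (P : probability W R) (I : eqType)
    (F : I -> set (set W)) : Prop :=
  forall (s : seq I) (A : I -> set W), uniq s ->
    (forall i, i \in s -> F i (A i)) ->
    P (\bigcap_(i in [set` s]) A i) = (\prod_(i <- s) P (A i))%E.

Definition independent2 (R : realType) (d : measure_display)
    (W : measurableType d) (P : probability W R) (F G : set (set W)) : Prop :=
  forall A B : set W, F A -> G B -> P (A `&` B) = (P A * P B)%E.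

(* The number of points of the sequence p, with multiplicity, lying in A. *)
Definition point_count (R : realType) (d : measure_display)
    (W : measurableType d) (p : nat -> W -> R) (A : set R) (w : W) : \bar R :=
  (\sum_(0 <= i <oo) (\1_A (p i w))%:E)%E.

(* The sequence p enumerates a Poisson point process with intensity mu.  The
   Poisson weights are written out because [poisson_pmf] is constantly 1 at
   rate 0, whereas the formula below is then the point mass at 0. *)
Definition poisson_point_process (R : realType) (d : measure_display)
    (W : measurableType d) (P : probability W R) (p : nat -> W -> R)
    (mu : set R -> \bar R) : Prop :=
  [/\ forall i, measurable_fun setT (p i),
      forall A : set R, measurable A -> (mu A < +oo)%E ->
        forall k : nat, P [set w | point_count p A w = k%:R%:E] =
          (expR (- fine (mu A)) * fine (mu A) ^+ k / k`!%:R)%:E,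
      forall A : set R, measurable A -> mu A = +oo%E ->
        P [set w | point_count p A w = +oo%E] = 1%E &
      forall (n : nat) (A : 'I_n -> set R),
        (forall i, measurable (A i)) -> trivIset setT A ->
        mutually_independent P
          (fun i => preimage_set_system setT (point_count p (A i))
                     measurable)].

Definition frechet_intensity (R : realType) (alpha : R) (A : set R) : \bar R :=
  (\int[lebesgue_measure]_(x in (A `&` `]0%R, +oo[))
     (alpha * x `^ (- alpha - 1))%:E)%E.

(* The de Haan representation: the Poisson points p and the independent copies
   Zc of Z live on some auxiliary probability space, and only the
   finite-dimensional distributions of X enter.  Independence is required of
   the enumeration p, not merely of the induced random counting measure: the
   order in which the points are matched with the copies must not depend on
   the copies. *)
Definition spectral_process (R : realType) (alpha : R)
    (dX : measure_display) (WX : measurableType dX) (PX : probability WX R)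
    (X : R -> WX -> R)
    (dZ : measure_display) (WZ : measurableType dZ) (PZ : probability WZ R)
    (Z : R -> WZ -> R) : Prop :=
  (forall t w, 0 <= Z t w) /\
  exists (d : measure_display) (W : measurableType d) (Q : probability W R)
      (p : nat -> W -> R) (Zc : nat -> R -> W -> R),
    [/\ poisson_point_process Q p (frechet_intensity alpha),
        forall i w, 0 <= p i w,
        (forall i t, measurable_fun setT (Zc i t)) /\
        (forall i, same_fdd PZ Q Z (Zc i)),
        mutually_independent Q (fun i => sigma_of (Zc i)) /\
        independent2 Q (sigma_of p)
          (sigma_of (fun it : nat * R => Zc it.1 it.2)) &
        same_fdd PX Q (fun t w => (X t w)%:E)
          (fun t w => ereal_sup (range (fun i => (p i w * Zc i t w)%:E)))].

(* Paths of a spectral process do not vanish identically, almost surely.  The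
   representation alone does not ensure this: if V is 2^(1/alpha) or 0 with
   probability 1/2 each, the constant-in-time process Z(t) = V represents
   X(t) = X(0), for which the Pickands constant is 0, although the integral of
   Z^alpha is 0, hence finite, with probability 1/2. *)
Definition nonvanishing_paths (R : realType) (d : measure_display)
    (W : measurableType d) (P : probability W R) (Z : R -> W -> R) : Prop :=
  {ae P, forall w, exists t, Z t w != 0}.

(* The supremum over [0, T] need not be measurable in w, but for a separable
   process it coincides off a null event with a countable supremum, and the
   integral of a nonnegative function ignores null events. *)
Definition pickands_constant (R : realType) (d : measure_display)
    (W : measurableType d) (P : probability W R) (alpha : R)
    (Z : R -> W -> R) : \bar R :=
  lim ((T^-1)%:E *
       (\int[P]_w ereal_sup [set (Z t w `^ alpha)%:E | t in `[0%R, T]])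
       @[T --> +oo%R])%E.

Definition path_integral (R : realType) (d : measure_display)
    (W : measurableType d) (alpha : R) (Z : R -> W -> R) (w : W) : \bar R :=
  (\int[lebesgue_measure]_(t in setT) (Z t w `^ alpha)%:E)%E.

(* Main.v *)
Require Import Defs.
From mathcomp Require Import all_boot all_order all_algebra.
From mathcomp Require Import all_classical all_reals all_analysis.
From mathcomp Require Import measurable_realfun lra zify.
Import Order.TTheory GRing.Theory Num.Theory.
Import numFieldNormedType.Exports.
Set Implicit Arguments.
Unset Strict Implicit.
Unset Printing Implicit Defensive.
Local Open Scope classical_set_scope.
Local Open Scope ring_scope.

(** Write [Y = Z^alpha] and [H] for the Pickands constant.  The Poisson
    representation gives [P (X t_i <= 1 / b_i for all i) =
    exp (- E max_i b_i^alpha Y t_i)], so stationarity of [X] makes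
    [E max_i c_i Y t_i] invariant under time shifts.  Differentiating in one
    coefficient shows that, under the measure [Y t dP], the law of the path
    [s |-> Y (s + t) / Y t] does not depend on [t]; hence [E [Y (s + t); A]] is
    invariant under simultaneous shifts of [t] and of any event [A] on paths
    that is stable under multiplication by positive scalars.

    Cut the line into unit windows.  Splitting the maximum of [N] consecutive
    window suprema according to the window that attains it first gives
    [H = E [W_0; W_0 is the first maximum]], where [W_0] is the supremum of [Y]
    over the window at 0 and all windows of the line compete.  The shifts of
    this event are disjoint, so by invariance [E [S(Z); W_0 is the first
    maximum] <= 1]: if [H > 0], then [S(Z)] is finite with positive probability.

    Conversely let [c_q = E [Y 0; sum_(j >= 0) min (Y j, Y 0) <= q Y 0]].  A
    deterministic inequality bounds the sum of the terms [Y k] with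
    [sum_j min (Y (k + j), Y k) <= q Y k] by [q max_k Y k], whence
    [c_q <= q H].  If all [c_q] vanish, then [Y u = 0] almost surely on
    [sum_j Y (u + j) < oo], so for almost every [u], and by continuity for every
    [u], [Y u = 0] almost surely on [S(Z) < oo]; as the paths are separable and
    do not vanish identically, [S(Z) = oo] almost surely. *)

(** * Poisson processes with independent marks *)

(** The representation yields finite-dimensional laws only, while windows and peaks involve a
    continuum of times. Paths are therefore sampled at the times [e i + k], [k] an integer, the
    [e i] being the fractional parts of an enumeration of a separating set. Every window is then an
    integer translate of one countable set of times, so that shift invariance passes from single
    times to finite maxima by splitting the event, and to window suprema by monotone limits. Events
    stable under scaling are the right ones because the tilted law sees only the ratios
    [Y (s + t) / Y t]; being the first maximum and the condition defining c_q are both homogeneous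
    in the path. The exponential formula also carries two properties of [X] over to [Y]. For some M
    the probability that X <= M at all times [e i] is positive, and its logarithm bounds E W_0.
    Stochastic continuity keeps P (X s <= 1, X t <= 1) close to exp (-1), hence E max (Y s, Y t)
    close to 1; this is the continuity in mean that turns almost every u into every u. The limit
    defining H is not assumed to exist: the windows bound the mean supremum over [0, T] from both
    sides. *)

Lemma set_consU (T : eqType) (x : T) (s : seq T) :
  [set` x :: s] = x |` [set` s].
Proof.
apply/seteqP; split=> y /=; rewrite inE; first by case/predU1P; [left|right].
by case=> [->|->]; rewrite ?eqxx ?orbT.
Qed.

Lemma powR_continuous (R : realType) (r a : R) : 0 < a ->
  {for a, continuous (fun x : R => x `^ r)}.
Proof.
move=> a0; apply: (@differentiable_continuous _ R^o R^o _ (fun x : R => x `^ r)); apply/derivable1_diffP.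
by apply: derivable_powR; rewrite in_itv/= andbT.
Qed.

Lemma frechet_intensity_ray (R : realType) (alpha a : R) : 0 < alpha -> 0 < a ->
  frechet_intensity alpha `]a, +oo[ = (a `^ (- alpha))%:E.
Proof.
move=> al0 a0; rewrite /frechet_intensity.
have -> : `]a, +oo[%classic `&` `]0%R, +oo[%classic = `]a, +oo[%classic :> set R.
  apply/seteqP; split=> x /=; rewrite !in_itv/= !andbT; first by case.
  by move=> ax; split=> //; exact: lt_trans ax.
have mf : measurable_fun setT (fun x : R => alpha * x `^ (- alpha - 1)).
  by apply: measurable_funM => //; exact: measurable_powR.
rewrite integral_itv_obnd_cbnd; last first.
  by apply/measurable_EFinP; exact: measurable_funTS.
rewrite (@ge0_continuous_FTC2y R _ (fun x => - (x `^ (- alpha))) a 0).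
- by rewrite EFinN sub0e oppeK.
- by move=> x _; rewrite mulr_ge0 ?powR_ge0// ltW.
- apply: continuous_in_subspaceT => x; rewrite inE/= in_itv/= andbT => ax.
  apply: cvgM; first exact: cvg_cst.
  by apply: powR_continuous; exact: lt_le_trans ax.
- rewrite -oppr0; apply: cvgN.
  have : (x `^ alpha)^-1 @[x --> +oo] --> (0:R).
    apply/gtr0_cvgV0.
      near=> x; apply: powR_gt0; near: x; exact: nbhs_pinfty_gt.
    apply/cvgryPge => M; near=> x.
    have x0 : 0 < x by near: x; exact: nbhs_pinfty_gt.
    have : (Num.max M 0) `^ (alpha^-1) <= x.
      by near: x; exact: nbhs_pinfty_ge.
    move=> /(@ge0_ler_powR _ alpha (ltW al0)); rewrite !nnegrE.
    rewrite powR_ge0 ltW// => /(_ erefl erefl).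
    rewrite -powRrM mulVf ?gt_eqF// powRr1 ?le_max ?lexx ?orbT//.
    by apply: le_trans; rewrite le_max lexx.
  apply: cvg_trans; apply: near_eq_cvg; near=> x.
  by rewrite powRN.
- move=> x ax; apply: derivableN.
  by apply: derivable_powR; rewrite in_itv/= andbT (lt_trans a0).
- apply: cvg_at_right_filter; apply: cvgN.
  exact: powR_continuous.
- move=> x; rewrite in_itv/= andbT => ax.
  rewrite derive1N; last first.
    by apply: derivable_powR; rewrite in_itv/= andbT (lt_trans a0).
  rewrite powR_derive1 ?in_itv/= ?andbT ?(lt_trans a0)//.
  by rewrite mulNr opprK.
Unshelve. all: by end_near. Qed.

(** Each [F i] is discrete, with value [f i m] on [E i m], and the induction fixes these values one
    index at a time. [B] collects the values already fixed; independence is assumed for all sublists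
    so that it survives the replacement of [B] by [B] intersected with [E i m]. *)
Lemma integral_prod_of_independent (R : realType) (d : measure_display)
    (W : measurableType d) (Q : probability W R) (I : eqType)
    (E : I -> nat -> set W) (F : I -> W -> R) (f : I -> nat -> R) (g : I -> R)
    (s : seq I) (B : set W) :
  (forall i m, measurable (E i m)) -> (forall i, trivIset setT (E i)) ->
  (forall i, i \in s -> Q (\bigcup_m E i m) = 1%E) ->
  (forall i, measurable_fun setT (F i)) -> (forall i w, 0 <= F i w) ->
  (forall i m w, E i m w -> F i w = f i m) -> (forall i m, 0 <= f i m) ->
  (forall i, i \in s ->
    \sum_(0 <= m <oo) ((f i m)%:E * Q (E i m)) = (g i)%:E)%E ->
  measurable B -> uniq s ->
  (forall (s' : seq I) (m : I -> nat), uniq s' -> {subset s' <= s} ->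
     Q (B `&` \bigcap_(i in [set` s']) E i (m i)) =
     (Q B * \prod_(i <- s') Q (E i (m i)))%E) ->
  (\int[Q]_(w in B) (\prod_(i <- s) F i w)%:E =
   Q B * (\prod_(i <- s) g i)%:E)%E.
Proof.
move=> mE tE cE mF F0 FE f0.
elim: s B cE => [|i s IH] B cE gE mB; rewrite ?cons_uniq.
  move=> _ _; under eq_integral do rewrite big_nil.
  by rewrite big_nil integral_cst// mul1e mule1.
move=> /andP[iNs us] ind.
have mP (t : seq I) : measurable_fun setT (fun w => \prod_(j <- t) F j w).
  by apply: measurable_prod.
have P0 (t : seq I) w : (0 <= (\prod_(j <- t) F j w)%:E)%E.
  by rewrite lee_fin; apply: prodr_ge0.
have mBE m : measurable (B `&` E i m) by exact: measurableI.
have mU : measurable (\bigcup_m E i m) by exact: bigcup_measurable.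
transitivity (\int[Q]_(w in \bigcup_m (B `&` E i m))
    (\prod_(j <- i :: s) F j w)%:E)%E.
  rewrite -setI_bigcupr (@ge0_negligible_integral _ _ _ _ B (~` \bigcup_m E i m))//.
  - by rewrite setDE setCK.
  - exact: measurableC.
  - by apply/measurable_EFinP; exact: measurable_funTS.
  - by rewrite [LHS]probability_setC// cE ?mem_head// subee.
rewrite ge0_integral_bigcup//; last 2 first.
  - by apply/measurable_EFinP; exact: measurable_funTS.
  - by apply: trivIset_setIl.
have QBfin : Q B \is a fin_num by exact: fin_num_measure.
rewrite big_cons EFinM muleCA muleC -(gE i) ?mem_head//.
rewrite -[Q B in RHS]fineK// -EFinM -nneseriesZl; last first.
  by move=> m _; rewrite mule_ge0// lee_fin.
apply: eq_eseriesr => m _.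
transitivity ((f i m)%:E * \int[Q]_(w in B `&` E i m)
    (\prod_(j <- s) F j w)%:E)%E.
  rewrite -ge0_integralZl_EFin//; last first.
    by apply/measurable_EFinP; exact: measurable_funTS.
  apply: eq_integral => w; rewrite inE => -[_ Ew].
  by rewrite big_cons EFinM (FE _ m).
rewrite IH//.
- have := ind [:: i] (fun=> m) erefl.
  rewrite set_cons1 bigcap_set1 big_seq1 => ->; last first.
    by move=> j; rewrite !inE => ->.
  by rewrite EFinM fineK// [RHS]muleCA -!muleA; do 2 congr (_ * _)%E; exact: muleC.
- by move=> j js; apply: cE; rewrite inE js orbT.
- by move=> j js; apply: gE; rewrite inE js orbT.
- move=> s' m' us' s's.
  have iNs' : i \notin s' by apply: contra iNs => /s's.
  pose m2 j := if j == i then m else m' j.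
  have m2E j : j \in s' -> m2 j = m' j.
    by rewrite /m2; case: eqVneq => // -> /(negP iNs').
  have := ind (i :: s') m2; rewrite cons_uniq iNs' us' => /(_ erefl).
  have h : {subset i :: s' <= i :: s}.
    by move=> j; rewrite !inE => /orP[->//|/s's ->]; rewrite orbT.
  move=> /(_ h); rewrite set_consU bigcap_setU1 setIA /m2 eqxx => e.
  have -> : \bigcap_(j in [set` s']) E j (m' j) =
            \bigcap_(j in [set` s']) E j (if j == i then m else m' j).
    by apply: eq_bigcapr => j /= js; rewrite -/(m2 j) m2E.
  rewrite e big_cons eqxx muleA.
  have := ind [:: i] (fun=> m) erefl.
  rewrite set_cons1 bigcap_set1 big_seq1 => ->; last first.
    by move=> j; rewrite !inE => ->.
  congr (_ * _)%E; rewrite big_seq [in RHS]big_seq; apply: eq_bigr => j js.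
  by rewrite -/(m2 j) m2E.
Qed.

(** The probability generating function of the Poisson law. *)
Lemma poisson_generating_series (R : realType) (mu x : R) : 0 <= mu -> 0 <= x ->
  (\sum_(0 <= m <oo) ((x ^+ m)%:E * (expR (- mu) * mu ^+ m / m`!%:R)%:E) =
   (expR (- (mu * (1 - x))))%:E)%E.
Proof.
move=> mu0 x0.
transitivity (\sum_(0 <= m <oo)
    ((expR (- mu))%:E * ((mu * x) ^+ m / m`!%:R)%:E))%E.
  apply: eq_eseriesr => m _; rewrite -!EFinM; congr EFin.
  by rewrite exprMn !mulrA; congr (_ / _); rewrite -mulrA mulrC.
rewrite nneseriesZl; last first.
  by move=> m _; rewrite lee_fin divr_ge0// exprn_ge0// mulr_ge0.
rewrite mulrBr mulr1 opprB addrC expRD EFinM; congr (_ * _)%E.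
have h := @is_cvg_series_exp_coeff R (mu * x).
rewrite expRE -EFin_lim; last first.
  by rewrite /pseries/=; under eq_fun do rewrite mulrC; exact: h.
apply/congr_lim/funext => m/=; rewrite /pseries/= /series/= -sumEFin//.
by under eq_bigr do rewrite mulrC.
Qed.

Lemma measurable_point_count (R : realType) (d : measure_display)
    (W : measurableType d) (p : nat -> W -> R) (A : set R) :
  (forall i, measurable_fun setT (p i)) -> measurable A ->
  measurable_fun setT (point_count p A).
Proof.
move=> mp mA; apply: ge0_emeasurable_sum => [i w _ _|i _].
  by rewrite lee_fin.
by apply/measurable_EFinP; apply: measurableT_comp => //; exact: measurable_indic.
Qed.

(** Cells of weight 1 are left out of the regrouped product because they may have infinite
    intensity, in which case their counts have no finite limit as [N] grows. *)
Lemma prod_cells (R : realType) (n : nat) (phi : 'I_n -> R) (c : nat -> 'I_n)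
    (N : nat) :
  \prod_(l < N) phi (c l) =
  \prod_(k < n | phi k != 1) phi k ^+ (\sum_(l < N) (c l == k))%N.
Proof.
transitivity (\prod_(l < N) \prod_(k < n | phi k != 1) phi k ^+ (c l == k)).
  apply: eq_bigr => l _; have [e|ne] := eqVneq (phi (c l)) 1.
    rewrite big1 ?e// => k /negP ne; case: eqVneq => [ck|_]; last by rewrite expr0.
    by exfalso; apply: ne; rewrite -ck e.
  rewrite (bigD1 (c l))//= eqxx expr1 big1 ?mulr1// => k /andP[_ kc].
  by rewrite eq_sym (negbTE kc) expr0.
rewrite exchange_big/=; apply: eq_bigr => k _.
elim/big_ind2: _ => [|x1 x2 y1 y2 -> ->|//]; first by rewrite expr0.
by rewrite exprD.
Qed.

(** Partial counts are integers increasing to [m], so they equal [m] once they are at distance less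
    than 1 from it. *)
Lemma point_count_eventually (R : realType) (d : measure_display)
    (W : measurableType d) (p : nat -> W -> R) (A : set R) (w : W) (m : nat) :
  point_count p A w = m%:R%:E ->
  \forall N \near \oo, (\sum_(l < N) (p l w \in A))%N = m.
Proof.
pose c N := (\sum_(l < N) (p l w \in A))%N.
have cE N : (\sum_(0 <= l < N) (\1_A (p l w))%:E)%E = (c N)%:R%:E :> \bar R.
  rewrite (sumEFin (index_iota 0 N) xpredT (fun l => \1_A (p l w))) big_mkord.
  by rewrite /c natr_sum; congr EFin; apply: eq_bigr.
have cnd : nondecreasing_seq (fun N => (c N)%:R%:E : \bar R).
  apply/nondecreasing_seqP => N; rewrite lee_fin ler_nat /c big_ord_recr/=.
  exact: leq_addr.
have cv : ((c N)%:R%:E : \bar R) @[N --> \oo] --> point_count p A w.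
  rewrite /point_count.
  under [X in _ --> limn X]eq_fun do rewrite cE.
  exact: ereal_nondecreasing_is_cvgn.
move=> e; rewrite e in cv.
have cle N : (c N <= m)%N.
  rewrite -(ler_nat R) -lee_fin.
  rewrite -(cvg_lim _ cv)// (cvg_lim _ (ereal_nondecreasing_cvgn cnd))//.
  by apply: ereal_sup_ubound; exists N.
have /fine_cvgP[_ /cvgrPdist_lt/(_ 1 ltr01)] := cv.
apply: filterS => N /=; rewrite -/(c N) ger0_norm ?subr_ge0 ?ler_nat//.
rewrite ltrBlDr nat1r ltr_nat ltnS => h.
by apply/eqP; rewrite eqn_leq cle.
Qed.

Lemma ae_probability1 (R : realType) (d : measure_display) (W : measurableType d)
    (Q : probability W R) (A : set W) :
  measurable A -> Q A = 1%E -> {ae Q, forall w, A w}.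
Proof.
move=> mA QA; exists (~` A); split; first exact: measurableC.
  by rewrite [LHS]probability_setC// QA subee.
by move=> w.
Qed.

(** The Laplace functional of the process for a step function. Almost surely every cell of weight
    other than 1 holds finitely many points, so the product stabilises at the product of [phi k] to
    the power of the count of cell [k]; these counts are independent Poisson variables, and 1
    dominates. *)
Lemma poisson_laplace (R : realType) (d : measure_display)
    (W : measurableType d) (Q : probability W R) (p : nat -> W -> R)
    (mu : set R -> \bar R) (n : nat) (cell : R -> 'I_n) (phi : 'I_n -> R) :
  poisson_point_process Q p mu ->
  (forall k, measurable (cell @^-1` [set k])) ->
  (forall k, 0 <= mu (cell @^-1` [set k]))%E ->
  (forall k, 0 <= phi k <= 1) ->
  (forall k, phi k != 1 -> (mu (cell @^-1` [set k]) < +oo)%E) ->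
  (\int[Q]_w (\prod_(l < N) phi (cell (p l w)))%:E)%E @[N --> \oo] -->
  (expR (- \sum_(k < n) fine (mu (cell @^-1` [set k])) * (1 - phi k)))%:E.
Proof.
move=> [mp pois _ ind] mcell mu0 phi01 mufin.
pose A k := cell @^-1` [set k].
have tA : trivIset setT A.
  by apply/trivIsetP => i j _ _ ij; apply/seteqP; split=> x //= [xi xj]; rewrite -xi -xj eqxx in ij.
pose s := [seq k <- index_enum 'I_n | phi k != 1].
pose E k (m : nat) := [set w | point_count p (A k) w = m%:R%:E].
(* [fine] turns an infinite count into 0; for the cells in [s] this happens only on a null event. *)
pose F k w := phi k `^ fine (point_count p (A k) w).
have mN k : measurable_fun setT (point_count p (A k)).
  by apply: measurable_point_count => //; exact: mcell.
have mE k m : measurable (E k m).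
  by rewrite -[E k m]setTI; exact: (mN k measurableT [set m%:R%:E]).
have mF k : measurable_fun setT (F k).
  have mfine : measurable_fun setT (fine \o point_count p (A k)).
    by apply: measurableT_comp (mN k); exact: fine_measurable.
  exact: (measurableT_comp (measurable_powRr (phi k)) mfine).
have phi0 k : 0 <= phi k by case/andP: (phi01 k).
have sP k : k \in s = (phi k != 1) by rewrite mem_filter mem_index_enum andbT.
have FE k m w : E k m w -> F k w = phi k ^+ m.
  by move=> /= e; rewrite /F e/= powR_mulrn.
have tE k : trivIset setT (E k).
  apply/trivIsetP => i j _ _ ij; apply/seteqP; split=> x //= [xi].
  by rewrite /E/= xi => -[] /eqP; rewrite eqr_nat (negbTE ij).
pose nu k := fine (mu (A k)).
have nu0 k : 0 <= nu k by apply: fine_ge0; exact: mu0.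
have QE k m : k \in s -> Q (E k m) = (expR (- nu k) * nu k ^+ m / m`!%:R)%:E.
  by rewrite sP => pk; apply: pois; [exact: mcell|exact: mufin].
have gE k : k \in s -> (\sum_(0 <= m <oo) ((phi k ^+ m)%:E * Q (E k m)) =
    (expR (- (nu k * (1 - phi k))))%:E)%E.
  move=> ks; rewrite -poisson_generating_series//.
  by apply: eq_eseriesr => m _; rewrite QE.
have cE k : k \in s -> Q (\bigcup_m E k m) = 1%E.
  move=> ks; rewrite measure_bigcup//.
  have := @poisson_generating_series R (nu k) 1 (nu0 k) ler01.
  rewrite subrr mulr0 oppr0 expR0 => <-.
  rewrite (@eq_eseriesl R _ xpredT); last by move=> m; rewrite in_setT.
  by apply: eq_eseriesr => m _; rewrite [LHS](QE k m ks) expr1n mul1e.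
have -> : (expR (- \sum_(k < n) nu k * (1 - phi k)))%:E =
    (\int[Q]_w (\prod_(k <- s) F k w)%:E)%E.
  rewrite (@integral_prod_of_independent R d W Q _ E F (fun k m => phi k ^+ m)
    (fun k => expR (- (nu k * (1 - phi k)))))//.
  - rewrite probability_setT mul1e -expR_sum sumrN big_filter; congr (expR (- _))%:E.
    rewrite (bigID (fun k => phi k != 1))/= [X in _ + X]big1 ?addr0//.
    by move=> k /negPn/eqP ->; rewrite subrr mulr0.
  - by move=> k w; exact: powR_ge0.
  - by move=> k m; exact: exprn_ge0.
  - exact: filter_uniq (index_enum_uniq _).
  - move=> s' m us' s's.
    rewrite setTI probability_setT mul1e.
    apply: (ind n A _ tA s' (fun k => E k (m k))) => // k ks'.
    by exists [set (m k)%:R%:E] => //; rewrite setTI.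
have aeE : {ae Q, forall w, forall k, k \in s -> exists m, E k m w}.
  apply: filter_forall => k.
  have [ks|nks] := boolP (k \in s); last by apply: aeW.
  have := ae_probability1 (bigcup_measurable (fun m _ => mE k m)) (cE k ks).
  by apply: filterS => w [m _ Em] _; exists m.
have [] := @dominated_convergence d W R Q setT measurableT
  (fun N w => (\prod_(l < N) phi (cell (p l w)))%:E)
  (fun w => (\prod_(k <- s) F k w)%:E) (EFin \o cst 1); last by [].
- move=> N; apply/measurable_EFinP; apply: measurable_prod => l _.
  have mc : measurable_fun setT (fun x : R => phi (cell x)).
    have -> : (fun x => phi (cell x)) = (fun x => \sum_(k < n) phi k * \1_(A k) x).
      apply/funext => x; rewrite (bigD1 (cell x))//= indicE mem_set// mulr1.
      rewrite big1 ?addr0// => k kx; rewrite indicE memNset ?mulr0//.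
      by move=> e; rewrite -e eqxx in kx.
    apply: (@measurable_sum _ _ _ _ _ _ (fun k x => phi k * \1_(A k) x)) => k; apply: measurable_funM => //.
    by apply: measurable_indic; exact: mcell.
  exact: measurableT_comp mc (mp l).
- by apply/measurable_EFinP; exact: measurable_prod.
- apply: filterS aeE => w Ew _.
  apply: cvg_EFin; first by near=> N.
  apply: cvg_near_cst.
  have : \forall N \near \oo, forall k, k \in s ->
      phi k ^+ (\sum_(l < N) (cell (p l w) == k))%N = F k w.
    apply: filter_forall => k.
    have [ks|nks] := boolP (k \in s); last by near=> N.
    have [m Em] := Ew k ks.
    have := @point_count_eventually R d W p (A k) w m Em.
    apply: filterS => N e _; rewrite (FE _ _ _ Em) -e; congr (_ ^+ _)%N.
    by apply: eq_bigr => l _; congr nat_of_bool; apply/eqP/idP; rewrite inE.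
  apply: filterS => N h /=; rewrite (prod_cells phi (fun l => cell (p l w)) N) big_filter.
  by apply: eq_bigr => k pk; apply: h; rewrite sP.
- exact: finite_measure_integrable_cst.
- apply: aeW => w N _; rewrite /= lee_fin ger0_norm; last exact: prodr_ge0.
  by apply: prodr_ile1 => l _; exact: phi01.
Unshelve. all: by end_near. Qed.

Lemma sigma_of_bigcap (d : measure_display) (W : measurableType d)
    (dT : measure_display) (T : measurableType dT) (I : Type)
    (Y : I -> W -> T) (N : nat) (F : nat -> set W) :
  (forall l, sigma_of Y (F l)) -> sigma_of Y (\bigcap_(l in `I_N) F l).
Proof.
move=> YF; rewrite bigcap_mkcond.
apply: (@bigcapT_measurable _ (g_sigma_algebraType
  (\bigcup_i preimage_set_system setT (Y i) measurable))) => l.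
by case: ifPn => _; [exact: YF|exact: measurableT].
Qed.

Lemma sigma_of_preimage (d : measure_display) (W : measurableType d)
    (dT : measure_display) (T : measurableType dT) (I : Type)
    (Y : I -> W -> T) (i : I) (A : set T) :
  measurable A -> sigma_of Y (Y i @^-1` A).
Proof.
move=> mA; apply: sub_sigma_algebra; exists i => //; exists A => //.
by rewrite setTI.
Qed.

Lemma sigma_of_measurable (d : measure_display) (W : measurableType d)
    (dT : measure_display) (T : measurableType dT) (I : Type)
    (Y : I -> W -> T) :
  (forall i, measurable_fun setT (Y i)) -> sigma_of Y `<=` measurable.
Proof.
move=> mY; apply: smallest_sub; first exact: sigma_algebra_measurable.
by move=> A [i _ [B mB <-]]; exact: mY.
Qed.

Lemma seq_iota (N : nat) : [set` iota 0 N] = `I_N.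
Proof. by apply/seteqP; split=> l /=; rewrite mem_iota. Qed.

(** Split according to the cells [J] occupied by the first [N] points. For fixed [J] the event is
    the intersection of one on the points and one on the marks, and the two independence hypotheses
    factor its probability. *)
Lemma marked_points_probability (R : realType) (d : measure_display)
    (W : measurableType d) (Q : probability W R) (p : nat -> W -> R)
    (I : Type) (Zc : nat -> I -> W -> R) (n : nat) (cell : R -> 'I_n)
    (B : nat -> 'I_n -> set W) (phi : 'I_n -> R) (N : nat) :
  (forall l, measurable_fun setT (p l)) ->
  (forall l i, measurable_fun setT (Zc l i)) ->
  mutually_independent Q (fun l => sigma_of (Zc l)) ->
  independent2 Q (sigma_of p) (sigma_of (fun it : nat * I => Zc it.1 it.2)) ->
  (forall k, measurable (cell @^-1` [set k])) ->
  (forall l k, sigma_of (Zc l) (B l k)) ->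
  (forall l k, Q (B l k) = (phi k)%:E) -> (forall k, 0 <= phi k) ->
  Q (\bigcap_(l in `I_N) [set w | B l (cell (p l w)) w]) =
  (\int[Q]_w (\prod_(l < N) phi (cell (p l w)))%:E)%E.
Proof.
move=> mp mZ indZ indpZ mcell sB QB phi0.
have subZ l : sigma_of (Zc l) `<=` sigma_of (fun it : nat * I => Zc it.1 it.2).
  apply: smallest_sub; first exact: smallest_sigma_algebra.
  move=> _ [i _ [A mA <-]]; rewrite setTI.
  exact: (@sigma_of_preimage _ _ _ _ _ (fun it : nat * I => Zc it.1 it.2) (l, i)).
have mall : sigma_of (fun it : nat * I => Zc it.1 it.2) `<=` measurable.
  by apply: sigma_of_measurable => it; exact: mZ.
pose K := {ffun 'I_N -> 'I_n}.
(* [cell 0] is a filler for indices [l >= N], which never matter. *)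
pose ext (J : K) (l : nat) := if insub l is Some o then J o else cell 0.
have extE J (o : 'I_N) : ext J o = J o by rewrite /ext valK.
pose AJ (J : K) := \bigcap_(l in `I_N) (p l @^-1` (cell @^-1` [set ext J l])).
pose BJ (J : K) := \bigcap_(l in `I_N) B l (ext J l).
have sAJ J : sigma_of p (AJ J).
  by apply: sigma_of_bigcap => l; exact: sigma_of_preimage.
have sBJ J : sigma_of (fun it : nat * I => Zc it.1 it.2) (BJ J).
  by apply: sigma_of_bigcap => l; exact: subZ.
have mAJ J : measurable (AJ J) by apply: (sigma_of_measurable mp).
have mBJ J : measurable (BJ J) by exact: mall.
have QBJ J : Q (BJ J) = (\prod_(l < N) phi (J l))%:E.
  rewrite /BJ -seq_iota indZ ?iota_uniq//.
  have -> : iota 0 N = index_iota 0 N by rewrite /index_iota subn0.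
  rewrite big_mkord -prodEFin.
  by apply: eq_bigr => l _; rewrite QB extE.
have SE : (fun w => (\1_(\bigcap_(l in `I_N) [set w | B l (cell (p l w)) w]) w)%:E) =
    (fun w => \sum_(J : K) (\1_(AJ J `&` BJ J) w)%:E)%E :> (W -> \bar R).
  apply/funext => w; pose J0 : K := [ffun l : 'I_N => cell (p l w)].
  have AJ0 J : AJ J w -> J = J0.
    by move=> h; apply/ffunP => l; rewrite ffunE (h l (ltn_ord l)) extE.
  have e0 l : (l < N)%N -> ext J0 l = cell (p l w).
    by move=> lN; rewrite (extE J0 (Ordinal lN)) ffunE.
  rewrite (bigD1 J0)//= big1 ?adde0; last first.
    move=> J /eqP JJ0; rewrite indicE memNset// => -[/AJ0]//.
  congr EFin; rewrite !indicE; congr (nat_of_bool _)%:R.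
  apply/idP/idP; rewrite !inE => h.
    by split=> l /= lN; rewrite /= e0//; exact: h.
  by move=> l /= lN; have := h.2 l lN; rewrite e0.
have PE : (fun w => (\prod_(l < N) phi (cell (p l w)))%:E) =
    (fun w => \sum_(J : K) (\prod_(l < N) phi (J l))%:E * (\1_(AJ J) w)%:E)%E
    :> (W -> \bar R).
  apply/funext => w; pose J0 : K := [ffun l : 'I_N => cell (p l w)].
  have AJ0 J : AJ J w -> J = J0.
    by move=> h; apply/ffunP => l; rewrite ffunE (h l (ltn_ord l)) extE.
  have e0 l : (l < N)%N -> ext J0 l = cell (p l w).
    by move=> lN; rewrite (extE J0 (Ordinal lN)) ffunE.
  rewrite [RHS](bigD1 J0)//= [X in (_ + X)%E]big1 ?adde0; last first.
    move=> J /eqP JJ0; rewrite indicE memNset ?mule0// => /AJ0//.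
  rewrite indicE mem_set; last by move=> l /= lN; rewrite e0.
  by rewrite mule1; congr EFin; apply: eq_bigr => l _; rewrite ffunE.
have phiJ0 (J : K) : (0 <= (\prod_(l < N) phi (J l))%:E)%E.
  by rewrite lee_fin; exact: prodr_ge0.
have mS : measurable (\bigcap_(l in `I_N) [set w | B l (cell (p l w)) w]).
  apply: fin_bigcap_measurable => // l _.
  rewrite (_ : mkset _ = \bigcup_(k in [set: 'I_n]) ((p l @^-1` (cell @^-1` [set k])) `&` B l k)).
    apply: fin_bigcup_measurable => // k _; apply: measurableI.
      by rewrite -[X in measurable X]setTI; exact: mp.
    exact: (sigma_of_measurable (mZ l)).
  apply/seteqP; split=> w /=; first by move=> h; exists (cell (p l w)).
  by move=> [k _ [/= <-]].
rewrite -[X in Q X]setIT -integral_indic// SE PE !ge0_integral_sum//.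
- apply: eq_bigr => J _; rewrite ge0_integralZl//.
  + rewrite integral_indic; last exact: measurableI.
    rewrite integral_indic// !setIT.
    have := indpZ _ _ (sAJ J) (sBJ J); rewrite QBJ muleC; exact.
  + exact: measurableT.
  + by apply/measurable_EFinP; exact: measurable_indic.
- move=> J; apply: emeasurable_funM => //.
  by apply/measurable_EFinP; exact: measurable_indic.
- by move=> J w _; rewrite mule_ge0// lee_fin.
- move=> J; apply/measurable_EFinP; apply: measurable_indic; exact: measurableI.
Qed.

Lemma frechet_intensity_ge0 (R : realType) (alpha : R) (A : set R) :
  0 <= alpha -> (0 <= frechet_intensity alpha A)%E.
Proof.
by move=> a0; apply: integral_ge0 => x _; rewrite lee_fin mulr_ge0// powR_ge0.
Qed.

Lemma measurable_frechet_density (R : realType) (alpha : R) (D : set R) :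
  measurable_fun D (fun x : R => (alpha * x `^ (- alpha - 1))%:E).
Proof.
apply/measurable_EFinP; apply: measurable_funTS; exact: measurable_funM.
Qed.

Lemma le_frechet_intensity (R : realType) (alpha : R) (A B : set R) :
  0 <= alpha -> measurable A -> measurable B -> A `<=` B ->
  (frechet_intensity alpha A <= frechet_intensity alpha B)%E.
Proof.
move=> a0 mA mB AB; apply: ge0_subset_integral.
- exact: measurableI.
- exact: measurableI.
- exact: measurable_frechet_density.
- by move=> x _; rewrite lee_fin mulr_ge0// powR_ge0.
- by move=> x [Ax x0]; split=> //; exact: AB.
Qed.

Lemma frechet_intensity_sum (R : realType) (alpha : R) (n : nat)
    (P : pred 'I_n) (F : 'I_n -> set R) : 0 <= alpha ->
  (forall k, measurable (F k)) -> trivIset setT F ->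
  (\sum_(k < n | P k) frechet_intensity alpha (F k) =
   frechet_intensity alpha [set x | exists2 k, P k & F k x])%E.
Proof.
move=> a0 mF tF.
pose s := [seq k <- index_enum 'I_n | P k].
pose G k := F k `&` `]0, +oo[%classic.
have UE : [set x | exists2 k, P k & F k x] `&` `]0, +oo[%classic =
    \big[setU/set0]_(k <- s) G k.
  rewrite -bigcup_seq; apply/seteqP; split=> x.
    by move=> [[k Pk Fk] x0]; exists k => //=; rewrite mem_filter Pk mem_index_enum.
  by move=> [k /=]; rewrite mem_filter => /andP[Pk _] [Fk x0]; split=> //; exists k.
have mG k : measurable (G k) by exact: measurableI.
rewrite /frechet_intensity UE (@ge0_integral_bigsetU _ _ R lebesgue_measure _ G)//.
- by rewrite big_filter.
- exact: filter_uniq (index_enum_uniq _).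
- apply: sub_trivIset (_ : trivIset setT G) => //.
  exact: trivIset_setIr.
- exact: measurable_frechet_density.
- by move=> x _; rewrite lee_fin mulr_ge0// powR_ge0.
Qed.

Lemma frechet_intensity_mul (R : realType) (alpha v : R) : 0 < alpha -> 0 <= v ->
  frechet_intensity alpha [set x | 1 < x * v] = (v `^ alpha)%:E.
Proof.
move=> a0; rewrite le_eqVlt => /predU1P[<-|v0].
  rewrite (_ : mkset _ = set0); last first.
    by apply/seteqP; split=> x //=; rewrite mulr0 ltr10.
  by rewrite powR0 ?gt_eqF// /frechet_intensity set0I integral_set0.
rewrite (_ : mkset _ = `]v^-1, +oo[%classic); last first.
  by apply/seteqP; split=> x /=; rewrite in_itv/= andbT -ltr_pdivrMr// div1r.
rewrite frechet_intensity_ray ?invr_gt0//; congr EFin.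
by rewrite -powR_inv1 ?ltW// -powRrM mulN1r opprK.
Qed.

(* Since [g] takes finitely many values, the conditional probability of the event
   given the points is a product over the points of weights depending only on
   which of finitely many cells contains them, so its mean is a Laplace
   functional of the Poisson counts of these cells. *)
Lemma sup_points_simple (R : realType) (alpha : R) (d : measure_display)
    (W : measurableType d) (Q : probability W R) (p : nat -> W -> R)
    (I : Type) (Zc : nat -> I -> W -> R) (xi : nat -> W -> R)
    (dZ : measure_display) (WZ : measurableType dZ) (PZ : probability WZ R)
    (eta : WZ -> R) (g : R -> R) (s : seq R) :
  0 < alpha -> poisson_point_process Q p (frechet_intensity alpha) ->
  (forall l i, measurable_fun setT (Zc l i)) ->
  mutually_independent Q (fun l => sigma_of (Zc l)) ->
  independent2 Q (sigma_of p) (sigma_of (fun it : nat * I => Zc it.1 it.2)) ->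
  (forall l (A : set R), measurable A -> sigma_of (Zc l) (xi l @^-1` A)) ->
  measurable_fun setT eta ->
  (forall l (A : set R), measurable A -> Q (xi l @^-1` A) = PZ (eta @^-1` A)) ->
  measurable_fun setT g -> uniq s -> (forall x, g x \in s) ->
  (forall v, v \in s -> 0 <= v) ->
  exists r : R, (\int[PZ]_w (g (eta w) `^ alpha)%:E)%E = r%:E /\
    Q [set w | forall l, p l w * g (xi l w) <= 1] = (expR (- r))%:E.
Proof.
move=> a0 ppp mZ indZ indpZ sxi meta lawxi mg us gs s0.
have a0' := ltW a0.
have [mp _ _ _] := ppp.
pose m := size s; pose v (j : 'I_m) := s`_j.
have v0 j : 0 <= v j by apply: s0; exact: mem_nth.
pose n := #|{set 'I_m}|.
(* Two points share a cell when the same values of [g] are admissible as marks, so the chance that a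
   point at [x] respects the bound depends on [cell x] alone. *)
pose cell (x : R) : 'I_n := enum_rank (finset (fun j : 'I_m => x * v j <= 1)).
pose T (k : 'I_n) : {set 'I_m} := enum_val k.
have Tcell x : T (cell x) = finset (fun j : 'I_m => x * v j <= 1) by rewrite /T enum_rankK.
have mle j : measurable [set x : R | x * v j <= 1].
  rewrite (_ : mkset _ = (fun x : R => x * v j) @^-1` `]-oo, 1]%classic); last first.
    by apply/seteqP; split=> x /=; rewrite in_itv.
  by rewrite -[X in measurable X]setTI; apply: measurable_funM.
have mcell k : measurable (cell @^-1` [set k]).
  rewrite (_ : _ @^-1` _ = \bigcap_(j in [set: 'I_m])
     (if j \in T k then [set x | x * v j <= 1] else ~` [set x : R | x * v j <= 1])).
    apply: fin_bigcap_measurable => // j _; case: ifPn => _; first exact: mle.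
    by apply: measurableC; exact: mle.
  apply/seteqP; split=> x /=.
    by move=> <- j _; rewrite Tcell inE; case: ifPn => //= /negP.
  move=> h; apply: enum_val_inj; rewrite -/(T _) Tcell.
  apply/setP => j; rewrite inE; have := h j Logic.I.
  by rewrite -/(T k); case: ifPn => //= _ /negP/negbTE.
have mgv j : measurable (g @^-1` [set v j]).
  by rewrite -[X in measurable X]setTI; exact: mg.
pose q j := fine (PZ (eta @^-1` (g @^-1` [set v j]))).
have qE j : PZ (eta @^-1` (g @^-1` [set v j])) = (q j)%:E.
  rewrite fineK// fin_num_measure//.
  by rewrite -[X in measurable X]setTI; exact: meta.
have q0 j : 0 <= q j by rewrite fine_ge0.
have vinj : injective v.
  by move=> i j /eqP; rewrite nth_uniq// => /eqP/val_inj.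
have gv x : exists j, g x = v j.
  have h : (index (g x) s < m)%N by rewrite index_mem.
  by exists (Ordinal h); rewrite /v nth_index.
have mU (D : {set 'I_m}) : measurable (\bigcup_(j in [set` D]) (g @^-1` [set v j])).
  by apply: fin_bigcup_measurable => // j _; exact: mgv.
have intE (c : 'I_m -> R) (h : WZ -> R) : (forall j, 0 <= c j) ->
    (forall w j, g (eta w) = v j -> h w = c j) ->
    (\int[PZ]_w (h w)%:E)%E = (\sum_j q j * c j)%:E.
  move=> c0 hc.
  have mj j : measurable (eta @^-1` (g @^-1` [set v j])).
    by rewrite -[X in measurable X]setTI; exact: meta.
  transitivity (\int[PZ]_w \sum_(j < m)
      ((c j)%:E * (\1_(eta @^-1` (g @^-1` [set v j])) w)%:E))%E.
    apply: eq_integral => w _; have [j e] := gv (eta w).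
    rewrite (hc w j e) (bigD1 j)//= big1 ?adde0; last first.
      move=> i ij; rewrite indicE memNset ?mule0//= e => /vinj ji.
      by rewrite ji eqxx in ij.
    by rewrite indicE mem_set ?mule1.
  rewrite ge0_integral_sum//; last 2 first.
  - move=> j; apply: emeasurable_funM => //.
    by apply/measurable_EFinP; exact: measurable_indic.
  - by move=> j w _; rewrite mule_ge0 ?lee_fin.
  rewrite -sumEFin; apply: eq_bigr => j _.
  rewrite ge0_integralZl_EFin//; last first.
    by apply/measurable_EFinP; exact: measurable_indic.
  by rewrite integral_indic// setIT EFinM -qE muleC.
have lawU (D : {set 'I_m}) :
    PZ (eta @^-1` (\bigcup_(j in [set` D]) (g @^-1` [set v j]))) =
    (\sum_(j in D) q j)%:E.
  rewrite -[X in PZ X]setIT -integral_indic//; last first.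
    by rewrite -[X in measurable X]setTI; exact: meta.
  rewrite (intE (fun j => (j \in D)%:R)) => [|//|w j e].
    congr EFin; rewrite [RHS]big_mkcond/=; apply: eq_bigr => j _.
    by case: ifP => _; rewrite ?mulr1 ?mulr0.
  rewrite indicE; congr (nat_of_bool _)%:R; apply/idP/idP.
    by rewrite inE => -[i /= iD]; rewrite e => /vinj ->.
  by move=> jD; rewrite inE; exists j.
have qT : \sum_j q j = 1.
  apply: EFin_inj.
  have := @intE (fun=> 1) (cst 1) (fun=> ler01) (fun _ _ _ => erefl).
  under eq_bigr do rewrite mulr1.
  by move=> <-; rewrite -[RHS](@probability_setT _ _ _ PZ) -[RHS]mul1e -integral_cst.
pose B l k := xi l @^-1` (\bigcup_(j in [set` T k]) (g @^-1` [set v j])).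
pose phi k := \sum_(j in T k) q j.
have phi01 k : 0 <= phi k <= 1.
  rewrite sumr_ge0//= -qT /phi big_mkcond/=.
  by apply: ler_sum => j _; case: ifP.
have phiC k : 1 - phi k = \sum_(j | j \notin T k) q j.
  by rewrite -qT (bigID (mem (T k)))/= [X in X + _ - _](_ : _ = phi k)// addrC addKr.
have QB l k : Q (B l k) = (phi k)%:E by rewrite lawxi.
have muj j : (frechet_intensity alpha [set x | (1 < x * v j)%R] = (v j `^ alpha)%:E)%E.
  exact: frechet_intensity_mul.
have cellsub k j : j \notin T k -> cell @^-1` [set k] `<=` [set x | 1 < x * v j].
  by move=> + x /= xk; rewrite -xk Tcell inE -ltNge.
have mgt j : measurable [set x : R | 1 < x * v j].
  rewrite (_ : mkset _ = ~` [set x | x * v j <= 1]); first exact: measurableC.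
  by apply/seteqP; split=> x /=; rewrite ltNge => /negP.
have cellfin k j : j \notin T k ->
    (frechet_intensity alpha (cell @^-1` [set k]) < +oo)%E.
  move=> jk; apply: le_lt_trans (ltry (v j `^ alpha)).
  by rewrite -muj; apply: le_frechet_intensity => //; exact: cellsub.
(* A weight other than 1 forces some value [v j] to be inadmissible, so the cell stays away from 0,
   where the intensity has infinite mass. *)
have mufin k : phi k != 1 -> (frechet_intensity alpha (cell @^-1` [set k]) < +oo)%E.
  move=> pk; have [j jk|] := pickP (fun j => j \notin T k); first exact: cellfin jk.
  move=> h; move: pk; rewrite eq_sym -subr_eq0 phiC big_pred0 ?eqxx//.
have Hlim := @poisson_laplace R d W Q p _ n cell phi ppp mcell
  (fun k => frechet_intensity_ge0 _ a0') phi01 mufin.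
have tcell : trivIset setT (fun k => cell @^-1` [set k]).
  by apply/trivIsetP => i j _ _ ij; apply/seteqP; split=> x //= [xi' xj];
    rewrite -xi' -xj eqxx in ij.
(* Exchange the sums: for fixed [j], the cells excluding [v j] make up the ray of the [x] with
   [x * v j > 1], of intensity [v j] to the power [alpha]. *)
have sumE : \sum_(k < n) fine (frechet_intensity alpha (cell @^-1` [set k])) * (1 - phi k)
    = \sum_j q j * v j `^ alpha.
  under eq_bigr do rewrite phiC mulr_sumr.
  rewrite (exchange_big_dep xpredT)//=; apply: eq_bigr => j _.
  rewrite -mulr_suml mulrC; congr (_ * _).
  apply: EFin_inj; rewrite -muj -sumEFin.
  rewrite (eq_bigr (fun k => frechet_intensity alpha (cell @^-1` [set k]))); last first.
    move=> k jk; rewrite fineK// ge0_fin_numE ?frechet_intensity_ge0//.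
    exact: cellfin jk.
  rewrite (@frechet_intensity_sum R alpha n (fun k => j \notin T k) _ a0' mcell tcell).
  congr frechet_intensity; apply/seteqP; split=> x /=.
    by move=> [k jk xk]; exact: (cellsub k j jk).
  by move=> xj; exists (cell x) => //; rewrite Tcell inE -ltNge.
exists (\sum_j q j * v j `^ alpha); split.
  by apply: intE => [j|w j ->//]; exact: powR_ge0.
rewrite -sumE.
have SE : [set w | forall l, p l w * g (xi l w) <= 1] =
    \bigcap_N \bigcap_(l in `I_N) [set w | B l (cell (p l w)) w].
  have BE l w : B l (cell (p l w)) w <-> p l w * g (xi l w) <= 1.
    rewrite /B/=; split.
      by move=> [j /=]; rewrite Tcell inE => h ->.
    by have [j e] := gv (xi l w) => h; exists j => //=; rewrite Tcell inE -e.
  apply/seteqP; split=> w /=.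
    by move=> h N _ l _; apply/BE; exact: h.
  by move=> h l; apply/BE; exact: (h l.+1 Logic.I l (ltnSn l)).
have sB l k : sigma_of (Zc l) (B l k) by exact: sxi.
have mS N : measurable (\bigcap_(l in `I_N) [set w | B l (cell (p l w)) w]).
  apply: fin_bigcap_measurable => // l _.
  rewrite (_ : mkset _ = \bigcup_(k in [set: 'I_n]) ((p l @^-1` (cell @^-1` [set k])) `&` B l k)).
    apply: fin_bigcup_measurable => // k _; apply: measurableI.
      by rewrite -[X in measurable X]setTI; exact: mp.
    exact: (sigma_of_measurable (mZ l)).
  apply/seteqP; split=> w /=; first by move=> h; exists (cell (p l w)).
  by move=> [k _ [/= <-]].
have Hmu : Q (\bigcap_(l in `I_N) [set w | B l (cell (p l w)) w]) @[N --> \oo] -->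
    Q [set w | forall l, p l w * g (xi l w) <= 1].
  rewrite SE; apply: nonincreasing_cvg_mu => //.
  - by rewrite (le_lt_trans (probability_le1 _ _)) ?ltry.
  - exact: bigcapT_measurable.
  - move=> i j ij; apply/subsetPset => w h l /= li; apply: h => /=.
    exact: leq_trans li ij.
have phi0 k : 0 <= phi k by case/andP: (phi01 k).
move: Hmu; under eq_fun => N do rewrite
  (marked_points_probability N mp mZ indZ indpZ mcell sB QB phi0).
by move=> /(cvg_lim (@ereal_hausdorff R)) <-; apply/cvg_lim.
Qed.

Lemma cvg_expeR_opp (R : realType) (u : nat -> R) (l : \bar R) :
  (u n)%:E @[n --> \oo] --> l -> (0 <= l)%E ->
  (expR (- u n))%:E @[n --> \oo] --> expeR (- l)%E.
Proof.
case: l => [r h _|h _|_ //] /=; apply: cvg_EFin.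
- exact: nearW.
- have hu : u n @[n --> \oo] --> r by have /fine_cvgP[] := h.
  apply: (@cvg_comp _ _ _ (fun n => - u n) (@expR R) _ _ _ (cvgN hu)).
  exact: continuous_expR.
- exact: nearW.
- have /cvgeryP hu := h.
  exact: (@cvg_comp _ _ _ u (fun x => expR (- x)) _ _ _ hu (@cvgr_expR R)).
Qed.

Section sup_points_probability.
Import HBNNSimple finmap.finmap.

(** Simple functions [g N] increasing to the identity reduce this to marks with finitely many
    values: the events decrease and the integrals increase. The mean may be infinite, hence the
    extended exponential. *)
Lemma sup_points_probability (R : realType) (alpha : R) (d : measure_display)
    (W : measurableType d) (Q : probability W R) (p : nat -> W -> R)
    (I : Type) (Zc : nat -> I -> W -> R) (xi : nat -> W -> R)
    (dZ : measure_display) (WZ : measurableType dZ) (PZ : probability WZ R)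
    (eta : WZ -> R) :
  0 < alpha -> poisson_point_process Q p (frechet_intensity alpha) ->
  (forall l w, 0 <= p l w) ->
  (forall l i, measurable_fun setT (Zc l i)) ->
  mutually_independent Q (fun l => sigma_of (Zc l)) ->
  independent2 Q (sigma_of p) (sigma_of (fun it : nat * I => Zc it.1 it.2)) ->
  (forall l (A : set R), measurable A -> sigma_of (Zc l) (xi l @^-1` A)) ->
  measurable_fun setT eta ->
  (forall l (A : set R), measurable A -> Q (xi l @^-1` A) = PZ (eta @^-1` A)) ->
  (forall l w, 0 <= xi l w) -> (forall w, 0 <= eta w) ->
  Q [set w | forall l, p l w * xi l w <= 1] =
  expeR (- \int[PZ]_w (eta w `^ alpha)%:E)%E.
Proof.
move=> a0 ppp p0 mZ indZ indpZ sxi meta lawxi xi0 eta0.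
have a0' := ltW a0.
have mf : measurable_fun [set: R] (fun x : R => `|x|%:E).
  by apply/measurable_EFinP; exact: normr_measurable.
have f0 (x : R) : setT x -> (0 <= `|x|%:E)%E by move=> _; rewrite lee_fin.
pose g N : R -> R := nnsfun_approx measurableT mf N.
have gcv (x : R) : 0 <= x -> (g N x)%:E @[N --> \oo] --> x%:E.
  move=> x0; have := @cvg_nnsfun_approx _ _ _ _ measurableT _ mf f0 x Logic.I.
  by rewrite ger0_norm.
have gnd (x : R) : nondecreasing_seq (g ^~ x).
  by move=> i j ij; have /lefP := nd_nnsfun_approx measurableT mf ij; exact.
have gle N (x : R) : 0 <= x -> g N x <= x.
  move=> x0; have := @le_approx _ _ _ _ _ N x f0 Logic.I.
  by rewrite lee_fin ger0_norm// /g nnsfun_approxE.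
have g0 N x : 0 <= g N x by [].
have mg N : measurable_fun setT (g N) by [].
have fin N : finite_set (range (g N)) by exact: fimfunP.
have gs N x : g N x \in (finmap.enum_fset (fset_set (range (g N)))).
  have : g N x \in fset_set (range (g N)) by rewrite in_fset_set// mem_set//; exists x.
  by [].
have s0 N v : v \in (finmap.enum_fset (fset_set (range (g N)))) -> 0 <= v.
  have : v \in fset_set (range (g N)) -> 0 <= v.
    by rewrite in_fset_set// => /set_mem[x _ <-].
  exact.
have us N : uniq (finmap.enum_fset (fset_set (range (g N)))) by exact: finmap.fset_uniq.
have H N := sup_points_simple a0 ppp mZ indZ indpZ sxi meta lawxi (mg N) (us N) (gs N) (s0 N).
pose S N := [set w | forall l, p l w * g N (xi l w) <= 1].
have [mp _ _ _] := ppp.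
have mxi l : measurable_fun setT (xi l).
  by move=> _ A mA; rewrite setTI; exact: (sigma_of_measurable (mZ l)) (sxi l A mA).
have mS N : measurable (S N).
  rewrite (_ : S N = \bigcap_l [set w | p l w * g N (xi l w) <= 1]); last first.
    by apply/seteqP; split=> w /= h l; [move=> _; exact: h|exact: h].
  apply: bigcapT_measurable => l.
  rewrite (_ : mkset _ = (fun w => p l w * g N (xi l w)) @^-1` `]-oo, 1]%classic); last first.
    by apply/seteqP; split=> x /=; rewrite in_itv.
  rewrite -[X in measurable X]setTI; apply: measurable_funM => //.
  exact: measurableT_comp (mg N) (mxi l).
have SE : [set w | forall l, p l w * xi l w <= 1] = \bigcap_N S N.
  apply/seteqP; split=> w /= h.
    by move=> N _ l; apply: le_trans (h l); apply: ler_wpM2l => //; exact: gle.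
  move=> l; have /fine_cvgP[_ cv] := gcv _ (xi0 l w).
  have cv2 : p l w * g N (xi l w) @[N --> \oo] --> p l w * xi l w.
    by apply: cvgM cv; exact: cvg_cst.
  by apply: (cvgr_to_le cv2); apply: nearW => N; exact: h.
have Hmu : Q (S N) @[N --> \oo] --> Q [set w | forall l, p l w * xi l w <= 1].
  rewrite SE; apply: nonincreasing_cvg_mu => //.
  - by rewrite (le_lt_trans (probability_le1 _ _)) ?ltry.
  - exact: bigcapT_measurable.
  - move=> i j ij; apply/subsetPset => w h l; apply: le_trans (h l).
    by apply: ler_wpM2l => //; exact: gnd.
have mgp N : measurable_fun setT (fun w => (g N (eta w) `^ alpha)%:E).
  apply/measurable_EFinP; apply: (measurableT_comp (measurable_powR _)).
  exact: measurableT_comp (mg N) meta.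
have Hint : (\int[PZ]_w (g N (eta w) `^ alpha)%:E)%E @[N --> \oo] -->
    (\int[PZ]_w (eta w `^ alpha)%:E)%E.
  have := @cvg_monotone_convergence _ _ _ PZ setT measurableT
    (fun N w => (g N (eta w) `^ alpha)%:E) mgp.
  have -> : (fun w => limn ((fun N w => (g N (eta w) `^ alpha)%:E) ^~ w)) =
      (fun w => (eta w `^ alpha)%:E) :> (WZ -> \bar R).
    apply/funext => w; apply/cvg_lim => //.
    apply: cvg_EFin; first exact: nearW.
    have /fine_cvgP[_ cv] := gcv _ (eta0 w).
    (* Continuity of the power is used at positive points only; at 0 all approximations are 0. *)
    have := eta0 w; rewrite le_eqVlt => /predU1P[e|ew0].
      apply: cvg_near_cst; apply: nearW => N /=.
      have := gle N _ (eta0 w); rewrite -e => g00.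
      by have /eqP -> : g N 0 == 0 by rewrite eq_le g00 g0.
    apply: (@cvg_comp _ _ _ (fun N => g N (eta w)) (fun x : R => x `^ alpha) _ _ _ cv).
    exact: powR_continuous.
  apply.
  - by move=> N w _; rewrite lee_fin powR_ge0.
  - move=> w _ i j ij; rewrite lee_fin ge0_ler_powR ?nnegrE//; exact: gnd.
pose r N := fine (\int[PZ]_w (g N (eta w) `^ alpha)%:E)%E.
have rE N : (r N)%:E = (\int[PZ]_w (g N (eta w) `^ alpha)%:E)%E.
  by rewrite /r; have [r' [-> _]] := H N.
have QS N : Q (S N) = (expR (- r N))%:E.
  by rewrite /r; have [r' [-> ->]] := H N.
have h0 : (0 <= \int[PZ]_w (eta w `^ alpha)%:E)%E.
  by apply: integral_ge0 => w _; rewrite lee_fin powR_ge0.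
have Hr : (r N)%:E @[N --> \oo] --> (\int[PZ]_w (eta w `^ alpha)%:E)%E.
  by under eq_fun do rewrite rE.
have := cvg_expeR_opp Hr h0; under eq_fun do rewrite -QS.
by move=> /(cvg_lim (@ereal_hausdorff R)) <-; apply/esym/cvg_lim.
Qed.

End sup_points_probability.

(** * Finite maxima and the finite-dimensional laws of [X] *)

Lemma measurable_bigmaxr (R : realType) (d : measure_display) (W : measurableType d)
    (I : Type) (s : seq I) (f : I -> W -> R) (D : set W) :
  (forall i, measurable_fun D (f i)) ->
  measurable_fun D (fun w => \big[Num.max/0]_(i <- s) f i w).
Proof.
move=> mf; elim: s => [|i s IH].
  by under eq_fun do rewrite big_nil; exact: measurable_cst.
under eq_fun do rewrite big_cons.
exact: measurable_maxr.
Qed.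

Lemma bigmax0_ge0 (R : realType) (I : Type) (s : seq I) (f : I -> R) :
  0 <= \big[Num.max/0]_(i <- s) f i.
Proof. exact: bigmax_ge_id. Qed.

Lemma bigmax0_le (R : realType) (I : eqType) (s : seq I) (f : I -> R) (a : R) :
  0 <= a -> (\big[Num.max/0]_(i <- s) f i <= a) = all (fun i => f i <= a) s.
Proof.
move=> a0; elim: s => [|i s IH]; first by rewrite big_nil.
by rewrite big_cons ge_max IH.
Qed.

Lemma bigmax0_powR (R : realType) (I : Type) (s : seq I) (f : I -> R) (a : R) :
  0 < a -> (forall i, 0 <= f i) ->
  (\big[Num.max/0]_(i <- s) f i) `^ a = \big[Num.max/0]_(i <- s) (f i `^ a).
Proof.
move=> a0 f0; elim: s => [|i s IH]; first by rewrite !big_nil powR0 ?gt_eqF.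
rewrite !big_cons -IH.
have [h|h] := leP (f i) (\big[Num.max/0]_(j <- s) f j).
  by rewrite max_r// ge0_ler_powR ?nnegrE ?bigmax0_ge0// ltW.
by rewrite max_l// ge0_ler_powR ?nnegrE ?bigmax0_ge0// ltW.
Qed.

Lemma jointly_measurable_section (R : realType) (d : measure_display)
    (W : measurableType d) (Y : R -> W -> R) (t : R) :
  jointly_measurable Y -> measurable_fun setT (Y t).
Proof.
move=> mY; have := measurableT_comp mY (@measurable_pair1 _ _ _ _ (t : measurableTypeR R)).
exact.
Qed.

(** Exchange the maximum over the times with the supremum over the points: the event says that
    [p l * xi l <= 1] for all [l], where the mark [xi l] is the weighted maximum of the copy [Zc l]
    over the given times. *)
Lemma spectral_joint_law (R : realType) (alpha : R)
    (dX : measure_display) (WX : measurableType dX) (PX : probability WX R)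
    (X : R -> WX -> R)
    (dZ : measure_display) (WZ : measurableType dZ) (PZ : probability WZ R)
    (Z : R -> WZ -> R) (n : nat) (t b : 'I_n -> R) :
  0 < alpha -> (forall t, measurable_fun setT (Z t)) ->
  spectral_process alpha PX X PZ Z -> (forall i, 0 < b i) ->
  PX [set w | forall i, b i * X (t i) w <= 1] =
  expeR (- \int[PZ]_w ((\big[Num.max/0]_(i < n) (b i * Z (t i) w)) `^ alpha)%:E)%E.
Proof.
move=> a0 mZ [Z0 [d [W [Q [p [Zc [ppp p0 [mZc lawZ] [indZ indpZ] lawX]]]]]]] b0.
pose xi l w := \big[Num.max/0]_(i < n) (b i * Zc l (t i) w).
pose eta w := \big[Num.max/0]_(i < n) (b i * Z (t i) w).
pose h (u : n.-tuple R) := \big[Num.max/0]_(i < n) (b i * tnth u i).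
have mh : measurable_fun setT h.
  apply: (@measurable_bigmaxr R _ _ _ _ (fun i u => b i * tnth u i)) => i.
  by apply: measurable_funM => //; exact: measurable_tnth.
have xiE l w : xi l w = h [tuple Zc l (t i) w | i < n].
  by apply: eq_bigr => i _; rewrite tnth_mktuple.
have etaE w : eta w = h [tuple Z (t i) w | i < n].
  by apply: eq_bigr => i _; rewrite tnth_mktuple.
have meta : measurable_fun setT eta.
  apply: (@measurable_bigmaxr R _ _ _ _ (fun i w => b i * Z (t i) w)) => i.
  exact: measurable_funM.
have lawxi l (A : set R) : measurable A -> Q (xi l @^-1` A) = PZ (eta @^-1` A).
  move=> mA; have mhA : measurable (h @^-1` A).
    by rewrite -[X in measurable X]setTI; exact: mh.
  have := lawZ l n t (h @^-1` A) mhA => /esym.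
  congr (_ = _).
    by congr (Q _); apply/seteqP; split=> w /=; rewrite -xiE.
  by congr (PZ _); apply/seteqP; split=> w /=; rewrite -etaE.
have sxi l (A : set R) : measurable A -> sigma_of (Zc l) (xi l @^-1` A).
  (* [W] is retyped with the sigma-algebra generated by [Zc l] alone, since independence asks for
     the event to lie there. *)
  move=> mA; pose G := \bigcup_i preimage_set_system setT (Zc l i) measurable.
  have mg i : measurable_fun [set: g_sigma_algebraType G] (Zc l i : g_sigma_algebraType G -> R).
    by move=> _ B mB; rewrite setTI; exact: sigma_of_preimage.
  have mxi : measurable_fun [set: g_sigma_algebraType G] (xi l : g_sigma_algebraType G -> R).
    apply: (@measurable_bigmaxr R _ (g_sigma_algebraType G) _ _
      (fun i w => b i * Zc l (t i) w)) => i.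
    exact: measurable_funM.
  by have := mxi measurableT A mA; rewrite setTI.
have <- := sup_points_probability a0 ppp p0 mZc indZ indpZ sxi meta lawxi
  (fun l w => bigmax0_ge0 _ _) (fun w => bigmax0_ge0 _ _).
(* Tuples of extended reals, because the supremum over the points is a priori allowed to be
   infinite. *)
pose A := [set u : n.-tuple (\bar R) | forall i, (tnth u i <= ((b i)^-1)%:E)%E].
have mA : measurable A.
  rewrite (_ : A = \bigcap_(i in [set: 'I_n]) ((tnth (T:=\bar R))^~ i @^-1` `]-oo, ((b i)^-1)%:E]%classic)).
    apply: fin_bigcap_measurable => // i _.
    by rewrite -[X in measurable X]setTI; apply: measurable_tnth => //; exact: emeasurable_itv.
  by apply/seteqP; split=> u h' i /=; [move=> _; rewrite in_itv/=; exact: h'|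
    have := h' i Logic.I; rewrite /= in_itv].
have := lawX n t A mA; congr (_ = _).
  congr (PX _); apply/seteqP; split=> w /= h' i.
    have := h' i; rewrite tnth_mktuple lee_fin => /(ler_wpM2l (ltW (b0 i))).
    by rewrite mulfV ?gt_eqF.
  rewrite tnth_mktuple lee_fin -(@ler_pM2l _ (b i))// mulfV ?gt_eqF//.
congr (Q _); apply/seteqP; split=> w /= h'.
  move=> l; have := p0 l w; rewrite le_eqVlt => /predU1P[<-|pl0].
    by rewrite mul0r ler01.
  rewrite -ler_pdivlMl// mulr1 bigmax0_le ?invr_ge0//; apply/allP => i _ /=.
  rewrite -[leRHS]mulr1 ler_pdivlMl// mulrCA -ler_pdivlMl// mulr1 -lee_fin.
  have := h' i; rewrite tnth_mktuple; apply: le_trans.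
  by apply: ereal_sup_ubound; exists l.
move=> i; rewrite tnth_mktuple; apply: ge_ereal_sup => _ [l _ <-].
have [->|pl] := eqVneq (p l w) 0; first by rewrite mul0r lee_fin invr_ge0 ltW.
have {}pl0 : 0 < p l w by rewrite lt_neqAle eq_sym pl p0.
move: (h' l).
rewrite -ler_pdivlMl// mulr1 bigmax0_le ?invr_ge0 ?(ltW pl0)// => /allP/(_ i).
rewrite mem_index_enum => /(_ isT) /=; rewrite -[leRHS]mulr1 ler_pdivlMl// => h2.
by rewrite lee_fin -(@ler_pM2l _ (b i))// mulfV ?gt_eqF// mulrCA.
Qed.

Lemma le_bigmax0 (R : realType) (I : eqType) (s : seq I) (f : I -> R) (i : I) :
  i \in s -> f i <= \big[Num.max/0]_(j <- s) f j.
Proof. by move=> si; exact: (@le_bigmax_seq _ _ _ _ 0 i xpredT f). Qed.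

Lemma bigmax_iota_nd (R : realType) (g : nat -> R) :
  nondecreasing_seq (fun n => (\big[Num.max/0]_(i <- iota 0 n) g i)%:E : \bar R).
Proof.
apply/nondecreasing_seqP => n; rewrite lee_fin bigmax0_le ?bigmax0_ge0//.
apply/allP => i; rewrite mem_iota => /andP[_ iN].
apply: (@le_bigmax0 R _ _ g).
by rewrite mem_iota leq0n !add0n in iN *; exact: ltnW.
Qed.

Lemma ereal_sup_bigmax (R : realType) (g : nat -> R) : (forall i, 0 <= g i) ->
  ereal_sup (range (fun i => (g i)%:E)) =
  limn (fun n => (\big[Num.max/0]_(i <- iota 0 n) g i)%:E).
Proof.
move=> g0; rewrite (cvg_lim _ (ereal_nondecreasing_cvgn (bigmax_iota_nd g)))//.
apply/eqP; rewrite eq_le; apply/andP; split; apply: ge_ereal_sup => _ [i _ <-].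
  apply: (@le_trans _ _ (\big[Num.max/0]_(j <- iota 0 i.+1) g j)%:E).
    by rewrite lee_fin; apply: (@le_bigmax0 R _ _ g); rewrite mem_iota/= ltnSn.
  by apply: ereal_sup_ubound; exists i.+1.
elim: (iota 0 i) => [|j s IH]; rewrite ?big_nil ?big_cons.
  apply: (@le_trans _ _ (g 0%N)%:E); first by rewrite lee_fin.
  by apply: ereal_sup_ubound; exists 0%N.
by rewrite EFin_max ge_max IH andbT; apply: ereal_sup_ubound; exists j.
Qed.

Lemma integral_sup_bigmax (R : realType) (d : measure_display)
    (W : measurableType d) (P : {measure set W -> \bar R}) (D : set W)
    (g : nat -> W -> R) : measurable D ->
  (forall i, measurable_fun setT (g i)) -> (forall i w, 0 <= g i w) ->
  (\int[P]_(w in D) ereal_sup (range (fun i => (g i w)%:E)) =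
   limn (fun n => \int[P]_(w in D) (\big[Num.max/0]_(i <- iota 0 n) g i w)%:E))%E.
Proof.
move=> mD mg g0.
transitivity (\int[P]_(w in D) limn (fun n => (\big[Num.max/0]_(i <- iota 0 n) g i w)%:E))%E.
  by apply: eq_integral => w _; rewrite ereal_sup_bigmax.
apply: monotone_convergence => //.
- move=> n; apply/measurable_EFinP; apply: measurable_funTS.
  exact: measurable_bigmaxr.
- by move=> n w _; rewrite lee_fin bigmax0_ge0.
- by move=> w _; exact: (bigmax_iota_nd (g^~ w)).
Qed.

(** * Max-stationarity of the spectral process *)

(** What the exponential formula makes of the stationarity of [X]; the process [Y] itself need not
    be stationary. A pair in [l] is a time with its coefficient. *)
Definition max_stationary (R : realType) (d : measure_display)
    (W : measurableType d) (P : probability W R) (Y : R -> W -> R) : Prop :=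
  forall (l : seq (R * R)) (h : R), (forall q, q \in l -> 0 < q.2) ->
    (\int[P]_w (\big[Num.max/0]_(q <- l) (q.2 * Y (q.1 + h) w))%:E =
     \int[P]_w (\big[Num.max/0]_(q <- l) (q.2 * Y q.1 w))%:E)%E.

Section spectral_consequences.
Context (R : realType) (alpha : R)
  (dX : measure_display) (WX : measurableType dX) (PX : probability WX R)
  (X : R -> WX -> R)
  (dZ : measure_display) (WZ : measurableType dZ) (PZ : probability WZ R)
  (Z : R -> WZ -> R).
Hypothesis halpha : 0 < alpha.
Hypothesis mX : jointly_measurable X.
Hypothesis mZ : jointly_measurable Z.
Hypothesis Zspectral : spectral_process alpha PX X PZ Z.

Let Y t w := Z t w `^ alpha.

Let Y0 t w : 0 <= Y t w. Proof. exact: powR_ge0. Qed.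

Let mXt t : measurable_fun setT (X t).
Proof. exact: jointly_measurable_section. Qed.

Let mZt t : measurable_fun setT (Z t).
Proof. exact: jointly_measurable_section. Qed.

Let mYt t : measurable_fun setT (Y t).
Proof. exact: measurableT_comp (measurable_powR _) (mZt t). Qed.

(** The coefficients of [X] carry the exponent [alpha^-1] so that they become linear in front of
    [Y]. *)
Lemma joint_law_seq (l : seq (R * R)) : (forall q, q \in l -> 0 < q.2) ->
  PX [set w | forall q, q \in l -> q.2 `^ alpha^-1 * X q.1 w <= 1] =
  expeR (- \int[PZ]_w (\big[Num.max/0]_(q <- l) (q.2 * Y q.1 w))%:E)%E.
Proof.
move=> l0; have Z0 := Zspectral.1.
pose b (i : 'I_(size l)) := (tnth (in_tuple l) i).2 `^ alpha^-1.
pose t (i : 'I_(size l)) := (tnth (in_tuple l) i).1.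
have b0 i : 0 < b i by apply: powR_gt0; apply: l0; exact: mem_tnth.
have := spectral_joint_law t halpha mZt Zspectral b0.
have -> : [set w | forall i, b i * X (t i) w <= 1] =
    [set w | forall q, q \in l -> q.2 `^ alpha^-1 * X q.1 w <= 1].
  apply/seteqP; split=> w /= h.
    by move=> q ql; have /tnthP[i ->] : q \in in_tuple l by []; exact: h.
  by move=> i; apply: h; exact: mem_tnth.
move=> ->; congr (expeR (- _))%E; apply: eq_integral => w _; congr EFin.
rewrite bigmax0_powR//; last by move=> i; rewrite mulr_ge0// ltW.
rewrite [RHS]big_tnth; apply: eq_bigr => i _.
rewrite powRM ?powR_ge0// -powRrM mulVf ?gt_eqF// powRr1//.
by apply/ltW/l0; exact: mem_tnth.
Qed.

Let expeRN_inj (a b : \bar R) : expeR (- a)%E = expeR (- b)%E -> a = b.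
Proof. by move=> /expeR_inj /oppe_inj. Qed.

Lemma spectral_mean1 t : frechet_marginals PX alpha X ->
  (\int[PZ]_w (Y t w)%:E = 1)%E.
Proof.
move=> /(_ t 1 ltr01); rewrite powR1 => e; apply: expeRN_inj.
have := joint_law_seq (l := [:: (t, 1)]).
under eq_integral => w _ do rewrite big_cons big_nil /= mul1r (max_l (Y0 t w)).
move=> <-; last by move=> q; rewrite inE => /eqP ->.
rewrite /= -e; congr (PX _); apply/seteqP; split=> w /=.
  by move=> /(_ (t, 1) (mem_head _ _)) /=; rewrite powR1 mul1r.
by move=> h q; rewrite inE => /eqP -> /=; rewrite powR1 mul1r.
Qed.

Lemma spectral_max_stationary : stationary PX X -> max_stationary PZ Y.
Proof.
move=> Xs l h l0; apply: expeRN_inj.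
pose l' := [seq (q.1 + h, q.2) | q <- l].
have l'0 q : q \in l' -> 0 < q.2 by move=> /mapP[q' q'l ->] /=; exact: l0.
rewrite -joint_law_seq//.
have := joint_law_seq l'0; under eq_integral do rewrite big_map.
move=> <-.
pose t (i : 'I_(size l)) := (tnth (in_tuple l) i).1.
pose b (i : 'I_(size l)) := (tnth (in_tuple l) i).2 `^ alpha^-1.
pose A := [set u : (size l).-tuple R | forall i, b i * tnth u i <= 1].
have mA : measurable A.
  rewrite (_ : A = \bigcap_(i in [set: 'I_(size l)])
     ((fun u => b i * tnth u i) @^-1` `]-oo, 1]%classic)).
    apply: fin_bigcap_measurable => // i _.
    rewrite -[X in measurable X]setTI; apply: measurable_funM => //.
    exact: measurable_tnth.
  by apply/seteqP; split=> u h' i /=; [move=> _; rewrite in_itv/=; exact: h'|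
    have := h' i Logic.I; rewrite /= in_itv].
have /esym := Xs h (size l) t A mA; congr (_ = _); congr (PX _).
  apply/seteqP; split=> w /= H.
    move=> _ /mapP[q ql ->] /=; have /tnthP[i qi] : q \in in_tuple l by [].
    by have := H i; rewrite tnth_mktuple /b /t -qi.
  move=> i; rewrite tnth_mktuple; apply: (H (t i + h, (tnth (in_tuple l) i).2)).
  by apply/mapP; exists (tnth (in_tuple l) i) => //; exact: mem_tnth.
apply/seteqP; split=> w /= H.
  move=> q ql; have /tnthP[i qi] : q \in in_tuple l by [].
  by have := H i; rewrite tnth_mktuple /b /t -qi.
by move=> i; rewrite tnth_mktuple; apply: H; exact: mem_tnth.
Qed.

(** The mean is minus the logarithm of P (X s <= 1, X t <= 1), and this probability is at least P (X
    t <= x0) - P (|X s - X t| >= 1 - x0) for any level x0 < 1. *)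
Lemma spectral_max_near t e : 0 < e ->
  stochastically_continuous PX X -> frechet_marginals PX alpha X ->
  \forall s \near t, (\int[PZ]_w (Num.max (Y s w) (Y t w))%:E <= (1 + e)%:E)%E.
Proof.
move=> e0 Xc Xf.
(* Chosen so that P (X t <= x0) = exp (- (1 + e / 2)); the gap [g] to the target exp (- (1 + e)) is
   what the probability of a large increment may use up. *)
pose x0 : R := (1 + e / 2) `^ (- alpha^-1).
have e20 : 0 < 1 + e / 2 by rewrite addr_gt0// divr_gt0.
have x00 : 0 < x0 by exact: powR_gt0.
have x01 : x0 < 1.
  rewrite /x0 powRN invf_lt1 ?powR_gt0//.
  have : 1 `^ alpha^-1 < (1 + e / 2) `^ alpha^-1.
    by rewrite gt0_ltr_powR ?nnegrE ?invr_gt0 ?(ltW e20)// ltrDl divr_gt0.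
  by rewrite powR1.
have Px0 : PX [set w | X t w <= x0] = (expR (- (1 + e / 2)))%:E.
  by rewrite Xf// /x0 -powRrM mulrNN mulVf ?gt_eqF// powRr1// ltW.
pose g := expR (- (1 + e / 2)) - expR (- (1 + e)).
have g0 : 0 < g.
  rewrite subr_gt0 ltr_expR ltrN2 ltrD2l ltr_pdivrMr// ltr_pMr//.
  by rewrite ltr1n.
have eta0 : 0 < 1 - x0 by rewrite subr_gt0.
have /fine_cvgP[_ /cvgrPdist_lt/(_ _ g0)] := Xc t _ eta0.
apply: filterS => s /=; rewrite sub0r normrN => h.
have mD : measurable [set w | 1 - x0 <= `|X s w - X t w|].
  rewrite (_ : mkset _ = (fun w => `|X s w - X t w|) @^-1` `[1 - x0, +oo[%classic); last first.
    by apply/seteqP; split=> w /=; rewrite in_itv/= andbT.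
  rewrite -[X in measurable X]setTI; apply: (measurableT_comp (@normr_measurable R setT)) => //.
  exact: measurable_funB.
have mT c r : measurable [set w | X r w <= c].
  rewrite (_ : mkset _ = X r @^-1` `]-oo, c]%classic); last first.
    by apply/seteqP; split=> w /=; rewrite in_itv.
  by rewrite -[X in measurable X]setTI; exact: mXt.
have lmax : (\int[PZ]_w (\big[Num.max/0]_(q <- [:: (s, 1); (t, 1)]) (q.2 * Y q.1 w))%:E =
    \int[PZ]_w (Num.max (Y s w) (Y t w))%:E)%E.
  apply: eq_integral => w _; congr EFin.
  rewrite !big_cons big_nil/= !mul1r; congr Num.max.
  by rewrite max_l.
have l0 (q : R * R) : q \in [:: (s, 1); (t, 1)] -> 0 < q.2.
  by rewrite !inE => /orP[] /eqP ->.
rewrite -leeN2 -lee_expeR -lmax -joint_law_seq//=.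
have -> : [set w | forall q, q \in [:: (s, 1); (t, 1)] -> q.2 `^ alpha^-1 * X q.1 w <= 1] =
    [set w | X s w <= 1] `&` [set w | X t w <= 1].
  apply/seteqP; split=> w /=.
    move=> H; split.
      by have := H (s, 1) (mem_head _ _); rewrite /= powR1 mul1r.
    by have := H (t, 1); rewrite !inE eqxx orbT /= powR1 mul1r => ->.
  by move=> [hs ht] q; rewrite !inE => /orP[] /eqP -> /=; rewrite powR1 mul1r.
have : (PX [set w | (X t w <= x0)%R] <=
   PX ([set w | (X s w <= 1)%R] `&` [set w | (X t w <= 1)%R]) +
   PX [set w | (1 - x0 <= `|X s w - X t w|)%R])%E.
  have mI : measurable ([set w | X s w <= 1] `&` [set w | X t w <= 1]).
    by apply: measurableI; exact: mT.
  apply: le_trans (measureU2 PX mI mD).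
  apply: le_measure; [by rewrite inE; exact: mT| |].
    by rewrite inE; apply: measurableU => //; apply: measurableI; exact: mT.
  move=> w /= ht; have [hs|hs] := leP (X s w) 1.
    by left; split => //; apply: le_trans ht _; exact: ltW.
  right; rewrite ger0_norm; first by rewrite lerB// ltW.
  by rewrite subr_ge0 (le_trans ht)// (le_trans (ltW x01))// ltW.
rewrite Px0.
have mI : measurable ([set w | X s w <= 1] `&` [set w | X t w <= 1]).
  by apply: measurableI; exact: mT.
rewrite -[X in (_ <= X + _)%E -> _]fineK ?fin_num_measure//.
rewrite -[X in (_ <= _ + X)%E -> _]fineK ?fin_num_measure//.
rewrite -EFinD lee_fin => h2.
rewrite -[leRHS]fineK ?fin_num_measure// lee_fin.
move: h; rewrite ger0_norm ?fine_ge0// /g => h3.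
lra.
Qed.

(** Some level bounds all the [X (e i)] with positive probability [B]. By the exponential formula
    [B] is at most exp (- c E max Y) for every finite maximum, so these means are bounded by
    [- ln B / c] uniformly. *)
Lemma spectral_sup_finite (e : nat -> R) : locally_bounded_paths PX X ->
  (forall i, 0 <= e i <= 1) ->
  (\int[PZ]_w ereal_sup (range (fun i => (Y (e i) w)%:E)) < +oo)%E.
Proof.
move=> Xb e01.
pose S M := [set w | forall i, X (e i) w <= M.+1%:R].
have mS M : measurable (S M).
  rewrite (_ : S M = \bigcap_i (X (e i) @^-1` `]-oo, M.+1%:R]%classic)); last first.
    apply/seteqP; split=> w h i /=; first by move=> _; rewrite in_itv/=; exact: h.
    by have := h i Logic.I; rewrite /= in_itv.
  by apply: bigcapT_measurable => i; rewrite -[X in measurable X]setTI; exact: mXt.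
have [M SM] : exists M, PX (S M) != 0%E.
  apply: contrapT => /forallNP h.
  have : PX.-negligible (\bigcup_M S M).
    apply: negligible_bigcup => M; apply/negligibleP => //.
    by apply: contrapT => /eqP; exact: h.
  move: Xb => /negligibleU /[apply].
  have -> : ~` [set w | forall a b, exists M : R, forall t, a <= t <= b -> `|X t w| <= M]
     `|` \bigcup_M S M = setT.
    apply/seteqP; split=> // w _.
    have [H|H] := pselect (forall a b, exists M : R, forall t, a <= t <= b -> `|X t w| <= M); last by left.
    right; have [M hM] := H 0 1; exists (Num.truncn M) => // i.
    apply: le_trans (ler_norm _) _; apply: le_trans (hM _ (e01 i)) _.
    by apply: ltW; exact: truncnS_gt.
  move=> /(measure_negligible measurableT)/eqP.
  by rewrite [X in X == _](@probability_setT _ _ _ PX) onee_eq0.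
have SM0 : (0 < PX (S M))%E by rewrite lt0e SM measure_ge0.
(* Then [c] to the power [alpha^-1] is the inverse of the level [M.+1], itself shifted by one to be
   positive. *)
pose c : R := M.+1%:R `^ (- alpha).
have c0 : 0 < c by exact: powR_gt0.
pose l n := [seq (e i, c) | i <- iota 0 n].
have l0 n (q : R * R) : q \in l n -> 0 < q.2 by move=> /mapP[i _ ->].
pose f n w := \big[Num.max/0]_(i <- iota 0 n) Y (e i) w.
have mf n : measurable_fun setT (f n) by exact: measurable_bigmaxr.
pose B := fine (PX (S M)).
have BE : PX (S M) = B%:E by rewrite fineK// fin_num_measure.
have B0 : 0 < B by rewrite -lte_fin -BE.
have fle n : (\int[PZ]_w (f n w)%:E <= (- ln B / c)%:E)%E.
  have : (B%:E <= expeR (- \int[PZ]_w (\big[Num.max/0]_(q <- l n) (q.2 * Y q.1 w))%:E))%E.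
    rewrite -joint_law_seq; last exact: l0.
    rewrite -BE; apply: le_measure; rewrite ?inE//.
      rewrite (_ : mkset _ = \bigcap_(i in `I_n) ((fun w => c `^ alpha^-1 * X (e i) w) @^-1` `]-oo, 1]%classic)).
        apply: fin_bigcap_measurable => // i _.
        by rewrite -[X in measurable X]setTI; apply: measurable_funM.
      apply/seteqP; split=> w /= H.
        move=> i /= ilt; rewrite in_itv/=; apply: (H (e i, c)).
        by apply/mapP; exists i => //; rewrite mem_iota.
      move=> q /mapP[i]; rewrite mem_iota => /= ilt ->.
      by have := H i ilt; rewrite /= in_itv.
    move=> w H _ /mapP[i _ ->] /=.
    rewrite /c -powRrM mulNr mulfV ?gt_eqF// powR_inv1//.
    by rewrite -ler_pdivlMl ?invr_gt0// invrK mulr1; exact: H.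
  rewrite -[in leLHS](lnK (x := B)) ?posrE//.
  rewrite -[X in (X <= _)%E]/(expeR (ln B)%:E) lee_expeR leeNr => H.
  rewrite mulNr EFinN; move: H.
  have -> : (\int[PZ]_w (\big[Num.max/0]_(q <- l n) (q.2 * Y q.1 w))%:E =
      \int[PZ]_w (c%:E * (f n w)%:E))%E.
    apply: eq_integral => w _; rewrite -EFinM; congr EFin.
    rewrite big_map /f; elim: (iota 0 n) => [|i s IH]; first by rewrite !big_nil mulr0.
    by rewrite !big_cons IH -maxr_pMr// ltW.
  rewrite ge0_integralZl_EFin//; last 3 first.
  - by move=> w _; rewrite lee_fin bigmax0_ge0.
  - exact/measurable_EFinP.
  - exact: ltW.
  by rewrite -lee_pdivlMl// => /le_trans; apply; rewrite -EFinN -EFinM lee_fin mulrC mulNr.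
have f0 n w : 0 <= f n w by exact: bigmax0_ge0.
have fnd w : nondecreasing_seq (fun n => (f n w)%:E : \bar R).
  exact: (@bigmax_iota_nd R (fun i => Y (e i) w)).
rewrite (@integral_sup_bigmax R _ _ PZ setT (fun i => Y (e i)))//.
apply: le_lt_trans (ltry (- ln B / c)); apply: lime_le; last exact: nearW.
apply: ereal_nondecreasing_is_cvgn => i j ij; apply: ge0_le_integral => //.
- by move=> w _; rewrite lee_fin; exact: f0.
- by apply/measurable_EFinP; exact: mf.
- by apply/measurable_EFinP; exact: mf.
- by move=> w _; exact: fnd.
Qed.

End spectral_consequences.

(** * The tilted law of the paths *)

(** Finite lists of upper bounds are closed under concatenation, so these sets form a pi-system;
    they generate the product sigma-algebra on paths. *)
Definition path_cylinder (R : realType) (l : seq (R * R)) : set (R -> R) :=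
  [set y | forall q, q \in l -> y q.1 <= q.2].

Notation path_space R := (g_sigma_algebraType (range (@path_cylinder R))).

Lemma path_cylinder_setI (R : realType) : setI_closed (range (@path_cylinder R)).
Proof.
move=> _ _ [l1 _ <-] [l2 _ <-]; exists (l1 ++ l2) => //.
apply/seteqP; split=> y /=.
  by move=> h; split=> q ql; apply: h; rewrite mem_cat ql ?orbT.
by move=> [h1 h2] q; rewrite mem_cat => /orP[/h1|/h2].
Qed.

Lemma measurable_path_fun (R : realType) (d : measure_display)
    (W : measurableType d) (f : W -> path_space R) :
  (forall s, measurable_fun setT (fun w => f w s)) -> measurable_fun setT f.
Proof.
move=> mf; apply: (@measurability _ _ W (path_space R) setT f (range (@path_cylinder R))) => //.
move=> _ [_ [l _ <-] <-]; rewrite setTI.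
rewrite (_ : _ @^-1` _ = \bigcap_(q in [set` l]) ((fun w => f w q.1) @^-1` `]-oo, q.2]%classic)).
  apply: fin_bigcap_measurable => // q _.
  by rewrite -[X in measurable X]setTI; exact: mf.
by apply/seteqP; split=> w /= h q ql; have := h q ql; rewrite /= in_itv.
Qed.

Lemma measurable_path_eval (R : realType) (s : R) :
  measurable_fun setT (fun y : path_space R => y s).
Proof.
apply: (@measurability _ _ _ _ _ _ _ (RGenOInfty.measurableE R)) => //.
move=> _ [_ [x ->] <-]; rewrite setTI.
rewrite (_ : _ @^-1` _ = ~` path_cylinder [:: (s, x)]).
  apply: measurableC; apply: sub_sigma_algebra; exact: imageT.
apply/seteqP; split=> y /=; rewrite in_itv/= andbT.
  by move=> xy /(_ (s, x) (mem_head _ _)) /=; rewrite leNgt xy.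
move=> h; rewrite ltNge; apply/negP => yx; apply: h => q.
by rewrite inE => /eqP ->.
Qed.

Section tilt.
Context (R : realType) (d : measure_display) (W : measurableType d)
  (P : probability W R) (Y : R -> W -> R).
Hypothesis mYt : forall t, measurable_fun setT (Y t).
Hypothesis Y0 : forall t w, 0 <= Y t w.
Hypothesis EY : forall t, (\int[P]_w (Y t w)%:E = 1)%E.
Hypothesis Ystat : max_stationary P Y.

(** Where [Y t w = 0] the quotient is 0 by convention, and [tilt] gives such points no weight. *)
Definition tilt_path (t : R) (w : W) : path_space R :=
  fun s => Y (s + t) w / Y t w.

Definition tilt (t : R) (A : set (R -> R)) : \bar R :=
  (\int[P]_(w in tilt_path t @^-1` A) (Y t w)%:E)%E.

Lemma measurable_tilt_path t : measurable_fun setT (tilt_path t).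
Proof.
apply: measurable_path_fun => s.
rewrite (_ : (fun w => _) = (fun w => Y (s + t) w * Y t w `^ (-1))); last first.
  by apply/funext => w; rewrite powR_inv1.
apply: measurable_funM => //.
exact: (measurableT_comp (measurable_powR (R := R) (-1)) (mYt t)).
Qed.

Let mpre t (A : set (path_space R)) : measurable A -> measurable (tilt_path t @^-1` A).
Proof. by move=> mA; rewrite -[X in measurable X]setTI; exact: measurable_tilt_path. Qed.

Let mYE t (D : set W) : measurable_fun D (fun w => (Y t w)%:E).
Proof. by apply/measurable_EFinP; exact: measurable_funTS. Qed.

Lemma integrable_family t : P.-integrable setT (EFin \o Y t).
Proof.
apply/integrableP; split; first exact: mYE.
under eq_integral do rewrite /= ger0_norm//.
by rewrite EY ltry.
Qed.

Lemma integrable_max_family (l : seq (R * R)) (t : R) :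
  P.-integrable setT (EFin \o (fun w => \big[Num.max/0]_(q <- l) (q.2 * Y (q.1 + t) w))).
Proof.
elim: l => [|q l IH].
  under eq_fun do rewrite big_nil.
  exact: finite_measure_integrable_cst.
have mf : measurable_fun setT (fun w => \big[Num.max/0]_(r <- l) (r.2 * Y (r.1 + t) w)).
  by apply: (@measurable_bigmaxr R _ _ _ _ (fun r w => r.2 * Y (r.1 + t) w)) => r;
    exact: measurable_funM.
have iY : P.-integrable setT (fun w => q.2%:E * (Y (q.1 + t) w)%:E)%E.
  by apply: integrableZl => //; exact: integrable_family.
apply: (le_integrable measurableT _ _ (integrableD measurableT
  (integrable_abse iY) (integrable_abse IH))).
  apply/measurable_EFinP; under eq_fun do rewrite big_cons.
  by apply: measurable_maxr => //; exact: measurable_funM.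
move=> w _ /=; rewrite big_cons -?EFinM -?EFinD lee_fin.
rewrite [leRHS]ger0_norm ?addr_ge0//.
by rewrite /Num.max; case: ifP => _; rewrite ?lerDl ?lerDr.
Qed.

(* With [V] the maximum of the [Y (q.1 + t) / q.2], both sides are the right
   derivative at [c = 1] of the shift-invariant quantity [E max (c Y t, V)]. *)
Lemma tilt_cylinder_gt0 t (l : seq (R * R)) : (forall q, q \in l -> 0 < q.2) ->
  tilt t (path_cylinder l) = tilt 0 (path_cylinder l).
Proof.
move=> l0.
pose V t w := \big[Num.max/0]_(q <- l) (q.2^-1 * Y (q.1 + t) w).
pose M t (c : R) w := Num.max (c * Y t w) (V t w).
pose l' (c : R) := (0, c) :: [seq (q.1, q.2^-1) | q <- l].
have l'0 c q : 0 < c -> q \in l' c -> 0 < q.2.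
  move=> c0; rewrite inE => /predU1P[->//|/mapP[q' q'l ->]] /=.
  by rewrite invr_gt0; exact: l0.
have ME u c w : M u c w = \big[Num.max/0]_(q <- l' c) (q.2 * Y (q.1 + u) w).
  by rewrite big_cons big_map /= add0r.
have iM u c : P.-integrable setT (EFin \o M u c).
  have := integrable_max_family (l' c) u.
  by congr (integrable _ _ (EFin \o _)); apply/funext => w; rewrite ME.
have Minv u c : 0 < c -> (\int[P]_w (M u c w)%:E = \int[P]_w (M 0 c w)%:E)%E.
  move=> c0; under eq_integral do rewrite ME.
  under [RHS]eq_integral do rewrite ME.
  rewrite Ystat; last by move=> q; exact: l'0.
  by apply: eq_integral => w _; congr EFin; apply: eq_bigr => q _; rewrite addr0.
pose c (n : nat) : R := 1 + n.+1%:R^-1.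
have c0 n : 0 < c n by rewrite addr_gt0// invr_gt0.
pose D u n w := n.+1%:R * (M u (c n) w - M u 1 w).
have mM u a : measurable_fun setT (M u a).
  apply: measurable_maxr; first exact: measurable_funM.
  by apply: (@measurable_bigmaxr R _ _ _ _ (fun q w => q.2^-1 * Y (q.1 + u) w)) => q;
    exact: measurable_funM.
(* If V <= Y the quotient is constantly Y; if Y < V both maxima are V as soon as [c n] is close to
   1. A right derivative puts the tie V = Y in the first case, as the closed inequalities of
   cylinders require. *)
have Dlim u w : D u n w @[n --> \oo] --> if V u w <= Y u w then Y u w else 0.
  apply: cvg_near_cst; case: ifPn => [VY|].
    apply: nearW => n; rewrite /D /M mul1r (max_l VY) max_l; last first.
      by apply: le_trans VY _; rewrite ler_peMl// lerDl.
    by rewrite /c mulrDl mul1r addrAC subrr add0r mulrA mulfV ?mul1r ?pnatr_eq0.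
  rewrite -ltNge => YV; have VY0 : 0 < V u w - Y u w by rewrite subr_gt0.
  near=> n; rewrite /D /M mul1r (max_r (ltW YV)) max_r ?subrr ?mulr0//.
  have : Y u w / (V u w - Y u w) <= n.+1%:R.
    apply: (@le_trans _ _ n%:R); last by rewrite ler_nat.
    by near: n; exact: nbhs_infty_ger.
  rewrite ler_pdivrMr// => h.
  by rewrite /c mulrDl mul1r -lerBrDl ler_pdivrMl.
have Dbnd u n w : `|D u n w| <= Y u w.
  rewrite /D normrM ger0_norm// -ler_pdivlMl// /M mul1r ger0_norm; last first.
    rewrite subr_ge0 ge_max le_max ler_peMl ?lerDl//=.
    by rewrite le_max lexx orbT.
  rewrite lerBlDl ge_max; apply/andP; split.
    by rewrite /c mulrDl mul1r lerD2r le_max lexx.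
  by rewrite -[leLHS]addr0 lerD ?le_max ?lexx ?orbT// mulr_ge0.
have mD u n : measurable_fun setT (D u n).
  by apply: measurable_funM => //; exact: measurable_funB.
have iD u n : (\int[P]_w (D u n w)%:E =
    n.+1%:R%:E * (\int[P]_w (M u (c n) w)%:E - \int[P]_w (M u 1 w)%:E))%E.
  rewrite /D; under eq_integral do rewrite EFinM EFinB.
  have i2 := integrableB measurableT (iM u (c n)) (iM u 1).
  by rewrite (integralZl measurableT i2) (integralB measurableT (iM u (c n)) (iM u 1)).
have Hlim u : (\int[P]_w (D u n w)%:E)%E @[n --> \oo] -->
    (\int[P]_w (if V u w <= Y u w then Y u w else 0)%:E)%E.
  have mm : measurable_fun setT (fun w => (if V u w <= Y u w then Y u w else 0)).
    apply: (measurable_fun_cvg (h := D u)) => //.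
  have [] := @dominated_convergence d W R P setT measurableT
    (fun n w => (D u n w)%:E) (fun w => (if V u w <= Y u w then Y u w else 0)%:E)
    (EFin \o Y u); last by [].
  - by move=> n; exact/measurable_EFinP.
  - exact/measurable_EFinP.
  - by apply: aeW => w _; apply: cvg_EFin; [exact: nearW|exact: Dlim].
  - exact: integrable_family.
  - by apply: aeW => w n _; rewrite lee_fin.
have tE u : tilt u (path_cylinder l) =
    (\int[P]_w (if V u w <= Y u w then Y u w else 0)%:E)%E.
  rewrite /tilt integral_mkcond; apply: eq_integral => w _.
  rewrite /patch; have [Yu|Yu] := eqVneq (Y u w) 0.
    by rewrite !Yu; case: ifP; case: ifP.
  have {}Yu : 0 < Y u w by rewrite lt_neqAle eq_sym Yu Y0.
  rewrite bigmax0_le//; set b := w \in _; set b' := all _ _.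
  suff -> : b = b' by case: ifP.
  apply/idP/idP; rewrite /b /b' inE.
    move=> h; apply/allP => q ql /=; have := h q ql; rewrite /tilt_path/=.
    by rewrite ler_pdivrMr// ler_pdivrMl//; exact: l0.
  move=> /allP h q ql /=; have := h q ql; rewrite /tilt_path/=.
  by rewrite ler_pdivrMr// ler_pdivrMl//; exact: l0.
rewrite !tE; have := Hlim t; have := Hlim 0.
under eq_fun do rewrite iD -(Minv t _ (c0 _)) -(Minv t _ ltr01) -iD.
by move=> /(cvg_lim (@ereal_hausdorff R)) <- /(cvg_lim (@ereal_hausdorff R)) <-.
Unshelve. all: by end_near. Qed.

(** Both sides are finite measures of equal total mass in [A], so agreement on cylinders suffices.
    Cylinders with a negative bound are null because the ratios are nonnegative. *)
Lemma tilt_shift t (A : set (path_space R)) : measurable A ->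
  tilt t A = tilt 0 A.
Proof.
move=> mA; pose C (B : set (path_space R)) := tilt t B = tilt 0 B.
have tiltC u (B : set (path_space R)) : measurable B -> tilt u (~` B) = (1 - tilt u B)%E.
  move=> mB.
  have fin : tilt u B \is a fin_num.
    rewrite ge0_fin_numE; last by apply: integral_ge0 => w _; rewrite lee_fin.
    apply: (@le_lt_trans _ _ (\int[P]_w (Y u w)%:E)%E); last by rewrite EY ltry.
    by apply: ge0_subset_integral => //; [exact: mpre|move=> w _; rewrite lee_fin].
  rewrite -(EY u) -(setUv (tilt_path u @^-1` B)) ge0_integral_setU//.
  - by rewrite addeC addeK.
  - exact: mpre.
  - by apply: measurableC; exact: mpre.
  - by move=> w _; rewrite lee_fin.
  - by apply/disj_setPS => x [].
have CC (B : set (path_space R)) : measurable B -> C B -> C (~` B).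
  by move=> mB; rewrite /C !tiltC// => ->.
apply: (@dynkin_induction _ (path_space R) (range (@path_cylinder R)) C) => //.
- exact: path_cylinder_setI.
- by rewrite /C /tilt !preimage_setT !EY.
- move=> _ [l _ <-].
  have [/hasP[q ql q0]|/hasPn l0] := boolP (has (fun q => q.2 < 0) l).
    have z u : tilt u (path_cylinder l) = 0%E.
      rewrite /tilt; apply: integral0_eq => w h; congr EFin.
      apply/eqP; apply: contraTT (h q ql) => Yn0; rewrite -ltNge.
      by apply: lt_le_trans q0 _; rewrite divr_ge0.
    by rewrite /C !z.
  (* Bounds equal to 0 escape the cylinder lemma, which divides by them; they are approached from
     above by positive ones. *)
  pose l_ n := [seq (q.1, q.2 + n.+1%:R^-1) | q <- l] : seq (R * R).
  have lE : path_cylinder l = ~` \bigcup_n ~` path_cylinder (l_ n).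
    rewrite setC_bigcup; apply/seteqP; split=> y /=.
      move=> h n _; rewrite setCK => _ /mapP[q ql ->] /=.
      by rewrite (le_trans (h q ql))// lerDl invr_ge0.
    move=> h q ql; apply/ler_addgt0Pr => e e0.
    pose N := Num.truncn e^-1.
    have Ne : N.+1%:R^-1 < e by rewrite invf_plt ?posrE//; exact: truncnS_gt.
    have := h N Logic.I; rewrite setCK => /(_ (q.1, q.2 + N.+1%:R^-1)) h2.
    apply: le_trans (h2 _) _; first by apply/mapP; exists q.
    by rewrite lerD2l; exact: ltW.
  have mcyl k : measurable (path_cylinder k : set (path_space R)).
    by apply: sub_sigma_algebra; exact: imageT.
  have Cn n : C (~` path_cylinder (l_ n)).
    apply: CC => //; apply: tilt_cylinder_gt0 => _ /mapP[q ql ->] /=.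
    by rewrite ltr_wpDl ?invr_gt0// leNgt; exact: l0.
  rewrite lE; apply: CC; first by apply: bigcupT_measurable => n; exact: measurableC.
  have cvu u : tilt u (~` path_cylinder (l_ n)) @[n --> \oo] -->
      tilt u (\bigcup_n ~` path_cylinder (l_ n)).
    rewrite /tilt preimage_bigcup.
    apply: ge0_nondecreasing_set_cvg_integral => //.
    - apply/nondecreasing_seqP => n; apply/subsetPset => w /= h h2; apply: h.
      move=> _ /mapP[q ql ->] /=; have := h2 (q.1, q.2 + n.+2%:R^-1).
      move=> /(_ _)/le_trans; apply; first by apply/mapP; exists q.
      by rewrite lerD2l lef_pV2 ?posrE// ler_nat.
    - by move=> i; apply: mpre; exact: measurableC.
    - by move=> i w _; rewrite lee_fin.
  rewrite /C; have := cvu t; under eq_fun do rewrite Cn.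
  move=> /(cvg_lim (@ereal_hausdorff R)) <-.
  exact/cvg_lim.
- move=> F mF tF CF.
  have tpre u : trivIset setT (fun n => tilt_path u @^-1` F n).
    apply/trivIsetP => i j _ _ ij; apply/seteqP; split=> w //= h.
    by have /trivIsetP/(_ i j Logic.I Logic.I ij)/seteqP[/(_ _ h)] := tF.
  rewrite /C /tilt !preimage_bigcup !ge0_integral_bigcup//.
    by apply: eq_eseriesr => n _; exact: CF.
  all: by [move=> k; exact: mpre|move=> w _; rewrite lee_fin].
Qed.

End tilt.

(** * Shift invariance on events stable under scaling *)

Lemma measurable_set_le (R : realType) (d : measure_display)
    (W : measurableType d) (f g : W -> R) :
  measurable_fun setT f -> measurable_fun setT g -> measurable [set w | f w <= g w].
Proof.
move=> mf mg.
rewrite (_ : mkset _ = (fun w => g w - f w) @^-1` `[0, +oo[%classic); last first.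
  by apply/seteqP; split=> w /=; rewrite in_itv/= andbT subr_ge0.
by rewrite -[X in measurable X]setTI; apply: measurable_funB.
Qed.

Lemma measurable_set_lt (R : realType) (d : measure_display)
    (W : measurableType d) (f g : W -> R) :
  measurable_fun setT f -> measurable_fun setT g -> measurable [set w | f w < g w].
Proof.
move=> mf mg; rewrite (_ : mkset _ = ~` [set w | g w <= f w]).
  by apply: measurableC; exact: measurable_set_le.
by apply/seteqP; split=> w /=; rewrite ltNge => /negP.
Qed.

Definition cone (R : realType) (A : set (R -> R)) : Prop :=
  forall (c : R) y, 0 < c -> A y -> A (fun s => c * y s).

Lemma cone_setI (R : realType) (A B : set (R -> R)) :
  cone A -> cone B -> cone (A `&` B).
Proof. by move=> cA cB c y c0 [Ay By]; split; [exact: cA|exact: cB]. Qed.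

Section cone_shift.
Context (R : realType) (d : measure_display) (W : measurableType d)
  (P : probability W R) (Y : R -> W -> R).
Hypothesis mYt : forall t, measurable_fun setT (Y t).
Hypothesis Y0 : forall t w, 0 <= Y t w.
Hypothesis EY : forall t, (\int[P]_w (Y t w)%:E = 1)%E.
Hypothesis Ystat : max_stationary P Y.

Definition shift_path (t : R) (w : W) : path_space R := fun s => Y (s + t) w.

Lemma measurable_shift_path t : measurable_fun setT (shift_path t).
Proof. by apply: measurable_path_fun => s; exact: mYt. Qed.

Lemma measurable_shift_preimage t (A : set (path_space R)) :
  measurable A -> measurable (shift_path t @^-1` A).
Proof. by move=> mA; rewrite -[X in measurable X]setTI; exact: measurable_shift_path. Qed.

(** Where Y u > 0, dividing the path by Y u does not affect membership in a cone; where Y u = 0 the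
    integrand vanishes. Both sides are thus [tilt] of the same event [A'], at the times [s0 + t] and
    [s0]. *)
Lemma cone_shift t s0 (A : set (path_space R)) : measurable A -> cone A ->
  (\int[P]_(w in shift_path t @^-1` A) (Y (s0 + t) w)%:E =
   \int[P]_(w in shift_path 0 @^-1` A) (Y s0 w)%:E)%E.
Proof.
move=> mA cA.
(* The translation by [s0] is there because [tilt_path] recentres the path at the time of its
   weight, while [A] looks at it from [s0] earlier. *)
pose A' := (fun y : path_space R => (fun s => y (s - s0)) : path_space R) @^-1` A.
have mA' : measurable A'.
  rewrite -[X in measurable X]setTI.
  have : measurable_fun setT (fun y : path_space R => (fun s => y (s - s0)) : path_space R).
    by apply: measurable_path_fun => s; exact: measurable_path_eval.
  by apply.
have key u : (\int[P]_(w in shift_path (u - s0) @^-1` A) (Y u w)%:E = tilt P Y u A')%E.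
  rewrite /tilt integral_mkcond [RHS]integral_mkcond; apply: eq_integral => w _.
  rewrite /patch; have [Yu|Yu] := eqVneq (Y u w) 0.
    by rewrite !Yu; case: ifP; case: ifP.
  have {}Yu : 0 < Y u w by rewrite lt_neqAle eq_sym Yu Y0.
  set b := w \in _; set b' := w \in _.
  suff -> : b = b' by [].
  apply/idP/idP; rewrite /b /b' !inE /A' /tilt_path /shift_path /= => h.
    have Yi : 0 < (Y u w)^-1 by rewrite invr_gt0.
    have := cA _ _ Yi h; congr (A _); apply/funext => s.
    by rewrite mulrC addrA addrAC.
  have := cA _ _ Yu h; congr (A _); apply/funext => s.
  by rewrite mulrCA mulfV ?mulr1 ?gt_eqF// addrA addrAC.
have := key (s0 + t); rewrite addrAC subrr add0r => ->.
have := key s0; rewrite subrr => ->.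
by rewrite (tilt_shift mYt Y0 EY Ystat _ mA') [RHS](tilt_shift mYt Y0 EY Ystat _ mA').
Qed.

Lemma measurable_path_bigmax (s : seq R) :
  measurable_fun setT (fun y : path_space R => \big[Num.max/0]_(e <- s) y e).
Proof.
by apply: (@measurable_bigmaxr R _ (path_space R) _ _ (fun e y => y e)) => e;
  exact: measurable_path_eval.
Qed.

(** Induction on the times, for all cones [A] at once: split [A] according to whether the first time
    exceeds the maximum of the others. Both pieces are cones again. *)
Lemma cone_shift_bigmax t (s : seq R) (A : set (path_space R)) :
  measurable A -> cone A ->
  (\int[P]_(w in shift_path t @^-1` A) (\big[Num.max/0]_(e <- s) Y (e + t) w)%:E =
   \int[P]_(w in shift_path 0 @^-1` A) (\big[Num.max/0]_(e <- s) Y e w)%:E)%E.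
Proof.
elim: s A => [|e s IH] A mA cA.
  under eq_integral do rewrite big_nil.
  under [RHS]eq_integral do rewrite big_nil.
  by rewrite !integral0.
pose B := [set y : path_space R | y e <= \big[Num.max/0]_(e <- s) y e].
have mB : measurable B.
  by apply: measurable_set_le; [exact: measurable_path_eval|exact: measurable_path_bigmax].
have bigZ (c : R) (y : R -> R) : 0 < c -> \big[Num.max/0]_(e <- s) (c * y e) =
    c * \big[Num.max/0]_(e <- s) y e.
  move=> c0; elim: (s) => [|x s' IH']; first by rewrite !big_nil mulr0.
  by rewrite !big_cons IH' maxr_pMr// ltW.
have cB : cone B by move=> c y c0; rewrite /B/= bigZ// ler_pM2l.
have cBC : cone (~` B).
  move=> c y c0 yB h; apply: yB; move: h.
  by rewrite /B/= bigZ// ler_pM2l.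
have mAB := measurableI _ _ mA mB.
have mABC := measurableI _ _ mA (measurableC mB).
have split u : (\int[P]_(w in shift_path u @^-1` A)
     (\big[Num.max/0]_(e <- e :: s) Y (e + u) w)%:E =
   \int[P]_(w in shift_path u @^-1` (A `&` B)) (\big[Num.max/0]_(e <- s) Y (e + u) w)%:E
   + \int[P]_(w in shift_path u @^-1` (A `&` ~` B)) (Y (e + u) w)%:E)%E.
  have mmax (s' : seq R) : measurable_fun setT (fun w => (\big[Num.max/0]_(e <- s') Y (e + u) w)%:E).
    apply/measurable_EFinP.
    by apply: (@measurable_bigmaxr R _ W _ _ (fun e w => Y (e + u) w)) => e'.
  rewrite -{1}(setUIDK A B) setDE preimage_setU ge0_integral_setU.
  - congr (_ + _)%E.
      apply: eq_integral => w; rewrite inE => -[_ Bw]; congr EFin.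
      by rewrite big_cons max_r.
    apply: eq_integral => w; rewrite inE => -[_ /negP Bw]; congr EFin.
    by rewrite big_cons max_l// ltW// ltNge.
  - exact: measurable_shift_preimage.
  - exact: measurable_shift_preimage.
  - exact: measurable_funTS.
  - by move=> w _; rewrite lee_fin bigmax0_ge0.
  - by apply/disj_setPS => w [[_ ?] [_ ?]].
rewrite split IH//; last exact: cone_setI.
rewrite cone_shift//; last exact: cone_setI.
have := split 0; under eq_integral do under eq_bigr do rewrite addr0.
under [X in _ = X + _ -> _]eq_integral do under eq_bigr do rewrite addr0.
by rewrite addr0.
Qed.

Lemma cone_shift_sup t (e : nat -> R) (A : set (path_space R)) :
  measurable A -> cone A ->
  (\int[P]_(w in shift_path t @^-1` A) ereal_sup (range (fun i => (Y (e i + t) w)%:E)) =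
   \int[P]_(w in shift_path 0 @^-1` A) ereal_sup (range (fun i => (Y (e i) w)%:E)))%E.
Proof.
move=> mA cA; have mS u := measurable_shift_preimage u mA.
rewrite !integral_sup_bigmax//; apply: congr_lim; apply/funext => n.
transitivity (\int[P]_(w in shift_path t @^-1` A)
    (\big[Num.max/0]_(x <- [seq e i | i <- iota 0 n]) Y (x + t) w)%:E)%E.
  by apply: eq_integral => w _; rewrite big_map.
by rewrite cone_shift_bigmax//; apply: eq_integral => w _; rewrite big_map.
Qed.

End cone_shift.

(** * The Pickands constant as the mean of a window peak *)

(** Comparing suprema through countably many inequalities between terms is what makes the window
    events measurable; the slack [N.+1%:R^-1] is there because suprema need not be attained. *)
Lemma ereal_sup_leP (R : realType) (u v : nat -> R) :
  (ereal_sup (range (fun i => (u i)%:E)) <= ereal_sup (range (fun i => (v i)%:E)))%E <->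
  forall i N, exists i', u i - N.+1%:R^-1 < v i'.
Proof.
split=> [h i N|h].
  have : ((u i - N.+1%:R^-1)%:E < ereal_sup (range (fun i => (v i)%:E)))%E.
    apply: lt_le_trans h; apply: (@lt_le_trans _ _ (u i)%:E).
      by rewrite lte_fin ltrBlDr ltrDl invr_gt0.
    by apply: ereal_sup_ubound; exists i.
  by move=> /ereal_sup_gt[_ [i' _ <-]]; rewrite lte_fin; exists i'.
apply: ge_ereal_sup => _ [i _ <-]; apply/lee_addgt0Pr => e e0.
pose N := Num.truncn e^-1.
have Ne : N.+1%:R^-1 < e by rewrite invf_plt ?posrE//; exact: truncnS_gt.
have [i' hi'] := h i N.
apply: (@le_trans _ _ ((v i')%:E + e%:E)%E).
  rewrite -EFinD lee_fin -lerBlDr; apply: le_trans (ltW hi').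
  by rewrite lerB// ltW.
by rewrite leeD2r//; apply: ereal_sup_ubound; exists i'.
Qed.

Section windows.
Context (R : realType) (e : nat -> R).

Definition window (k : int) (y : R -> R) : \bar R :=
  ereal_sup (range (fun i => (y (e i + k%:~R))%:E)).

(** Strictness on the left only selects the leftmost of several maximal windows, so that the integer
    shifts of the event with [J = setT] exclude each other. *)
Definition first_max (J : set int) : set (R -> R) :=
  [set y | forall j, J j -> (window j y <= window 0 y)%E /\
    ((j < 0)%R -> (window j y < window 0 y)%E)].

Lemma windowZ k (c : R) y : 0 < c -> window k (fun s => c * y s) = (c%:E * window k y)%E.
Proof.
move=> c0; rewrite /window -ereal_sup_pZl//.
congr ereal_sup; apply/seteqP; split=> x /=.
  by move=> [i _ <-]; exists (y (e i + k%:~R))%:E => //; exists i.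
by move=> [_ [i _ <-] <-]; exists i.
Qed.

Lemma measurable_window_le j k :
  measurable ([set y | (window j y <= window k y)%E] : set (path_space R)).
Proof.
rewrite (_ : mkset _ = \bigcap_i \bigcap_N \bigcup_i'
    [set y : path_space R | y (e i + j%:~R) - N.+1%:R^-1 < y (e i' + k%:~R)]).
  do 2 apply: bigcapT_measurable => ?; apply: bigcupT_measurable => ?.
  apply: measurable_set_lt; last exact: measurable_path_eval.
  by apply: measurable_funB => //; exact: measurable_path_eval.
apply/seteqP; split=> y /=.
  by move=> /ereal_sup_leP h i _ N _; have [i' hi'] := h i N; exists i'.
move=> h; apply/ereal_sup_leP => i N; have [i' _ hi'] := h i Logic.I N Logic.I.
by exists i'.
Qed.

Lemma measurable_first_max J : measurable (first_max J : set (path_space R)).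
Proof.
rewrite (_ : first_max J = \bigcap_(n in [set: nat])
   (if @unpickle int n is Some j then
      if j \in J then [set y | (window j y <= window 0 y)%E] `&`
        (if j < 0 then ~` [set y | (window 0 y <= window j y)%E] else setT)
      else setT else setT)).
  apply: bigcapT_measurable => n; case: unpickle => [j|]; last exact: measurableT.
  case: ifP => _; last exact: measurableT.
  apply: measurableI; first exact: measurable_window_le.
  by case: ifP => _; [apply: measurableC; exact: measurable_window_le|exact: measurableT].
apply/seteqP; split=> y /= h.
  move=> n _; case: unpickle => [j|//]; case: ifPn => [|//]; rewrite inE => Jj.
  have [h1 h2] := h j Jj; split=> //; case: ifPn => // j0 /=.
  by apply/negP; rewrite -ltNge; exact: h2.
move=> j Jj; have := h (pickle j) Logic.I; rewrite pickleK mem_set// => -[h1 h2].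
by split=> // j0; move: h2; rewrite j0 /= => /negP; rewrite -ltNge.
Qed.

Lemma cone_first_max J : cone (first_max J).
Proof.
move=> c y c0 h j Jj; rewrite !windowZ//.
by rewrite lee_pmul2l ?lte_fin// lte_pmul2l ?lte_fin//; exact: h.
Qed.

Lemma first_maxS J K : J `<=` K -> first_max K `<=` first_max J.
Proof. by move=> JK y h j /JK; exact: h. Qed.

End windows.

Lemma measurable_ereal_sup_range (R : realType) (d : measure_display)
    (W : measurableType d) (g : nat -> W -> \bar R) :
  (forall i, measurable_fun setT (g i)) ->
  measurable_fun setT (fun w => ereal_sup (range (g ^~ w))).
Proof.
move=> mg; have := measurable_fun_esups mg 0%N.
congr measurable_fun; apply/funext => w; rewrite /esups; congr ereal_sup.
by apply/seteqP; split=> x [i _ <-]; exists i.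
Qed.

Lemma sum_ord_lt (N m : nat) : (\sum_(k < N) (k < m) <= m)%N.
Proof.
suff -> : (\sum_(k < N) (k < m) = minn N m)%N by exact: geq_minr.
elim: N => [|N IH]; first by rewrite big_ord0 min0n.
by rewrite big_ord_recr/= IH; lia.
Qed.

Lemma sum_ord_gt (N m : nat) : (\sum_(k < N) (N <= k + m) <= m)%N.
Proof.
rewrite (reindex_inj rev_ord_inj)/=; apply: leq_trans (sum_ord_lt N m).
by apply: leq_sum => k _; have := ltn_ord k; do 2 case: leqP; lia.
Qed.

Section window_maxima.
Context (R : realType) (d : measure_display) (W : measurableType d)
  (P : probability W R) (Y : R -> W -> R) (e : nat -> R).
Hypothesis mYt : forall t, measurable_fun setT (Y t).
Hypothesis Y0 : forall t w, 0 <= Y t w.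
Hypothesis EY : forall t, (\int[P]_w (Y t w)%:E = 1)%E.
Hypothesis Ystat : max_stationary P Y.
Hypothesis supY : (\int[P]_w ereal_sup (range (fun i => (Y (e i) w)%:E)) < +oo)%E.

(* When the points [e i] form the fractional parts of a separating set, [Wsup k]
   plays the role of the supremum of the path over [k, k + 1). *)
Definition Wsup (k : int) (w : W) : \bar R :=
  ereal_sup (range (fun i => (Y (e i + k%:~R) w)%:E)).

Definition Wmax (a : int) (N : nat) (w : W) : \bar R :=
  \big[maxe/0%E]_(k < N) Wsup (a + k%:Z) w.

(** [J] is the set of competing windows. With [setT] this will be the Pickands constant; blocks of
    [N] windows lead to finite [J]. *)
Definition Wpeak (J : set int) : \bar R :=
  (\int[P]_(w in shift_path Y 0 @^-1` first_max e J) Wsup 0 w)%E.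

Lemma Wsup_ge0 k w : (0 <= Wsup k w)%E.
Proof.
apply: (@le_trans _ _ (Y (e 0%N + k%:~R) w)%:E); first by rewrite lee_fin.
by apply: ereal_sup_ubound; exists 0%N.
Qed.

Lemma measurable_Wsup k : measurable_fun setT (Wsup k).
Proof.
apply: (measurable_ereal_sup_range (g := fun i w => (Y (e i + k%:~R) w)%:E)) => i.
exact/measurable_EFinP.
Qed.

Lemma measurable_Wmax a N : measurable_fun setT (Wmax a N).
Proof.
rewrite /Wmax; elim: (index_enum _) => [|k s IH].
  by under eq_fun do rewrite big_nil; exact: measurable_cst.
under eq_fun do rewrite big_cons.
by apply: measurable_maxe => //; exact: measurable_Wsup.
Qed.

Lemma Wmax_ge0 a N w : (0 <= Wmax a N w)%E.
Proof. exact: bigmax_ge_id. Qed.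

Let mpeak k J : measurable (shift_path Y k @^-1` first_max e J).
Proof. by apply: (measurable_shift_preimage mYt); exact: measurable_first_max. Qed.

Lemma window_shift j (k : int) w : window e j (shift_path Y k%:~R w) = Wsup (j + k) w.
Proof.
by rewrite /window /shift_path; under eq_fun do rewrite -addrA -intrD.
Qed.

Lemma first_max_disjoint (k1 k2 : int) w : (k1 < k2)%R ->
  first_max e setT (shift_path Y k1%:~R w) ->
  first_max e setT (shift_path Y k2%:~R w) -> False.
Proof.
move=> k12 D1 D2.
have [h1 _] := D1 (k2 - k1)%R Logic.I.
have [_ h2] := D2 (k1 - k2)%R Logic.I.
have lt0 : (k1 - k2 < 0)%R by rewrite subr_lt0.
by move: h1 (h2 lt0); rewrite !window_shift !add0r !subrK => h1 /lt_le_trans/(_ h1);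
  rewrite ltxx.
Qed.

Lemma Wpeak_shift (k : int) J :
  (\int[P]_(w in shift_path Y k%:~R @^-1` first_max e J) Wsup k w)%E = Wpeak J.
Proof.
rewrite /Wsup cone_shift_sup//; [|exact: measurable_first_max|exact: cone_first_max].
by apply: eq_integral => w _; rewrite /Wsup; under eq_fun do rewrite -[e _]addr0.
Qed.

Lemma Wpeak_ge0 J : (0 <= Wpeak J)%E.
Proof. by apply: integral_ge0 => w _; exact: Wsup_ge0. Qed.

Lemma EWsup0 : (\int[P]_w Wsup 0 w < +oo)%E.
Proof.
apply: le_lt_trans supY; rewrite le_eqVlt; apply/orP; left; apply/eqP.
by apply: eq_integral => w _; rewrite /Wsup; under eq_fun do rewrite addr0.
Qed.

Lemma Wpeak_le J K : J `<=` K -> (Wpeak K <= Wpeak J)%E.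
Proof.
move=> JK; apply: ge0_subset_integral.
- exact: mpeak.
- exact: mpeak.
- exact: measurable_funTS (measurable_Wsup 0).
- by move=> w _; exact: Wsup_ge0.
- by move=> w; exact: first_maxS.
Qed.

Lemma Wpeak_leE J : (Wpeak J <= \int[P]_w Wsup 0 w)%E.
Proof.
apply: ge0_subset_integral => //.
- exact: measurable_Wsup.
- by move=> w _; exact: Wsup_ge0.
Qed.

Lemma Wpeak_fin J : Wpeak J \is a fin_num.
Proof.
by rewrite ge0_fin_numE ?Wpeak_ge0//; exact: le_lt_trans (Wpeak_leE J) EWsup0.
Qed.

(** The maximum of the block is the value of its first maximal window. Seen from position [k], the
    block occupies the offsets from [- k] to [N - k - 1], and shift invariance moves that window to
    0. *)
Lemma int_Wmax_le a N :
  (\int[P]_w Wmax a N w <= \sum_(k < N) Wpeak [set j | - k%:Z <= j < N%:Z - k%:Z]%R)%E.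
Proof.
pose D (k : 'I_N) := shift_path Y (a + k%:Z)%:~R @^-1`
  first_max e [set j | - k%:Z <= j < N%:Z - k%:Z]%R.
have mD k : measurable (D k) by exact: mpeak.
have mr k : measurable_fun setT (Wsup (a + k%:Z) \_ (D k)).
  apply/(measurable_restrictT _ (mD k)); exact: measurable_funTS (measurable_Wsup _).
have r0 k w : (0 <= (Wsup (a + k%:Z) \_ (D k)) w)%E.
  by apply: erestrict_ge0 => w' _; exact: Wsup_ge0.
apply: (@le_trans _ _ (\int[P]_w \sum_(k < N) (Wsup (a + k%:Z) \_ (D k)) w)%E).
  apply: ge0_le_integral => //.
  - by move=> w _; exact: Wmax_ge0.
  - exact: measurable_Wmax.
  - exact: emeasurable_sum.
  move=> w _; have [N0|Npos] := posnP N.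
    apply: (@le_trans _ _ 0%E); last by apply: sume_ge0 => k _; exact: r0.
    by apply: bigmax_le => // -[j jN]; exfalso; rewrite N0 in jN.
  pose Q (k : nat) := (k < N)%N && [forall j : 'I_N, (Wsup (a + j%:Z) w <= Wsup (a + k%:Z) w)%E].
  have exQ : exists k, Q k.
    case: (@arg_maxP _ (\bar R) 'I_N (Ordinal Npos) xpredT (fun j => Wsup (a + j%:Z) w) isT) => k _ hk.
    by exists k; rewrite /Q ltn_ord; apply/forallP => j; exact: hk.
  case: (ex_minnP exQ) => k0 /andP[k0N /forallP hk0] kmin.
  pose k1 := Ordinal k0N.
  have Dk1 : D k1 w.
    rewrite /D /= => j /= /andP[jk jN]; rewrite -[0]/(0%:~R) !window_shift.
    have [i ji] : exists i : 'I_N, (j + (a + k0%:Z) = a + i%:Z)%R.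
      have h : (absz (j + k0%:Z)%R < N)%N by lia.
      by exists (Ordinal h) => /=; lia.
    rewrite ji add0r; split; first exact: hk0.
    move=> j0; rewrite ltNge; apply/negP => hle.
    have : Q i.
      by rewrite /Q ltn_ord; apply/forallP => j'; apply: le_trans (hk0 j') hle.
    by move=> /kmin; lia.
  rewrite (bigD1 k1)//= patchT ?inE//.
  apply: (@le_trans _ _ (Wsup (a + k0%:Z) w)).
    by apply: bigmax_le => [|j _]; [exact: Wsup_ge0|exact: hk0].
  by rewrite leeDl// sume_ge0.
rewrite ge0_integral_sum//; apply: lee_sum => k _.
by rewrite -integral_mkcond Wpeak_shift.
Qed.

(** At most one window of the block is a first maximum over all integers, so the sum of the peak
    values has at most one nonzero term and stays below the block maximum. *)
Lemma int_Wmax_ge a N : (N%:R%:E * Wpeak setT <= \int[P]_w Wmax a N w)%E.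
Proof.
pose D (k : 'I_N) := shift_path Y (a + k%:Z)%:~R @^-1` first_max e setT.
have mD k : measurable (D k) by exact: mpeak.
have mr k : measurable_fun setT (Wsup (a + k%:Z) \_ (D k)).
  apply/(measurable_restrictT _ (mD k)); exact: measurable_funTS (measurable_Wsup _).
have r0 k w : (0 <= (Wsup (a + k%:Z) \_ (D k)) w)%E.
  by apply: erestrict_ge0 => w' _; exact: Wsup_ge0.
apply: (@le_trans _ _ (\int[P]_w \sum_(k < N) (Wsup (a + k%:Z) \_ (D k)) w)%E).
  rewrite ge0_integral_sum//.
  rewrite (eq_bigr (fun=> Wpeak setT)); last first.
    by move=> k _; rewrite -integral_mkcond Wpeak_shift.
  rewrite -(fineK (Wpeak_fin setT)) sumEFin sumr_const card_ord.
  by rewrite -EFinM mulr_natl.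
apply: ge0_le_integral => //.
- by move=> w _; apply: sume_ge0 => k _; exact: r0.
- exact: emeasurable_sum.
- exact: measurable_Wmax.
move=> w _; have [[k Dk]|noD] := pselect (exists k, D k w); last first.
  rewrite big1 ?Wmax_ge0// => k _; rewrite patchN// notin_setE => Dk.
  by apply: noD; exists k.
rewrite (bigD1 k)//= big1 ?adde0; last first.
  move=> i ik; rewrite patchN// notin_setE => Di.
  have h (k1 k2 : 'I_N) : (k1 < k2)%N -> D k1 w -> D k2 w -> False.
    by move=> k12; apply: first_max_disjoint; lia.
  have [ik'|ki'|e'] := ltngtP i k; [exact: h ik' Di Dk|exact: h ki' Dk Di|].
  by move: ik; rewrite -val_eqE /= e' eqxx.
rewrite patchT ?inE//.
exact: (@le_bigmax_seq _ _ _ _ 0%E k xpredT (fun k : 'I_N => Wsup (a + k%:Z) w)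
  (mem_index_enum k) isT).
Qed.

End window_maxima.

(** Monotonicity without measurability, read off from the integral as a supremum over simple
    functions: the supremum of a path over [0, T] need not be measurable. *)
Lemma ge0_le_integralT (R : realType) (d : measure_display)
    (W : measurableType d) (P : {measure set W -> \bar R}) (f g : W -> \bar R) :
  (forall w, 0 <= f w)%E -> (forall w, f w <= g w)%E ->
  (\int[P]_w f w <= \int[P]_w g w)%E.
Proof.
move=> f0 fg; rewrite !ge0_integralTE//; last by move=> w; exact: le_trans (fg w).
apply: le_ereal_sup => _ [h hf <-]; exists h => // w.
exact: le_trans (fg w).
Qed.

(** * Convergence of the mean supremum over growing intervals *)

Section peak_limit.
Context (R : realType) (d : measure_display) (W : measurableType d)
  (P : probability W R) (Y : R -> W -> R) (e : nat -> R).
Hypothesis mYt : forall t, measurable_fun setT (Y t).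
Hypothesis Y0 : forall t w, 0 <= Y t w.
Hypothesis EY : forall t, (\int[P]_w (Y t w)%:E = 1)%E.
Hypothesis Ystat : max_stationary P Y.
Hypothesis supY : (\int[P]_w ereal_sup (range (fun i => (Y (e i) w)%:E)) < +oo)%E.

Notation Wsup := (Wsup Y e).
Notation Wmax := (Wmax Y e).
Notation Wpeak := (Wpeak P Y e).

Definition centered (m : nat) : set int := [set j | - m%:Z <= j <= m%:Z]%R.

Let fin J : Wpeak J \is a fin_num := Wpeak_fin mYt Y0 supY J.

(** A window at distance at least [m] from both ends of the block competes with all offsets up to
    [m]; the at most [2 * m] others are bounded by the mean of [Wsup 0]. *)
Lemma int_Wmax_centered a N m :
  (\int[P]_w Wmax a N w <=
   (N%:R * fine (Wpeak (centered m)) +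
    (2 * m)%:R * fine (\int[P]_w Wsup 0 w))%:E)%E.
Proof.
set w0 := fine (\int[P]_w Wsup 0 w).
have w0E : (\int[P]_w Wsup 0 w)%E = w0%:E.
  rewrite /w0 fineK// ge0_fin_numE; first exact: EWsup0.
  by apply: integral_ge0 => w _; exact: Wsup_ge0.
have w00 : 0 <= w0 by apply: fine_ge0; apply: integral_ge0 => w _; exact: Wsup_ge0.
have A0 J : 0 <= fine (Wpeak J) by apply: fine_ge0; exact: Wpeak_ge0.
apply: le_trans (int_Wmax_le mYt Y0 EY Ystat supY a N) _.
apply: (@le_trans _ _ (\sum_(k < N) (fine (Wpeak (centered m)) +
    ((k < m) + (N <= k + m))%N%:R * w0)%:E)%E).
  apply: lee_sum => k _.
  have [km|km] := ltnP k m.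
    apply: (le_trans (Wpeak_leE P e mYt Y0 _)); rewrite w0E lee_fin.
    rewrite ler_wpDl// ler_peMl// ler1n; lia.
  have [kN|kN] := leqP N (k + m).
    apply: (le_trans (Wpeak_leE P e mYt Y0 _)); rewrite w0E lee_fin.
    by rewrite ler_wpDl// ler_peMl// ler1n.
  rewrite addn0 mul0r addr0 fineK//.
  by apply: Wpeak_le => // j; rewrite /centered/=; lia.
rewrite sumEFin lee_fin big_split/= sumr_const card_ord -mulr_suml mulr_natl lerD2l.
apply: ler_wpM2r => //; rewrite -natr_sum ler_nat big_split/= mul2n -addnn.
by apply: leq_add; [exact: sum_ord_lt|exact: sum_ord_gt].
Qed.

Lemma Wpeak_centered_lim eps : 0 < eps ->
  exists m, fine (Wpeak (centered m)) <= fine (Wpeak setT) + eps.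
Proof.
move=> eps0.
pose D J := shift_path Y 0 @^-1` first_max e J.
have mD J : measurable (D J).
  by apply: (measurable_shift_preimage mYt); exact: measurable_first_max.
have mW := measurable_Wsup e mYt 0.
have mWD J : measurable_fun setT (Wsup 0 \_ (D J)).
  by apply/(measurable_restrictT _ (mD J)); exact: measurable_funTS.
have iW : P.-integrable setT (Wsup 0).
  apply/integrableP; split=> //.
  under eq_integral do rewrite gee0_abs ?Wsup_ge0//.
  exact: EWsup0.
have cv : {ae P, forall w, setT w ->
    (Wsup 0 \_ (D (centered m))) w @[m --> \oo] --> (Wsup 0 \_ (D setT)) w}.
  apply: aeW => w _; apply: cvg_near_cst.
  have [wD|wD] := pselect (D setT w).
    apply: nearW => m; rewrite !patchT ?inE// => j _.
    exact: wD.
  have [j jP] : exists j, ~ ((window e j (shift_path Y 0 w) <= window e 0 (shift_path Y 0 w))%E /\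
    ((j < 0)%R -> (window e j (shift_path Y 0 w) < window e 0 (shift_path Y 0 w))%E)).
    by apply/existsNP => h'; apply: wD => j _; exact: h'.
  near=> m; rewrite !patchN// notin_setE; first exact: wD.
  move=> /(_ j) h'; apply: jP; apply: h'; rewrite /centered/=.
  have : (absz j <= m)%N by near: m; exact: nbhs_infty_ge.
  by lia.
have bnd : {ae P, forall w (m : nat), setT w ->
    (`|(Wsup 0 \_ (D (centered m))) w| <= Wsup 0 w)%E}.
  apply: aeW => w m _; rewrite /patch; case: ifP => _; rewrite ?abse0 ?Wsup_ge0//.
  by rewrite gee0_abs// Wsup_ge0.
have [_ _] := dominated_convergence measurableT (fun m => mWD (centered m))
  (mWD setT) cv iW bnd.
have -> : (\int[P]_w (Wsup 0 \_ (D setT)) w = (fine (Wpeak setT))%:E)%E.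
  by rewrite fineK// -integral_mkcond.
rewrite (_ : [sequence _]_n = fun m => (fine (Wpeak (centered m)))%:E); last first.
  by apply/funext => m; rewrite /= fineK// -integral_mkcond.
move=> /fine_cvgP[_ /cvgrPdist_lt/(_ _ eps0)[m _ /(_ m (leqnn m))]].
rewrite /= => h1; exists m.
have := ler_norm (fine (Wpeak (centered m)) - fine (Wpeak setT)).
by rewrite distrC => h2; have := le_lt_trans h2 h1; rewrite ltrBlDl => /ltW.
Unshelve. all: by end_near. Qed.

Hypothesis e01 : forall i, 0 <= e i < 1.
(** The block starts one window before 0 because separability controls a value through sample times
    in an open interval containing it. *)
Hypothesis sep : {ae P, forall w, forall (n : nat) t, 0 <= t < n%:R ->
  ((Y t w)%:E <= Wmax (- 1) n.+1 w)%E}.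

Definition sup_mean (T : R) : \bar R :=
  (\int[P]_w ereal_sup [set (Y t w)%:E | t in `[0%R, T]])%E.

Lemma sup_mean_ge (T : R) (n : nat) : n%:R <= T ->
  (\int[P]_w Wmax 0 n w <= sup_mean T)%E.
Proof.
move=> nT; apply: ge0_le_integralT => [w|w]; first exact: Wmax_ge0.
apply: bigmax_le => [|k _].
  apply: (@le_trans _ _ (Y 0 w)%:E); first by rewrite lee_fin.
  apply: ereal_sup_ubound; exists 0 => //=; rewrite in_itv/= lexx.
  by apply: le_trans nT.
apply: ge_ereal_sup => _ [i _ <-]; apply: ereal_sup_ubound.
exists (e i + (0 + k%:Z)%:~R) => //=; rewrite in_itv/= add0r.
have /andP[e0 e1] := e01 i; rewrite addr_ge0//=.
apply: le_trans nT; apply: (@le_trans _ _ (1 + k%:R)); first by rewrite lerD2r ltW.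
by rewrite nat1r ler_nat.
Qed.

Lemma sup_mean_le (T : R) (n : nat) : 0 <= T -> T < n%:R ->
  (sup_mean T <= \int[P]_w Wmax (- 1) n.+1 w)%E.
Proof.
move=> T0 Tn; have [N [mN PN0 hN]] := sep.
(* An infinite value on the exceptional null set makes the bound hold everywhere, as a comparison
   without measurability requires, and leaves the integral unchanged. *)
pose g w := maxe (Wmax (- 1) n.+1 w) ((cst +oo%E \_ N) w).
have mW := measurable_Wmax e mYt (- 1) n.+1.
have mg : measurable_fun setT g.
  apply: measurable_maxe => //; apply/(measurable_restrictT _ mN).
  exact: measurable_cst.
have W0 w : (0 <= Wmax (- 1) n.+1 w)%E by exact: Wmax_ge0.
have g0 w : (0 <= g w)%E by rewrite /g le_max W0.
have -> : (\int[P]_w Wmax (- 1) n.+1 w = \int[P]_w g w)%E.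
  apply: ge0_ae_eq_integral => //.
  exists N; split=> // w /= h; apply: contrapT => wN; apply: h => _.
  have e0 : (cst +oo%E \_ N) w = 0%E by rewrite /= /patch memNset.
  by rewrite /g e0 max_l.
apply: ge0_le_integralT => [w|w].
  apply: (@le_trans _ _ (Y 0 w)%:E); first by rewrite lee_fin.
  by apply: ereal_sup_ubound; exists 0 => //=; rewrite in_itv/= lexx.
apply: ge_ereal_sup => x [t] /=; rewrite in_itv/= => /andP[t0 tT] <-.
have [wN|wN] := pselect (N w).
  by rewrite /g patchT ?inE// le_max leey orbT.
rewrite /g le_max; apply/orP; left.
have [h|h] := pselect (forall (n : nat) t, 0 <= t < n%:R -> ((Y t w)%:E <= Wmax (- 1) n.+1 w)%E).
  by apply: h; rewrite t0/=; exact: le_lt_trans Tn.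
by exfalso; apply: wN; apply: hN.
Qed.

Lemma sup_mean_limit :
  ((T^-1)%:E * sup_mean T)%E @[T --> +oo] --> Wpeak setT.
Proof.
set w0 := fine (\int[P]_w Wsup 0 w).
have w00 : 0 <= w0 by apply: fine_ge0; apply: integral_ge0 => w _; exact: Wsup_ge0.
have A0 J : 0 <= fine (Wpeak J) by apply: fine_ge0; exact: Wpeak_ge0.
pose s T := fine (sup_mean T).
(* With [n] the integer part of [T], the lower bound uses [n >= T - 1] windows and the upper bound
   [n + 2 <= T + 2]: one for the incomplete window at [T], one for the window before 0. *)
have bounds T m : 0 < T -> [/\ sup_mean T = (s T)%:E,
    (T - 1) * fine (Wpeak setT) <= s T &
    s T <= (T + 2) * fine (Wpeak (centered m)) + (2 * m)%:R * w0].
  move=> T0; set n := Num.truncn T.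
  have /andP[nT Tn] : n%:R <= T < n.+1%:R by apply: truncn_itv; exact: ltW.
  have lo := le_trans (int_Wmax_ge mYt Y0 EY Ystat supY 0 n) (sup_mean_ge nT).
  have hi := le_trans (sup_mean_le (ltW T0) Tn) (int_Wmax_centered (- 1) n.+2 m).
  have fins : sup_mean T = (s T)%:E.
    rewrite /s fineK// ge0_fin_numE; first exact: le_lt_trans hi (ltry _).
    by apply: le_trans lo; rewrite mule_ge0 ?lee_fin// Wpeak_ge0.
  move: lo hi; rewrite fins -(fineK (fin setT)) -EFinM !lee_fin => lo hi; split=> //.
    apply: le_trans lo; apply: (ler_wpM2r (A0 _)).
    by rewrite lerBlDr natr1 ltW.
  apply: (le_trans hi); rewrite lerD2r; apply: (ler_wpM2r (A0 _)).
  by rewrite -addn2 natrD lerD2r.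
rewrite -(fineK (fin setT)); set a := fine _.
have a0 : 0 <= a by exact: A0.
apply/fine_cvgP; split.
  near=> T; have T0 : 0 < T by near: T; exact: nbhs_pinfty_gt.
  by have [-> _ _] := bounds T 0%N T0.
apply/cvgrPdist_le => eps eps0.
have eps20 : 0 < eps / 2 by rewrite divr_gt0.
have [m Am] := Wpeak_centered_lim eps20.
set A := fine (Wpeak (centered m)) in Am.
near=> T; have T0 : 0 < T by near: T; exact: nbhs_pinfty_gt.
(* [h1] absorbs the lower error [a] into [eps * T]; [h2] absorbs the upper boundary terms into half
   of it, the other half paying for [A - a]. *)
have h1 : a / eps <= T by near: T; apply: nbhs_pinfty_ge; exact: num_real.
have h2 : (2 * A + (2 * m)%:R * w0) / (eps / 2) <= T.
  by near: T; apply: nbhs_pinfty_ge; exact: num_real.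
have [sE lo hi] := bounds T m T0; rewrite /= sE /=.
rewrite ler_pdivrMr// in h1; rewrite ler_pdivrMr ?divr_gt0// in h2.
rewrite -/a -/A in lo hi h2.
have TA : T * A <= T * (a + eps / 2) by rewrite ler_pM2l.
have -> : a - T^-1 * s T = (T * a - s T) / T.
  by rewrite mulrBl mulrAC mulfV ?mul1r ?gt_eqF// [s T / T]mulrC.
rewrite normrM (gtr0_norm (_ : 0 < T^-1)) ?invr_gt0// ler_pdivrMr// ler_norml.
apply/andP; split.
  rewrite -subr_ge0; nra.
rewrite -subr_ge0; nra.
Unshelve. all: by end_near. Qed.

End peak_limit.

(** * A positive Pickands constant forces finite mass *)

Lemma lebesgue_measure_translate (R : realType) (c : R) (A : set R) : measurable A ->
  pushforward lebesgue_measure ((fun x => x + c) : _ -> measurableTypeR R) A =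
  lebesgue_measure A.
Proof.
move=> mA; have mc : measurable_fun setT ((fun x => x + c) : measurableTypeR R -> measurableTypeR R).
  exact: measurable_funD.
apply/esym/lebesgue_measure_unique => //= _ [[a b]] _ <-.
rewrite /pushforward (_ : _ @^-1` _ = `]a - c, b - c]%classic); last first.
  by apply/seteqP; split=> x /=; rewrite !in_itv/= ltrBlDr lerBrDr.
by rewrite !lebesgue_measure_itv/= !lte_fin ltrD2r -!EFinB opprD addrACA subrr addr0.
Qed.

Lemma ge0_integral_translate (R : realType) (c : R) (D : set R) (f : R -> \bar R) :
  measurable D -> measurable_fun setT f -> (forall x, 0 <= f x)%E ->
  (\int[lebesgue_measure]_(x in D) f x =
   \int[lebesgue_measure]_(x in (fun x => (x + c)%R) @^-1` D) f (x + c)%R)%E.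
Proof.
move=> mD mf f0.
have mc : measurable_fun setT ((fun x => x + c) : measurableTypeR R -> measurableTypeR R).
  exact: measurable_funD.
have mfD : measurable_fun D f by exact: measurable_funTS.
have f0D : {in D, forall y, 0 <= f y}%E by move=> y _; exact: f0.
rewrite -[RHS](ge0_integral_pushforward mc _ mD mfD f0D).
by apply: eq_measure_integral => //= A mA AS; exact/esym/lebesgue_measure_translate.
Qed.

(** The enumeration 0, -1, 1, -2, 2, ... of the integers. *)
Definition zint (n : nat) : int := if odd n then - (n./2.+1)%:Z else (n./2)%:Z.

Lemma zint_inj : injective zint.
Proof.
move=> m n; rewrite /zint; have := odd_double_half m; have := odd_double_half n.
by move: (odd m) (odd n) m./2 n./2 => [] [] x y /= <- <- h; lia.
Qed.

Lemma zint_surj k : exists n, zint n = k.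
Proof.
rewrite /zint; have [k0|k0] := leP 0 k.
  by exists (`|k|%N).*2; rewrite odd_double doubleK; lia.
by exists (`|k|%N.-1).*2.+1; rewrite /= odd_double /= uphalf_double; lia.
Qed.

(** Stated for any injective [z] to serve twice: with [zint] the intervals cover the line, with the
    natural numbers a half-line. *)
Lemma fold_integral (R : realType) (a : R) (z : nat -> int) (f : R -> \bar R) :
  injective z -> measurable_fun setT f -> (forall x, 0 <= f x)%E ->
  (\int[lebesgue_measure]_(x in \bigcup_n `[(a + (z n)%:~R)%R, (a + (z n)%:~R + 1)%R[%classic) f x =
   \int[lebesgue_measure]_(x in `[a, (a + 1)%R[%classic)
     \sum_(n <oo) f (x + (z n)%:~R)%R)%E.
Proof.
move=> zi mf f0; rewrite ge0_integral_bigcup//; last 2 first.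
- exact: measurable_funTS.
- apply/trivIsetP => i j _ _ ij; apply/seteqP; split=> x //=.
  rewrite !in_itv/= => -[/andP[h1 h2] /andP[h3 h4]].
  have : (z i < z j + 1)%R by rewrite -(ltr_int R) intrD; lra.
  have : (z j < z i + 1)%R by rewrite -(ltr_int R) intrD; lra.
  move=> h5 h6; have /zi e : z i = z j by lia.
  by rewrite e eqxx in ij.
rewrite integral_nneseries//; last first.
  move=> n; apply: measurable_funTS.
  exact: measurableT_comp mf (measurable_funD _ _).
apply: eq_eseriesr => n _; rewrite (ge0_integral_translate (z n)%:~R)//.
congr integral; apply/seteqP; split=> x /=; rewrite !in_itv/=.
  by move=> /andP[h1 h2]; apply/andP; lra.
by move=> /andP[h1 h2]; apply/andP; lra.
Qed.

Lemma zint_cover (R : realType) (a : R) :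
  \bigcup_n `[a + (zint n)%:~R, a + (zint n)%:~R + 1[%classic = [set: R].
Proof.
apply/seteqP; split=> // x _; have [n zn] := zint_surj (Num.floor (x - a)).
exists n => //=; rewrite in_itv/= zn; have := floor_itv (x - a).
by rewrite intrD => /andP[h1 h2]; apply/andP; lra.
Qed.

Section integral_of_paths.
Context (R : realType) (d : measure_display) (W : measurableType d)
  (P : probability W R) (Y : R -> W -> R).
Hypothesis mY : jointly_measurable Y.
Hypothesis Y0 : forall t w, 0 <= Y t w.

Definition path_mass (w : W) : \bar R :=
  (\int[lebesgue_measure]_(t in setT) (Y t w)%:E)%E.

Lemma path_mass_ge0 w : (0 <= path_mass w)%E.
Proof. by apply: integral_ge0 => t _; rewrite lee_fin. Qed.

Lemma measurable_joint : measurable_fun setT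
  (fun p : measurableTypeR R * W => (Y p.1 p.2)%:E).
Proof. exact/measurable_EFinP. Qed.

Lemma measurable_path_mass : measurable_fun setT path_mass.
Proof.
have := @measurable_fun_fubini_tonelli_G _ _ _ _ R lebesgue_measure _ measurable_joint.
by apply => p; rewrite lee_fin.
Qed.

Lemma measurable_path_mass_fin : measurable [set w | (path_mass w < +oo)%E].
Proof.
have := emeasurable_fun_infty_o measurableT measurable_path_mass +oo%E.
by rewrite setTI.
Qed.

Lemma integral_path_mass (D : set W) : measurable D ->
  (\int[P]_(w in D) path_mass w =
   \int[lebesgue_measure]_(t in setT) \int[P]_(w in D) (Y t w)%:E)%E.
Proof.
move=> mD.
pose f (p : measurableTypeR R * W) : \bar R := (Y p.1 p.2 * \1_D p.2)%:E.
have mf : measurable_fun setT f.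
  apply/measurable_EFinP; apply: measurable_funM => //.
  apply: (measurableT_comp (measurable_indic mD)); exact: measurable_snd.
have f0 p : (0 <= f p)%E by rewrite lee_fin mulr_ge0.
have := @fubini_tonelli _ _ _ _ R lebesgue_measure P f mf f0.
rewrite /f/= => e.
transitivity (\int[P]_w \int[lebesgue_measure]_t (Y t w * \1_D w)%:E)%E.
  rewrite integral_mkcond; apply: eq_integral => w _; rewrite /patch indicE.
  case: (w \in D) => /=.
    by apply: eq_integral => t _; rewrite mulr1.
  by under eq_integral do rewrite mulr0; rewrite integral0.
rewrite -e; apply: eq_integral => t _; rewrite [RHS]integral_mkcond.
apply: eq_integral => w _; rewrite /patch indicE.
by case: (w \in D); rewrite ?mulr1 ?mulr0.
Qed.

Lemma measurable_slice (D : set W) : measurable D ->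
  measurable_fun setT (fun t : R => \int[P]_(w in D) (Y t w)%:E)%E.
Proof.
move=> mD.
pose f (p : measurableTypeR R * W) : \bar R := (Y p.1 p.2 * \1_D p.2)%:E.
have mf : measurable_fun setT f.
  apply/measurable_EFinP; apply: measurable_funM => //.
  apply: (measurableT_comp (measurable_indic mD)); exact: measurable_snd.
have f0 p : (0 <= f p)%E by rewrite lee_fin mulr_ge0.
have := @measurable_fun_fubini_tonelli_F _ _ _ _ R P f mf f0.
congr measurable_fun; apply/funext => t; rewrite /fubini_F [RHS]integral_mkcond.
apply: eq_integral => w _; rewrite /patch /f /= indicE.
by case: (w \in D); rewrite ?mulr1 ?mulr0.
Qed.

Hypothesis EY : forall t, (\int[P]_w (Y t w)%:E = 1)%E.
Hypothesis Ystat : max_stationary P Y.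
Variable e : nat -> R.
Hypothesis supY : (\int[P]_w ereal_sup (range (fun i => (Y (e i) w)%:E)) < +oo)%E.

Let mYt t : measurable_fun setT (Y t).
Proof. exact: jointly_measurable_section. Qed.

(* The integer shifts of the event that the window at 0 is the first maximum
   are disjoint, so the mass carried by the peak is at most E Y(u), averaged
   over u in [0, 1). *)
Lemma integral_mass_peak :
  (\int[P]_(w in shift_path Y 0 @^-1` first_max e setT) path_mass w <= 1)%E.
Proof.
set D := _ @^-1` _.
have mF : measurable (first_max e setT : set (path_space R)) by exact: measurable_first_max.
have mD : measurable D by exact: (measurable_shift_preimage mYt).
rewrite integral_path_mass// -(zint_cover 0) fold_integral; last 3 first.
- exact: zint_inj.
- exact: measurable_slice.
- by move=> t; apply: integral_ge0 => w _; rewrite lee_fin.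
pose Dn n := shift_path Y (- zint n)%:~R @^-1` first_max e setT.
have mDn n : measurable (Dn n) by exact: (measurable_shift_preimage mYt).
have tDn : trivIset setT Dn.
  apply/trivIsetP => i j _ _ ij; apply/seteqP; split=> w // [Di Dj].
  have [h|h|h] := ltgtP (zint i) (zint j).
  - have hlt : (- zint j < - zint i)%R by lia.
    exact: (first_max_disjoint hlt Dj Di).
  - have hlt : (- zint i < - zint j)%R by lia.
    exact: (first_max_disjoint hlt Di Dj).
  - by move/zint_inj : h ij => ->; rewrite eqxx.
apply: (@le_trans _ _ (\int[lebesgue_measure]_(x in `[0%R, (0 + 1)%R[) (cst 1%E x))%E).
  apply: ge0_le_integral => //.
  - move=> u _; apply: nneseries_ge0 => n _ _; apply: integral_ge0 => w _.
    by rewrite lee_fin.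
  - apply: ge0_emeasurable_sum => [n u _ _|n _].
      by apply: integral_ge0 => w _; rewrite lee_fin.
    apply: measurable_funTS; apply: (measurableT_comp (measurable_slice mD)).
    exact: measurable_funD.
  move=> u _ /=.
  (* Shifting time by [- zint n] moves every weight to the single time [u] and spreads [D] into the
     disjoint events [Dn n], so the sum is at most E Y u = 1. *)
  rewrite (eq_eseriesr (g := fun n => \int[P]_(w in Dn n) (Y u w)%:E)%E); last first.
    move=> n _; rewrite -(cone_shift mYt Y0 EY Ystat (- zint n)%:~R)//; last first.
      exact: cone_first_max.
    by apply: eq_integral => w _; rewrite mulrNz addrK.
  rewrite -ge0_integral_bigcup//; last 2 first.
  - exact/measurable_EFinP/measurable_funTS.
  - by move=> w _; rewrite lee_fin.
  rewrite -(EY u); apply: ge0_subset_integral => //.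
  - exact: bigcup_measurable.
  - exact/measurable_EFinP.
  - by move=> w _; rewrite lee_fin.
rewrite integral_cst// mul1e.
apply: (@le_trans _ _ (lebesgue_measure (`[0, 0 + 1[%classic : set R))) => //.
by rewrite lebesgue_measure_itv/= lte_fin add0r ltr01 oppr0 adde0.
Qed.

(** A mean of at most 1 makes the mass almost surely finite on the peak event; were it almost surely
    infinite, that event would be null and the peak mean 0. *)
Lemma peak_mass_finite : (0 < Wpeak P Y e setT)%E ->
  (0 < P [set w | path_mass w < +oo])%E.
Proof.
set D := shift_path Y 0 @^-1` first_max e setT.
have mF : measurable (first_max e setT : set (path_space R)) by exact: measurable_first_max.
have mD : measurable D by exact: (measurable_shift_preimage mYt).
have mS := measurable_path_mass_fin.
move=> pos; rewrite lt0e measure_ge0 andbT; apply/eqP => PS0.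
have PD : P D = 0%E.
  have iD : P.-integrable D path_mass.
    apply/integrableP; split; first exact: measurable_funTS measurable_path_mass.
    rewrite (eq_integral path_mass); last by move=> w _; rewrite gee0_abs ?path_mass_ge0.
    exact: le_lt_trans integral_mass_peak (ltry _).
  have [N [mN PN hN]] := integrable_ae mD iD.
  apply/eqP; rewrite -measure_le0.
  apply: (@le_trans _ _ (P (N `|` [set w | path_mass w < +oo])))%E.
    apply: le_measure; rewrite ?inE//; first exact: measurableU.
    move=> w Dw; have [fw|fw] := pselect (path_mass w < +oo)%E; first by right.
    by left; apply: hN => /= /(_ Dw); rewrite ge0_fin_numE ?path_mass_ge0.
  apply: le_trans (measureU2 _ _ _) _ => //.
  by rewrite [X in (X + _)%E]PN [X in (_ + X)%E]PS0 adde0.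
move: pos; rewrite /Wpeak -/D lt_neqAle => /andP[/eqP + _]; apply; apply/esym.
transitivity (\int[P]_(w in D) `|Wsup Y e 0 w|)%E.
  by apply: eq_integral => w _; rewrite gee0_abs// Wsup_ge0.
by apply: integral_abs_eq0 => //; apply: measurable_funTS; exact: measurable_Wsup.
Qed.

End integral_of_paths.

(** * Finite mass forces a positive Pickands constant *)

(* If the k-th term is the first one counted, all counted terms have index >= k
   and y_j / M <= min (y_j / y_k) 1, so their sum is at most q M. *)
Lemma sum_dominated_terms (R : realType) (q M : R) (n : nat) (y : nat -> R) :
  0 <= q -> (forall k, 0 <= y k) -> (forall k, (k < n)%N -> y k <= M) -> 0 <= M ->
  \sum_(k < n) (if \sum_(j < n - k) Num.min (y (k + j)%N) (y k) <= q * y k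
                then y k else 0) <= q * M.
Proof.
move=> q0; elim: n y => [|n IH] y y0 yM M0; first by rewrite big_ord0 mulr_ge0.
rewrite big_ord_recl/=.
have tail : \sum_(i < n) (if \sum_(j < n.+1 - bump 0 i) Num.min (y (bump 0 i + j)%N) (y (bump 0 i))
      <= q * y (bump 0 i) then y (bump 0 i) else 0) <= q * M.
  have := IH (fun k => y k.+1) (fun k => y0 _) (fun k kn => yM k.+1 kn) M0.
  apply: le_trans; rewrite le_eqVlt; apply/orP; left; apply/eqP.
  by apply: eq_bigr => i _; rewrite /bump/= add1n subSS.
case: ifPn => h; last by rewrite add0r.
have [y00|y00] := eqVneq (y 0%N) 0; first by rewrite y00 add0r.
have {}y00 : 0 < y 0%N by rewrite lt_neqAle eq_sym y00 y0.
have M0' : 0 < M by exact: lt_le_trans y00 (yM 0%N isT).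
rewrite subn0 in h.
apply: (@le_trans _ _ (\sum_(j < n.+1) y j)).
  rewrite big_ord_recl/= lerD2l; apply: ler_sum => i _.
  by case: ifP => // _; rewrite y0.
have h2 : \sum_(j < n.+1) y j * (y 0%N / M) <= q * y 0%N.
  apply: le_trans h; apply: ler_sum => j _; rewrite add0n le_min.
  have le1 (i : 'I_n.+1) : y i / M <= 1 by rewrite ler_pdivrMr// mul1r yM.
  by rewrite ler_piMr//=; [rewrite mulrCA ler_piMr// ltW|exact: (le1 ord0)].
move: h2; rewrite -mulr_suml mulrA ler_pdivrMr// mulrAC ler_pM2r//.
Qed.

Section mass_to_peak.
Context (R : realType) (d : measure_display) (W : measurableType d)
  (P : probability W R) (Y : R -> W -> R).
Hypothesis mY : jointly_measurable Y.
Hypothesis Y0 : forall t w, 0 <= Y t w.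
Hypothesis EY : forall t, (\int[P]_w (Y t w)%:E = 1)%E.
Hypothesis Ystat : max_stationary P Y.

Let mYt t : measurable_fun setT (Y t).
Proof. exact: jointly_measurable_section. Qed.

(** Only times after 0 are summed, since the deterministic inequality looks at the terms following
    the first one counted. Bounding every partial sum gives a countable intersection of conditions
    on coordinates. *)
Definition dominated_path (q : R) : set (path_space R) :=
  [set y | forall N, \sum_(j < N) Num.min (y j%:R) (y 0) <= q * y 0].

Lemma measurable_dominated_path q : measurable (dominated_path q).
Proof.
rewrite (_ : dominated_path q = \bigcap_N
    [set y : path_space R | \sum_(j < N) Num.min (y j%:R) (y 0) <= q * y 0]).
  apply: bigcapT_measurable => N; apply: measurable_set_le.
    apply: (@measurable_sum _ (path_space R) _ _ _ _
      (fun (j : 'I_N) (y : path_space R) => Num.min (y j%:R) (y 0))) => j.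
    by apply: measurable_minr; exact: measurable_path_eval.
  by apply: measurable_funM => //; exact: measurable_path_eval.
by apply/seteqP; split=> y /= h N; [move=> _|]; exact: h.
Qed.

Lemma cone_dominated_path q : cone (dominated_path q).
Proof.
move=> c y c0 h N.
under eq_bigr do rewrite -minr_pMr ?(ltW c0)//.
by rewrite -mulr_sumr mulrCA ler_pM2l//; exact: h.
Qed.

(** The number c_q. *)
Definition dominated_mean (q : R) : \bar R :=
  (\int[P]_(w in shift_path Y 0 @^-1` dominated_path q) (Y 0 w)%:E)%E.

Let mdom t q : measurable (shift_path Y t @^-1` dominated_path q).
Proof. by apply: (measurable_shift_preimage mYt); exact: measurable_dominated_path. Qed.

Lemma dominated_mean_shift t q :
  (\int[P]_(w in shift_path Y t @^-1` dominated_path q) (Y t w)%:E = dominated_mean q)%E.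
Proof.
have := cone_shift mYt Y0 EY Ystat t 0 (@measurable_dominated_path q)
  (@cone_dominated_path q).
by rewrite add0r.
Qed.

(** The inequality c_q <= q H before division by the length: by shift invariance [n] times c_q is
    the mean of the sum of the counted terms among Y 0, ..., Y (n - 1). *)
Lemma dominated_mean_le q (T : R) (n : nat) : 0 <= q -> (0 < n)%N -> n%:R <= T ->
  (n%:R%:E * dominated_mean q <= q%:E * sup_mean P Y T)%E.
Proof.
move=> q0 n0 nT.
pose D (k : 'I_n) := shift_path Y k%:R @^-1` dominated_path q.
pose M w := \big[Num.max/0]_(k <- iota 0 n) Y k%:R w.
have mM : measurable_fun setT M.
  by apply: (@measurable_bigmaxr R _ W _ _ (fun (k : nat) w => Y k%:R w)) => k.
have mr (k : 'I_n) : measurable_fun setT ((fun w => (Y k%:R w)%:E) \_ (D k)).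
  apply/(measurable_restrictT _ (mdom _ _)).
  by apply/measurable_EFinP; exact: measurable_funTS.
have r0 (k : 'I_n) w : (0 <= ((fun w => (Y k%:R w)%:E) \_ (D k)) w)%E.
  by apply: erestrict_ge0 => w' _; rewrite lee_fin.
apply: (@le_trans _ _ (\int[P]_w (q%:E * (M w)%:E))%E); last first.
  rewrite ge0_integralZl_EFin//; last 2 first.
  - by move=> w _; rewrite lee_fin bigmax0_ge0.
  - exact/measurable_EFinP.
  apply: lee_wpmul2l; rewrite ?lee_fin//.
  apply: ge0_le_integralT => [w|w]; first by rewrite lee_fin bigmax0_ge0.
  rewrite /M big_seq; elim/big_ind: _ => [|x1 x2 h1 h2|k].
  - apply: (@le_trans _ _ (Y 0 w)%:E); first by rewrite lee_fin.
    apply: ereal_sup_ubound; exists 0 => //=; rewrite in_itv/= lexx.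
    by apply: le_trans nT.
  - by rewrite EFin_max ge_max h1.
  rewrite mem_iota => /andP[_ kn]; apply: ereal_sup_ubound; exists k%:R => //=.
  rewrite in_itv/= ler0n/=; apply: le_trans nT.
  by rewrite ler_nat ltnW.
have cE : dominated_mean q \is a fin_num.
  rewrite ge0_fin_numE; last by apply: integral_ge0 => w _; rewrite lee_fin.
  apply: (@le_lt_trans _ _ (\int[P]_w (Y 0 w)%:E)%E); last by rewrite EY ltry.
  apply: ge0_subset_integral => //; first exact/measurable_EFinP.
  by move=> w _; rewrite lee_fin.
apply: (@le_trans _ _ (\int[P]_w \sum_(k < n) ((fun w => (Y k%:R w)%:E) \_ (D k)) w)%E).
  rewrite ge0_integral_sum//.
  rewrite (eq_bigr (fun=> dominated_mean q)); last first.
    by move=> k _; rewrite -integral_mkcond dominated_mean_shift.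
  rewrite -(fineK cE) sumEFin sumr_const card_ord.
  by rewrite -EFinM mulr_natl.
apply: ge0_le_integral => //.
- by move=> w _; apply: sume_ge0 => k _; exact: r0.
- exact: emeasurable_sum.
- by apply/measurable_EFinP; exact: measurable_funM.
move=> w _; rewrite -EFinM.
have := @sum_dominated_terms R q (M w) n (fun k => Y k%:R w) q0 (fun k => Y0 _ _).
move=> /(_ _ (bigmax0_ge0 _ _)) h.
apply: (@le_trans _ _ (\sum_(k < n) (if \sum_(j < n - k)
    Num.min (Y (k + j)%:R w) (Y k%:R w) <= q * Y k%:R w then Y k%:R w else 0))%:E).
  rewrite -sumEFin; apply: lee_sum => k _; rewrite /patch.
  have [Dk|_] := boolP (w \in D k); last by case: ifP => _; rewrite lee_fin.
  rewrite ifT//; move: Dk; rewrite inE => /(_ (n - k)%N).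
  rewrite /shift_path/= add0r; apply: le_trans.
  by apply: ler_sum => j _; rewrite natrD addrC.
rewrite lee_fin; apply: h => k kn.
by apply: (@le_bigmax0 R _ _ (fun k => Y k%:R w)); rewrite mem_iota.
Qed.

End mass_to_peak.

Lemma measurable_section_snd (R : realType) (d : measure_display) (W : measurableType d)
    (f : measurableTypeR R * W -> \bar R) (u : R) :
  measurable_fun setT f -> measurable_fun setT (fun w => f (u, w)).
Proof.
move=> mf; have := measurableT_comp mf (@measurable_pair1 _ _ _ _ (u : measurableTypeR R)).
exact.
Qed.

Lemma measurable_section_fst (R : realType) (d : measure_display) (W : measurableType d)
    (f : measurableTypeR R * W -> \bar R) (w : W) :
  measurable_fun setT f -> measurable_fun setT (fun u : measurableTypeR R => f (u, w)).
Proof.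
by move=> mf; have := measurableT_comp mf (@measurable_pair2 _ _ (measurableTypeR R) _ w).
Qed.

(** * Vanishing of [Y] on the event of finite mass *)

Section mass_positive.
Context (R : realType) (d : measure_display) (W : measurableType d)
  (P : probability W R) (Y : R -> W -> R).
Hypothesis mY : jointly_measurable Y.
Hypothesis Y0 : forall t w, 0 <= Y t w.
Hypothesis EY : forall t, (\int[P]_w (Y t w)%:E = 1)%E.
Hypothesis Ystat : max_stationary P Y.

Let mYt t : measurable_fun setT (Y t).
Proof. exact: jointly_measurable_section. Qed.

Definition lattice_mass (p : measurableTypeR R * W) : \bar R :=
  (\sum_(n <oo) (Y (p.1 + (n%:Z)%:~R) p.2)%:E)%E.

Lemma measurable_lattice_mass : measurable_fun setT lattice_mass.
Proof.
apply: ge0_emeasurable_sum => [n p _ _|n _]; first by rewrite lee_fin.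
apply/measurable_EFinP.
have mt : measurable_fun setT (fun p : measurableTypeR R * W =>
    ((p.1 + (n%:Z)%:~R : measurableTypeR R), p.2)).
  apply: measurable_fun_pair => //.
  by apply: measurable_funD.
exact: measurableT_comp mY mt.
Qed.

Lemma integral_lattice_mass t0 w :
  (\int[lebesgue_measure]_(u in `[t0, (t0 + 1)%R[%classic) lattice_mass (u, w)
   <= path_mass Y w)%E.
Proof.
have mw : measurable_fun setT (fun t : R => (Y t w)%:E).
  exact: (measurable_section_fst w (measurable_joint mY)).
have zi : injective Posz by move=> i j [].
have Y0E t : (0 <= (Y t w)%:E)%E by rewrite lee_fin.
have := fold_integral t0 zi mw Y0E; rewrite /lattice_mass/= => <-.
apply: ge0_subset_integral => //.
by apply: bigcup_measurable.
Qed.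

Lemma lattice_mass_ge0 p : (0 <= lattice_mass p)%E.
Proof. by apply: nneseries_ge0 => n _ _; rewrite lee_fin. Qed.

Hypothesis dom0 : forall q : nat, dominated_mean P Y q.+1%:R = 0%E.

(** If Y u > 0 and the sum along u + n is a finite [r], the path seen from [u] is dominated with any
    constant above [r / Y u]. These events increase with the constant, and Y u integrates to 0 over
    each. *)
Lemma finite_lattice_mass_null u :
  (\int[P]_(w in [set w | lattice_mass (u, w) < +oo]) (Y u w)%:E = 0)%E.
Proof.
pose E (q : nat) := shift_path Y u @^-1` dominated_path (R := R) q.+1%:R.
have mE q : measurable (E q).
  by apply: (measurable_shift_preimage mYt); exact: measurable_dominated_path.
have E0 q : (\int[P]_(w in E q) (Y u w)%:E = 0)%E.
  by rewrite -(dom0 q) -(dominated_mean_shift mY Y0 EY Ystat u q.+1%:R).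
have mYu (D : set W) : measurable_fun D (fun w => (Y u w)%:E).
  by apply/measurable_EFinP; exact: measurable_funTS.
have EU : (\int[P]_(w in \bigcup_q E q) (Y u w)%:E = 0)%E.
  have ndE : nondecreasing_seq E.
    apply/nondecreasing_seqP => q; apply/subsetPset => w h N.
    apply: le_trans (h N) _; apply: ler_wpM2r; first exact: Y0.
    by rewrite ler_nat.
  have h0 q w : E q w -> (0 <= (Y u w)%:E)%E by move=> _; rewrite lee_fin.
  have : (\int[P]_(w in E q) (Y u w)%:E)%E @[q --> \oo] -->
      (\int[P]_(w in \bigcup_q E q) (Y u w)%:E)%E.
    exact: (ge0_nondecreasing_set_cvg_integral ndE mE (fun q => mYu (E q)) h0).
  rewrite (_ : (fun q => _) = (fun=> 0%E)); last exact/funext.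
  by move=> cv; exact: (cvg_unique (@ereal_hausdorff R) cv (cvg_cst _)).
have mF : measurable [set w | (lattice_mass (u, w) < +oo)%E].
  have m1 : measurable_fun setT (fun w => lattice_mass (u, w)).
    exact: (measurable_section_snd u measurable_lattice_mass).
  have := emeasurable_fun_infty_o measurableT m1 +oo%E.
  by rewrite setTI.
apply/eqP; rewrite eq_le integral_ge0 ?andbT; last by move=> w _; rewrite lee_fin.
rewrite -EU integral_mkcond [leRHS]integral_mkcond.
have mU : measurable (\bigcup_q E q) by exact: bigcup_measurable.
apply: ge0_le_integral => //.
- by move=> w _; apply: erestrict_ge0 => w' _; rewrite lee_fin.
- exact/(measurable_restrictT _ mF).
- exact/(measurable_restrictT _ mU).
move=> w _; rewrite /patch; case: ifPn => [|_]; last first.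
  by case: ifP => _; rewrite lee_fin.
rewrite inE => /= Fw; case: ifPn => // /negP nU; rewrite lee_fin leNgt; apply/negP => Yu.
apply: nU; rewrite inE.
pose r := fine (lattice_mass (u, w)).
have rE : lattice_mass (u, w) = r%:E.
  by rewrite fineK// ge0_fin_numE// lattice_mass_ge0.
exists (Num.truncn (r / Y u w)) => // N; rewrite /shift_path/= add0r.
apply: (@le_trans _ _ r).
  rewrite -lee_fin -rE.
  apply: (@le_trans _ _ (\sum_(0 <= j < N) (Y (u + (j%:Z)%:~R) w)%:E)%E).
    rewrite big_mkord sumEFin lee_fin; apply: ler_sum => j _.
    by rewrite ge_min -pmulrn [u + _]addrC lexx.
  by apply: nneseries_lim_ge => j _ _; rewrite lee_fin.
rewrite -ler_pdivrMr//; apply: ltW; exact: truncnS_gt.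
Qed.

(** For a path of finite mass the lattice sum is finite at almost every [u]. By Tonelli the part of
    the slice where it is infinite integrates to 0 over [u], and the rest vanishes by the previous
    lemma. *)
Lemma mass_finite_slice_null t0 :
  (\int[lebesgue_measure]_(u in `[t0, (t0 + 1)%R[%classic)
     \int[P]_(w in [set w | path_mass Y w < +oo]) (Y u w)%:E = 0)%E.
Proof.
set I := `[t0, (t0 + 1)%R[%classic; set B := [set w | _].
have mB : measurable B by exact: measurable_path_mass_fin.
have mI : measurable (I : set (measurableTypeR R)) by exact: measurable_itv.
pose E := [set p | lattice_mass p = +oo%E].
have mE : measurable E.
  rewrite (_ : E = lattice_mass @^-1` [set +oo%E]) //.
  by rewrite -[X in measurable X]setTI; exact: measurable_lattice_mass.
(* The part of [Y] to be discarded: finite mass, infinite lattice sum, time in [I]. *)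
pose k (p : measurableTypeR R * W) : \bar R :=
  (Y p.1 p.2 * (\1_B p.2 * \1_E p * \1_I p.1))%:E.
have mk : measurable_fun setT k.
  apply/measurable_EFinP; apply: measurable_funM => //.
  apply: measurable_funM; last first.
    by apply: (measurableT_comp (measurable_indic mI)); exact: measurable_fst.
  apply: measurable_funM; last exact: measurable_indic.
  by apply: (measurableT_comp (measurable_indic mB)); exact: measurable_snd.
have k0 p : (0 <= k p)%E by rewrite lee_fin !mulr_ge0.
have tonelli := @fubini_tonelli _ _ _ _ R lebesgue_measure P k mk k0.
have rhs0 : (\int[P]_w \int[lebesgue_measure]_u k (u, w) = 0)%E.
  apply: integral0_eq => w _.
  have [wB|wB] := pselect (B w); last first.
    have B0 : \1_B w = 0 :> R by rewrite indicE memNset.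
    by apply: integral0_eq => u _; rewrite /k/= B0 !mul0r mulr0.
  have iR : lebesgue_measure.-integrable I (fun u => lattice_mass (u, w)).
    apply/integrableP; split.
      apply: measurable_funTS.
      exact: (measurable_section_fst w measurable_lattice_mass).
    rewrite (eq_integral (fun u => lattice_mass (u, w))); last first.
      by move=> u _; rewrite gee0_abs ?lattice_mass_ge0.
    exact: le_lt_trans (integral_lattice_mass t0 w) wB.
  transitivity (\int[@lebesgue_measure R]_u (cst 0%E u))%E; last exact: integral0.
  apply: ge0_ae_eq_integral => //.
    exact: (measurable_section_fst w mk).
  have := integrable_ae mI iR; apply: filterS => u h _.
  rewrite /k/= !indicE; have [uI|uI] := boolP (u \in I); last by rewrite !mulr0.
  rewrite (memNset (A := E)) ?mulr0 ?mul0r ?mulr0// /E/= => e.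
  by have := h (set_mem uI); rewrite e.
apply/eqP; rewrite eq_le integral_ge0 ?andbT; last first.
  by move=> u _; apply: integral_ge0 => w _; rewrite lee_fin.
rewrite -rhs0 -tonelli integral_mkcond.
apply: ge0_le_integral => //.
- move=> u _; apply: erestrict_ge0 => t _; apply: integral_ge0 => w _.
  by rewrite lee_fin.
- by apply/(measurable_restrictT _ mI); apply: measurable_funTS; exact: measurable_slice.
- exact: (measurable_fun_fubini_tonelli_F k mk k0).
move=> u _; rewrite /patch; case: ifPn => uI; last by apply: integral_ge0.
have mYu (D : set W) : measurable_fun D (fun w => (Y u w)%:E).
  by apply/measurable_EFinP; exact: measurable_funTS.
have mF : measurable [set w | (lattice_mass (u, w) < +oo)%E].
  have m1 : measurable_fun setT (fun w => lattice_mass (u, w)).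
    exact: (measurable_section_snd u measurable_lattice_mass).
  have := emeasurable_fun_infty_o measurableT m1 +oo%E.
  by rewrite setTI.
rewrite -[leRHS]add0e -(finite_lattice_mass_null u).
rewrite integral_mkcond [X in (_ <= X + _)%E]integral_mkcond -ge0_integralD//; last 3 first.
- by move=> w _; apply: erestrict_ge0 => w' _; rewrite lee_fin.
- exact/(measurable_restrictT _ mF).
- exact: (measurable_section_snd u mk).
apply: ge0_le_integral => //.
- by move=> w _; apply: erestrict_ge0 => w' _; rewrite lee_fin.
- exact/(measurable_restrictT _ mB).
- apply: emeasurable_funD; first exact/(measurable_restrictT _ mF).
  exact: (measurable_section_snd u mk).
move=> w _; rewrite /patch /k/= !indicE uI mulr1.
case: (w \in B); last by rewrite mul0r mulr0 adde0; case: ifP; rewrite lee_fin.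
case: ifPn => [_|/negP hF]; first by rewrite leeDl// lee_fin mulr_ge0.
rewrite mem_set ?mulr1 ?add0e// /E/=.
by apply/eqP; rewrite -leye_eq leNgt; apply/negP => h; apply: hF; rewrite inE.
Qed.

End mass_positive.

Section mass_null.
Context (R : realType) (d : measure_display) (W : measurableType d)
  (P : probability W R) (Y : R -> W -> R).
Hypothesis mY : jointly_measurable Y.
Hypothesis Y0 : forall t w, 0 <= Y t w.
Hypothesis EY : forall t, (\int[P]_w (Y t w)%:E = 1)%E.
Hypothesis Ystat : max_stationary P Y.
Hypothesis Ycont : forall t eps, 0 < eps -> \forall s \near t,
  (\int[P]_w (Num.max (Y s w) (Y t w))%:E <= (1 + eps)%:E)%E.

Let mYt t : measurable_fun setT (Y t).
Proof. exact: jointly_measurable_section. Qed.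

Let mYE t (D : set W) : measurable_fun D (fun w => (Y t w)%:E).
Proof. by apply/measurable_EFinP; exact: measurable_funTS. Qed.

(* [E [Y t; B] - E [Y s; B] <= E (max (Y s, Y t) - Y s)]. *)
Lemma slice_near (B : set W) t eps : measurable B -> 0 < eps ->
  \forall s \near t,
    (\int[P]_(w in B) (Y t w)%:E <= \int[P]_(w in B) (Y s w)%:E + eps%:E)%E.
Proof.
move=> mB eps0; near=> s.
have hs : (\int[P]_w (Num.max (Y s w) (Y t w))%:E <= (1 + eps)%:E)%E.
  by near: s; exact: Ycont.
pose g w := Num.max (Y s w) (Y t w) - Y s w.
have g0 w : 0 <= g w by rewrite subr_ge0 le_max lexx.
have mg : measurable_fun setT g by apply: measurable_funB => //; exact: measurable_maxr.
have mgE (D : set W) : measurable_fun D (fun w => (g w)%:E).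
  by apply/measurable_EFinP; exact: measurable_funTS.
have gle : (\int[P]_w (g w)%:E <= eps%:E)%E.
  rewrite -(@leeD2lE _ 1%E)// -{1}(EY s) -ge0_integralD//; last 2 first.
  - by move=> w _; rewrite lee_fin.
  - by move=> w _; rewrite lee_fin.
  apply: le_trans hs; rewrite le_eqVlt; apply/orP; left; apply/eqP.
  by apply: eq_integral => w _; rewrite -EFinD /g addrC subrK.
apply: (@le_trans _ _ (\int[P]_(w in B) (Y s w)%:E + \int[P]_(w in B) (g w)%:E)%E); last first.
  rewrite leeD2l//; apply: le_trans gle; apply: ge0_subset_integral => //.
  by move=> w _; rewrite lee_fin.
rewrite -ge0_integralD//; last 2 first.
- by move=> w _; rewrite lee_fin.
- by move=> w _; rewrite lee_fin.
apply: ge0_le_integral => //.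
- by move=> w _; rewrite lee_fin.
- exact: emeasurable_funD.
by move=> w _; rewrite -EFinD lee_fin /g addrC subrK le_max lexx orbT.
Unshelve. all: by end_near. Qed.

Hypothesis dom0 : forall q : nat, dominated_mean P Y q.+1%:R = 0%E.

Notation B := [set w | (path_mass Y w < +oo)%E].

(** A positive slice at [t] would, by [slice_near], keep at least half its value on an interval to
    the right of [t], against the vanishing of its integral. *)
Lemma slice_mass_null t : (\int[P]_(w in B) (Y t w)%:E = 0)%E.
Proof.
have mB : measurable B by exact: measurable_path_mass_fin.
pose h u := (\int[P]_(w in B) (Y u w)%:E)%E.
have h0 u : (0 <= h u)%E by apply: integral_ge0 => w _; rewrite lee_fin.
have hfin u : h u \is a fin_num.
  rewrite ge0_fin_numE//; apply: (@le_lt_trans _ _ (\int[P]_w (Y u w)%:E)%E).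
    by apply: ge0_subset_integral => // w _; rewrite lee_fin.
  by rewrite EY ltry.
apply/eqP; rewrite eq_le h0 andbT leNgt; apply/negP => ht.
pose c := fine (h t) / 2.
have c0 : 0 < c by rewrite divr_gt0// fine_gt0// ht/= ltey_eq hfin.
have := slice_near t mB c0 => /nbhs_ballP[dl /= dl0 hdl].
(* Capped at 1 to remain inside the unit interval where the integral is known to vanish. *)
pose dl' := Num.min dl 1.
have dl'0 : 0 < dl' by rewrite lt_min dl0/=.
have mh : measurable_fun setT h by exact: measurable_slice.
have : (c%:E * dl'%:E <= 0)%E.
  rewrite -(mass_finite_slice_null mY Y0 EY Ystat dom0 t).
  apply: (@le_trans _ _ (\int[lebesgue_measure]_(u in `[t, (t + dl')%R[%classic) h u)%E).
    apply: (@le_trans _ _ (\int[lebesgue_measure]_(u in `[t, (t + dl')%R[%classic) (cst c%:E u))%E).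
      rewrite integral_cst//.
      apply: lee_wpmul2l; first by rewrite lee_fin ltW.
      apply: (@le_trans _ _ (lebesgue_measure (`[t, t + dl'[%classic : set R))) => //.
      rewrite lebesgue_measure_itv/= lte_fin ltrDl dl'0 -EFinB lee_fin.
      by rewrite addrAC subrr add0r.
    apply: ge0_le_integral => //.
    - by move=> u _; rewrite lee_fin ltW.
    - exact: measurable_funTS.
    move=> u /=; rewrite in_itv/= => /andP[tu ut].
    have := hdl u; rewrite /ball/= => hu.
    have {}hu : (h t <= h u + c%:E)%E.
      apply: hu; rewrite ler0_norm ?subr_le0// opprB ltrBlDl.
      by apply: lt_le_trans ut _; rewrite lerD2l ge_min lexx.
    move: hu; rewrite -(fineK (hfin t)) -(fineK (hfin u)) -EFinD !lee_fin.
    by rewrite {2}/c; rewrite /c; lra.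
  apply: ge0_subset_integral => //.
  - exact: measurable_funTS.
  move=> u /=; rewrite !in_itv/= => /andP[-> ut]/=; apply: lt_le_trans ut _.
  by rewrite lerD2l ge_min lexx orbT.
by rewrite -EFinM lee_fin leNgt mulr_gt0.
Qed.

Lemma mass_finite_null (a : nat -> R) : {ae P, forall w, exists i, Y (a i) w != 0} ->
  P B = 0%E.
Proof.
move=> nv; have mB : measurable B by exact: measurable_path_mass_fin.
have z i : {ae P, forall w, B w -> (Y (a i) w)%:E = 0%E}.
  apply/(ae_eq_integral_abs P mB (mYE (a i) (D := B))).
  rewrite -(slice_mass_null (a i)); apply: eq_integral => w _.
  by rewrite gee0_abs ?lee_fin.
have : {ae P, forall w, ~ B w}.
  have := ae_foralln z; apply: filterS2 nv => w [i Yi] h Bw.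
  by have [] := h i Bw => e; rewrite e eqxx in Yi.
move=> [N [mN PN hN]]; apply: (subset_measure0 mB mN) => // w Bw.
by apply: hN => /=; exact.
Qed.

End mass_null.

Lemma dominated_mean_le_peak (R : realType) (d : measure_display) (W : measurableType d)
    (P : probability W R) (Y : R -> W -> R) (l : \bar R) (q : R) :
  jointly_measurable Y -> (forall t w, 0 <= Y t w) ->
  (forall t, (\int[P]_w (Y t w)%:E = 1)%E) -> max_stationary P Y ->
  ((T^-1)%:E * sup_mean P Y T)%E @[T --> +oo] --> l -> 0 < q ->
  (0 < dominated_mean P Y q)%E -> (0 < l)%E.
Proof.
move=> mY Y0 EY Ystat lim q0 c0.
have cE : dominated_mean P Y q \is a fin_num.
  rewrite ge0_fin_numE ?ltW//.
  apply: (@le_lt_trans _ _ (\int[P]_w (Y 0 w)%:E)%E); last by rewrite EY ltry.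
  have mY0 := jointly_measurable_section 0 mY.
  apply: ge0_subset_integral => //.
  - by apply: measurable_shift_preimage; [move=> t; exact: jointly_measurable_section|
      exact: measurable_dominated_path].
  - exact/measurable_EFinP.
  - by move=> w _; rewrite lee_fin.
move: c0; rewrite -(fineK cE) lte_fin; set c := fine _ => c0.
(* The factor 2 pays for rounding [T] down to [n]: for T >= 2 one has T <= 2 n. *)
apply: (@lt_le_trans _ _ (c / (2 * q))%:E).
  by rewrite lte_fin divr_gt0// mulr_gt0.
apply: (cvge_to_ge lim); near=> T.
have T2 : 2 <= T by near: T; apply: nbhs_pinfty_ge; exact: num_real.
have T0 : 0 < T by exact: lt_le_trans T2.
set n := Num.truncn T.
have /andP[nT Tn] : n%:R <= T < n.+1%:R by apply: truncn_itv; exact: ltW.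
have n0 : (0 < n)%N by rewrite -(ltr_nat R); rewrite -natr1 in Tn; lra.
have := dominated_mean_le mY Y0 EY Ystat (ltW q0) n0 nT.
rewrite lee_pdivlMl// -(fineK cE) -/c; case: (sup_mean P Y T) => [s| |].
- rewrite -!EFinM !lee_fin => h; rewrite mulrA ler_pdivrMr ?mulr_gt0//.
  have : T * c <= 2 * (n%:R * c).
    rewrite mulrA ler_pM2r//; rewrite -natr1 in Tn; lra.
  by move=> h2; apply: le_trans h2 _; nra.
- by rewrite leey.
- by rewrite mulrNy gtr0_sg// mul1e leeNy_eq.
Unshelve. all: by end_near. Qed.

(** * From separable paths to countably many times *)

Lemma countable_enumeration (R : realType) (D : set R) : countable D -> D !=set0 ->
  exists a : nat -> R, (forall i, D (a i)) /\ (forall x, D x -> exists i, a i = x).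
Proof.
move=> /countable_injP[f finj] [x0 Dx0].
pose a n := xget x0 [set x | D x /\ f x = n].
exists a; split=> [i|x Dx].
  by rewrite /a; case: xgetP => [x _ []|].
exists (f x); rewrite /a; case: xgetP => [y -> [Dy fy]|/(_ x)[]//].
by apply: finj; rewrite ?inE.
Qed.

Section separable_paths.
Context (R : realType) (alpha : R) (d : measure_display) (W : measurableType d)
  (P : probability W R) (Z : R -> W -> R).
Hypothesis alpha0 : 0 < alpha.
Hypothesis Z0 : forall t w, 0 <= Z t w.
Variables (D : set R) (a : nat -> R).
Hypothesis aD : forall x, D x -> exists i, a i = x.
Hypothesis Zsep : {ae P, forall w, forall I F : set R, open I -> closed F ->
  (forall s, (I `&` D) s -> F (Z s w)) -> forall t, I t -> F (Z t w)}.

Let Y t w := Z t w `^ alpha.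
Let e i := a i - (Num.floor (a i))%:~R.

Lemma separable_window_bound : {ae P, forall w, forall (n : nat) t, 0 <= t < n%:R ->
  ((Y t w)%:E <= Wmax Y e (- 1) n.+1 w)%E}.
Proof.
apply: filterS Zsep => w sep n t /andP[t0 tn].
have W0 : (0 <= Wmax Y e (- 1) n.+1 w)%E by exact: Wmax_ge0.
case ME : (Wmax Y e (- 1) n.+1 w) => [m| |]; [|by rewrite leey|by rewrite ME in W0].
rewrite ME lee_fin in W0.
(* Separability concerns [Z], so a bound [m] on [Y] is rewritten as a closed half-line for [Z]. *)
have le_root z : 0 <= z -> (z <= m `^ alpha^-1) = (z `^ alpha <= m).
  move=> z0; apply/idP/idP => h.
    have := @ge0_ler_powR _ alpha (ltW alpha0) _ _ _ _ h.
    rewrite !nnegrE z0 powR_ge0 => /(_ erefl erefl).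
    by rewrite -powRrM mulVf ?gt_eqF// powRr1.
  have ai : 0 <= alpha^-1 by rewrite invr_ge0 ltW.
  have := @ge0_ler_powR _ alpha^-1 ai _ _ _ _ h.
  rewrite !nnegrE W0 powR_ge0 => /(_ erefl erefl).
  by rewrite -powRrM mulfV ?gt_eqF// powRr1.
rewrite lee_fin -le_root//.
have := sep `]-1, n%:R[%classic [set x | x <= m `^ alpha^-1] (itv_open _ _)
  (@closed_le R (m `^ alpha^-1)).
move=> h; apply: (h _ t); last by rewrite /= in_itv/= tn andbT (lt_le_trans _ t0)// ltrN10.
move=> s [] /=; rewrite !in_itv/= => /andP[s1 sn] Ds.
rewrite le_root// -lee_fin -ME.
have [i ais] := aD Ds.
pose k := Num.floor s.
have /andP[ks sk] := floor_itv s.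
have k1 : (-1 <= k)%R by rewrite /k real_floor_ge_int ?num_real// intrN; exact: ltW.
have kn : (k < n%:Z)%R by rewrite -(ltr_int R); exact: le_lt_trans sn.
have [j jk] : exists j : 'I_n.+1, (- 1 + j%:Z = k)%R.
  have hj : (absz (k + 1)%R < n.+1)%N by lia.
  by exists (Ordinal hj) => /=; lia.
apply: (@le_trans _ _ (Wsup Y e (- 1 + j%:Z) w)).
  apply: ereal_sup_ubound; exists i => //=.
  by rewrite jk /e ais /k subrK.
exact: (@le_bigmax_seq _ _ _ _ 0%E j xpredT (fun k : 'I_n.+1 => Wsup Y e (- 1 + k%:Z) w)
  (mem_index_enum j) isT).
Qed.

(** Separability with the whole line and the closed set {0}: a path vanishing on the separating set
    vanishes everywhere. *)
Lemma separable_nonvanishing : nonvanishing_paths P Z ->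
  {ae P, forall w, exists i, Y (a i) w != 0}.
Proof.
move=> nv; apply: filterS2 nv Zsep => w [t Zt] sep.
apply: contrapT => /forallNP h.
have := sep setT [set x | x = 0] openT (@closed_eq R 0) => Z00.
move/eqP: Zt; apply; apply: (Z00 _ t) => // s [_ Ds] /=.
have [i ais] := aD Ds; have /negP := h i; rewrite negbK -ais => /eqP.
exact: powR_eq0_eq0.
Qed.

End separable_paths.

Theorem mainTheorem3 (R : realType) (alpha : R)
    (dX : measure_display) (WX : measurableType dX) (PX : probability WX R)
    (X : R -> WX -> R)
    (dZ : measure_display) (WZ : measurableType dZ) (PZ : probability WZ R)
    (Z : R -> WZ -> R)
    (halpha : 0 < alpha)
    (Xregular : regular_process PX X)
    (Xcontinuous : stochastically_continuous PX X)
    (Xstationary : stationary PX X)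
    (Xmax_stable : max_stable PX X)
    (Xfrechet : frechet_marginals PX alpha X)
    (Zregular : regular_process PZ Z)
    (Zspectral : spectral_process alpha PX X PZ Z)
    (Znonvanishing : nonvanishing_paths PZ Z) :
  (0 < pickands_constant PZ alpha Z)%E <->
  (0 < PZ [set w | path_integral alpha Z w < +oo])%E.
Proof.
have [mX _ Xbounded] := Xregular.
have [mZ [D [cD dD Zsep]] _] := Zregular.
have Z0 := Zspectral.1.
have [x0 [_ Dx0]] : (setT `&` D) !=set0 by apply: dD; [exists 0|exact: openT].
have [a [aD Da]] := countable_enumeration cD (ex_intro _ x0 Dx0).
pose Y t w := Z t w `^ alpha.
pose e i := a i - (Num.floor (a i))%:~R.
have Y0 t w : 0 <= Y t w by exact: powR_ge0.
have mY : jointly_measurable Y.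
  exact: (measurableT_comp (measurable_powR alpha) mZ).
have mYt t : measurable_fun setT (Y t) by exact: jointly_measurable_section.
have EY t : (\int[PZ]_w (Y t w)%:E = 1)%E.
  exact: (spectral_mean1 halpha mZ Zspectral).
have Ystat : max_stationary PZ Y.
  exact: (spectral_max_stationary halpha mZ Zspectral).
have Ycont t eps : 0 < eps -> \forall s \near t,
    (\int[PZ]_w (Num.max (Y s w) (Y t w))%:E <= (1 + eps)%:E)%E.
  by move=> eps0; exact: (spectral_max_near halpha mX mZ Zspectral).
have e01 i : 0 <= e i < 1.
  have /andP[h1 h2] := floor_itv (a i); rewrite /e subr_ge0 h1/= ltrBlDr.
  by move: h2; rewrite intrD addrC.
have supY : (\int[PZ]_w ereal_sup (range (fun i => (Y (e i) w)%:E)) < +oo)%E.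
  apply: (spectral_sup_finite halpha mX mZ Zspectral Xbounded) => i.
  by have /andP[-> /ltW] := e01 i.
have sep := separable_window_bound halpha Z0 Da Zsep.
have lim := sup_mean_limit mYt Y0 EY Ystat supY e01 sep.
have HE : pickands_constant PZ alpha Z = Wpeak PZ Y e setT by exact: cvg_lim lim.
rewrite HE; split; first exact: peak_mass_finite.
move=> pos.
(* If all c_q vanished, the mass would be almost surely infinite, against [pos]; one nonzero c_q
   already bounds the limit away from 0. *)
have [q q0] : exists q : nat, dominated_mean PZ Y q.+1%:R != 0%E.
  apply: contrapT => /forallNP h.
  have dom0 q : dominated_mean PZ Y q.+1%:R = 0%E by apply/eqP/negPn/negP; exact: h.
  have := mass_finite_null mY Y0 EY Ystat Ycont dom0
    (separable_nonvanishing alpha Da Zsep Znonvanishing).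
  by move=> e0; move: pos; rewrite [X in (_ < X)%E]e0 ltxx.
apply: (dominated_mean_le_peak mY Y0 EY Ystat lim (ltr0Sn _ q)).
by rewrite lt0e q0 integral_ge0// => w _; rewrite lee_fin.
Qed.
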